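(* Let $\lambda > -1$, a partition $\boldsymbol{k} \in \mathbb{Z}_+^m$ of $n$ with $m\geq 2$, and $j\in\{1,\dots,m\}$ be given. If $T\in\mathrm{End}_{\mathrm{U}(\boldsymbol{k},j,\mathbb{T})}(\mathcal{A}^2_\lambda(\mathbb{B}^n))$, then for every $\boldsymbol{\kappa}\in\mathbb{N}^m$ we have \[ T(\mathcal{P}_{\boldsymbol{\kappa}}(\mathbb{C}^n))\subset\mathcal{P}_{\boldsymbol{\kappa}}(\mathbb{C}^n), \] and there exists a linear map $M_{\lambda,T}(\boldsymbol{\kappa},j)\in\mathrm{End}(\mathcal{P}_{\kappa_j}(\mathbb{C}^{k_j}))$ such that \[ T|_{\mathcal{P}_{\boldsymbol{\kappa}}(\mathbb{C}^n)} = U_{\boldsymbol{\kappa}}\circ(I_{1}\otimes\dots\otimes I_{j-1}\otimes M_{\lambda,T}(\boldsymbol{\kappa},j)\otimes I_{j+1}\otimes\dots\otimes I_{m})\circ U_{\boldsymbol{\kappa}}^{-1}, \] where $I_l$ is the identity map of $\mathcal{P}_{\kappa_l}(\mathbb{C}^{k_l})$ and $U_{\boldsymbol{\kappa}}:\bigotimes_{l=1}^m\mathcal{P}_{\kappa_l}(\mathbb{C}^{k_l})\to\mathcal{P}_{\boldsymbol{\kappa}}(\mathbb{C}^n)$ is the linear isomorphism determined by $U_{\boldsymbol{\kappa}}(p_1\otimes\dots\otimes p_m)(z)=p_1(z_{(1)})\cdots p_m(z_{(m)})$.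
   Context: Here $\mathbb{N}=\{0,1,2,\dots\}$ and $\mathbb{Z}_+$ is the set of positive integers. $\mathbb{B}^n$ is the open unit ball of $\mathbb{C}^n$ with Lebesgue measure $v$. For $\lambda>-1$, $dv_\lambda(z) = c_\lambda (1-|z|^2)^\lambda dv(z)$ with $c_\lambda = \frac{\Gamma(n+\lambda+1)}{\pi^n\Gamma(\lambda+1)}$, and $\mathcal{A}^2_\lambda(\mathbb{B}^n)$ is the closed subspace of holomorphic functions in $L^2(\mathbb{B}^n,v_\lambda)$. $\pi_\lambda$ is the unitary representation of $\mathrm{U}(n)$ on $\mathcal{A}^2_\lambda(\mathbb{B}^n)$ given by $\pi_\lambda(A)f=f\circ A^{-1}$. For a subgroup $H\subset\mathrm{U}(n)$, $\mathrm{End}_H(\mathcal{A}^2_\lambda(\mathbb{B}^n))$ is the algebra of bounded operators $T$ with $T\pi_\lambda(A)=\pi_\lambda(A)T$ for all $A\in H$. A partition of $n$ is $\boldsymbol{k}=(k_1,\dots,k_m)\in\mathbb{Z}_+^m$ with $k_1+\dots+k_m=n$. It gives $\mathbb{C}^n=\mathbb{C}^{k_1}\times\dots\times\mathbb{C}^{k_m}$, $z=(z_{(1)},\dots,z_{(m)})$ and, for multi-indices, $\alpha=(\alpha_{(1)},\dots,\alpha_{(m)})\in\mathbb{N}^n$ with $\alpha_{(l)}\in\mathbb{N}^{k_l}$. For $j\in\{1,\dots,m\}$, $\mathrm{U}(\boldsymbol{k},j,\mathbb{T}) = \mathrm{U}(k_1)\times\dots\times\mathrm{U}(k_{j-1})\times\mathbb{T}I_{(j)}\times\mathrm{U}(k_{j+1})\times\dots\times\mathrm{U}(k_m)$,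 embedded block diagonally in $\mathrm{U}(n)$, with $I_{(j)}$ the identity of $\mathbb{C}^{k_j}$. For $\boldsymbol{\kappa}\in\mathbb{N}^m$, $\mathcal{P}_{\boldsymbol{\kappa}}(\mathbb{C}^n)$ is the linear span of the monomials $z^\alpha$ with $|\alpha_{(l)}|=\kappa_l$ for all $l$. $\mathcal{P}_{\kappa}(\mathbb{C}^{k})$ is the space of homogeneous holomorphic polynomials of degree $\kappa$ on $\mathbb{C}^k$. *)

(* Defs.v *)
From HB Require Import structures.
From mathcomp Require Import all_boot all_order all_algebra.
From mathcomp Require Import boolp.
From mathcomp Require mpoly.

Set Implicit Arguments.
Unset Strict Implicit.
Unset Printing Implicit Defensive.

Import Order.TTheory GRing.Theory Num.Theory.
Local Open Scope ring_scope.

(* Tensor product of a finite family of finite dimensional vector spaces, in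
   coordinates with respect to the bases vbasis {:V i}; [tlift_pure] and
   [tensor_ext] are its universal property. *)
Section Tensor.
Variables (K : fieldType) (I : finType).

Definition multilinear (V : I -> vectType K) (W : lmodType K)
    (phi : (forall i, V i) -> W) :=
  forall (v : forall i, V i) (i : I) (a : K) (x y : V i),
    phi (dfwith v (a *: x + y)) = a *: phi (dfwith v x) + phi (dfwith v y).

Variable V : I -> vectType K.

Definition tindex := {dffun forall i : I, 'I_(\dim {:V i})}.

Definition tensor := {ffun tindex -> K^o}.
HB.instance Definition _ := Vector.on tensor.

Definition tbasis (f : tindex) (i : I) : V i := (vbasis {:V i})`_(f i).

Definition pure (v : forall i, V i) : tensor :=
  [ffun f : tindex => \prod_i coord (vbasis {:V i}) (f i) (v i)].

Section Lift.
Variables (W : vectType K) (phi : (forall i, V i) -> W).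

Definition tlift_fun (t : tensor) : W := \sum_f t f *: phi (tbasis f).

Fact tlift_fun_linear : linear tlift_fun.
Proof.
move=> a s t; rewrite /tlift_fun scaler_sumr -big_split /=.
by apply: eq_bigr => f _; rewrite !ffunE scalerA -scalerDl.
Qed.
HB.instance Definition _ :=
  GRing.isLinear.Build K tensor W _ tlift_fun tlift_fun_linear.

Definition tlift : 'Hom(tensor, W) := linfun tlift_fun.
End Lift.

Lemma dfwith_id (v : forall i, V i) i : dfwith v (v i) = v.
Proof. by apply: functional_extensionality_dep => i'; case: dfwithP. Qed.

Lemma multilinear_ext (W : lmodType K) (phi psi : (forall i, V i) -> W)
    (B : forall i, seq (V i)) :
    multilinear phi -> multilinear psi ->
    (forall i (x : V i), x \in <<B i>>%VS) ->
    (forall v : forall i, V i, (forall i, v i \in B i) -> phi v = psi v) ->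
  phi =1 psi.
Proof.
move=> mphi mpsi spanB eqB.
have lin (chi : (forall i, V i) -> W) (mchi : multilinear chi) v i :
    exists2 g : {linear V i -> W}, True & forall x, chi (dfwith v x) = g x.
  have lg : linear (fun x : V i => chi (dfwith v x)).
    by move=> a x y; exact: mchi.
  pose g := GRing.isLinear.Build K (V i) W _ _ lg.
  by exists (HB.pack_for {linear V i -> W}
    (fun x : V i => chi (dfwith v x)) g).
suff H (s : seq I) (v : forall i, V i) :
    (forall i, i \notin s -> v i \in B i) -> phi v = psi v.
  by move=> v; apply: (H (enum I)) => i; rewrite mem_enum.
elim: s v => [|i s IH] v vB; first by apply: eqB => i; exact: vB.
rewrite -(dfwith_id v i).
have [g _ gE] := lin _ mphi v i; have [h _ hE] := lin _ mpsi v i.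
rewrite gE hE.
have /coord_span -> : v i \in <<in_tuple (B i)>>%VS by exact: spanB.
rewrite !linear_sum /=; apply: eq_bigr => j _.
rewrite !linearZ /= -gE -hE; congr (_ *: _); apply: IH => i'.
case: dfwithP => [|i'' ii''] i's; first by rewrite mem_nth.
by apply: vB; rewrite inE negb_or eq_sym ii''.
Qed.

Lemma pure_multilinear : multilinear pure.
Proof.
move=> v i a x y; apply/ffunP => f; rewrite !ffunE.
rewrite !(bigD1 (P := predT) i) //= !dfwith_in.
rewrite linearP /= mulrDl -mulrA; congr (_ * (_ * _) + _ * _);
  by apply: eq_bigr => i' ii'; rewrite !dfwith_out // eq_sym.
Qed.

Lemma pure_tbasis f g : pure (tbasis f) g = (f == g)%:R.
Proof.
rewrite ffunE; have [<-|fg] := eqVneq f g.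
  rewrite big1 // => i _; rewrite /tbasis coord_free ?eqxx //.
  exact: basis_free (vbasisP _).
have [i fgi] : exists i, f i != g i.
  apply/existsP; apply: contraR fg; rewrite negb_exists => /forallP fg.
  by apply/eqP/ffunP => i; apply/eqP; move: (fg i); rewrite negbK.
rewrite (bigD1 i) //= /tbasis coord_free ?(basis_free (vbasisP _)) //.
by rewrite [_ == _](negbTE _) ?mul0r // eq_sym.
Qed.

Lemma tensor_ext (W : vectType K) (f g : 'Hom(tensor, W)) :
  (forall v, f (pure v) = g (pure v)) -> f = g.
Proof.
move=> fg; apply/lfunP => t.
have -> : t = \sum_h (t h : K) *: pure (tbasis h) :> tensor.
  apply/ffunP => h; rewrite sum_ffunE (bigD1 h) //= ffunE pure_tbasis eqxx.
  rewrite big1 ?addr0 => [|h' hh']; first by rewrite [_ *: _]mulr1.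
  by rewrite ffunE pure_tbasis (negbTE hh') scaler0.
by rewrite !linear_sum; apply: eq_bigr => h _; rewrite !linearZ /= fg.
Qed.

Lemma tlift_pure (W : vectType K) (phi : (forall i, V i) -> W) :
  multilinear phi -> forall v, tlift phi (pure v) = phi v.
Proof.
move=> mphi.
apply: (@multilinear_ext W _ _ (fun i => vbasis {:V i})) => //.
- by move=> v i a x y; rewrite pure_multilinear linearP.
- by move=> i x; rewrite (span_basis (vbasisP _)) memvf.
move=> v vB; pose f : tindex := [ffun i => cast_ord (size_tuple (vbasis {:V i}))
  (Ordinal (etrans (index_mem _ _) (vB i)))].
have -> : v = tbasis f.
  apply: functional_extensionality_dep => i.
by rewrite /tbasis ffunE /= nth_index //; exact: vB.
rewrite lfunE /= /tlift_fun (bigD1 f) //=.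
rewrite pure_tbasis eqxx scale1r big1 ?addr0 // => g gf.
by rewrite pure_tbasis eq_sym (negbTE gf) scale0r.
Qed.

Definition tmap (f : forall i, 'End(V i)) : 'End(tensor) :=
  tlift (fun v => pure (fun i => f i (v i))).

Lemma tmap_pure f v : tmap f (pure v) = pure (fun i => f i (v i)).
Proof.
rewrite /tmap tlift_pure // => w i a x y.
have E (z : V i) : pure (fun i' => f i' (dfwith w z i')) =
    pure (dfwith (fun i' => f i' (w i')) (f i z)).
  congr pure; apply: functional_extensionality_dep => i'.
  by case: dfwithP => [|i'' ne]; rewrite ?dfwith_in ?dfwith_out.
by rewrite !E linearP pure_multilinear.
Qed.

End Tensor.

Module HomogeneousPolynomials.
Import mpoly.

(* Linear span, in {mpoly K[n]}, of the monomials with exponents in s. *)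
Section Mspan.
Variables (K : fieldType) (n : nat) (s : seq 'X_{1..n}).

Definition mspan_pred : pred {mpoly K[n]} :=
  fun p => all (mem s) (msupp p).

Fact mspan_submod_closed : submod_closed mspan_pred.
Proof.
split=> [|a p q /allP ps /allP qs]; first by rewrite /in_mem /= /mspan_pred msupp0.
by apply/allP => m /msuppD_le; rewrite mem_cat => /orP[/msuppZ_le/ps|/qs].
Qed.
HB.instance Definition _ :=
  GRing.isSubmodClosed.Build K {mpoly K[n]} mspan_pred mspan_submod_closed.

Record mspan := MSpan { mspan_val :> {mpoly K[n]}; _ : mspan_val \in mspan_pred }.

HB.instance Definition _ := [isSub for mspan_val].
HB.instance Definition _ := [Choice of mspan by <:].
HB.instance Definition _ := [SubChoice_isSubLmodule of mspan by <:].

Definition mspanX (m : 'X_{1..n}) : mspan := insubd 0 'X_[m].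

Lemma mspanXE m : m \in s -> mspanX m = 'X_[m] :> {mpoly K[n]}.
Proof.
move=> ms; rewrite insubdK //.
by apply/allP => m'; rewrite msuppX inE => /eqP ->.
Qed.

Lemma mspan_val_linear : linear mspan_val. Proof. by []. Qed.
HB.instance Definition _ :=
  GRing.isLinear.Build K mspan {mpoly K[n]} _ mspan_val mspan_val_linear.

Lemma mspan_valZ (a : K) (p : mspan) : mspan_val (a *: p) = a *: mspan_val p.
Proof. by []. Qed.

Lemma mspanE (p : mspan) : p = \sum_(m <- undup s) p@_m *: mspanX m.
Proof.
apply: (@val_inj _ _ mspan); apply/mpolyP => m.
rewrite [in RHS](linear_sum mspan_val) raddf_sum.
transitivity (\sum_(m' <- undup s) p@_m' * (m' == m)%:R).
  have [ms|ms] := boolP (m \in s).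
    rewrite (bigD1_seq m) ?mem_undup ?undup_uniq //= eqxx mulr1 big1 ?addr0 //.
    by move=> m' /negbTE ->; rewrite mulr0.
  rewrite big_seq big1 => [|m'].
    apply/eqP; rewrite mcoeff_eq0; apply: contra ms.
    by apply/allP; case: (p).
  rewrite mem_undup => m's; case: eqP => [m'm|]; last by rewrite mulr0.
  by rewrite -m'm m's in ms.
rewrite !big_seq; apply: eq_bigr => m'; rewrite mem_undup => m's.
rewrite -[RHS]/(p@_m' *: mspan_val (mspanX m'))@_m.
by rewrite mcoeffZ mspanXE // mcoeffX.
Qed.

Fact mspan_vector_axiom : Vector.axiom (size (undup s)) mspan.
Proof.
exists (fun p : mspan => \row_i p@_(nth 0%MM (undup s) i)).
  by move=> a p q; apply/rowP => i; rewrite !mxE mcoeffD mcoeffZ.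
exists (fun r : 'rV_(size (undup s)) =>
    \sum_i r 0 i *: mspanX (nth 0%MM (undup s) i)) => [p|r].
  rewrite [RHS]mspanE (big_nth 0%MM) big_mkord.
  by apply: eq_bigr => i _; rewrite mxE.
apply/rowP => i; rewrite mxE (linear_sum mspan_val) raddf_sum (bigD1 i) //= big1.
  rewrite addr0 -[LHS]/(r 0 i *: mspan_val (mspanX (nth 0%MM (undup s) i)))@_(nth 0%MM (undup s) i).
 rewrite mcoeffZ mspanXE ?mcoeffX ?eqxx ?mulr1 ?addr0 //.
  by rewrite -mem_undup mem_nth.
move=> i' i'i.
rewrite -[LHS]/(r 0 i' *: mspan_val (mspanX (nth 0%MM (undup s) i')))@_(nth 0%MM (undup s) i).
rewrite mcoeffZ mspanXE; last by rewrite -mem_undup mem_nth.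
by rewrite mcoeffX nth_uniq ?undup_uniq // [_ == _](negbTE i'i) mulr0.
Qed.
HB.instance Definition _ := Lmodule_hasFinDim.Build K mspan mspan_vector_axiom.

End Mspan.

Definition homog_exponents (k d : nat) : seq 'X_{1..k} :=
  [seq bmnm m | m in [pred m : 'X_{1..k < d.+1} | mdeg m == d]].

Lemma mem_homog_exponents k d m : (m \in homog_exponents k d) = (mdeg m == d).
Proof.
apply/imageP/idP => [[m' m'd ->] //|md].
have mb : (mdeg m < d.+1)%N by rewrite (eqP md).
by exists (BMultinom mb).
Qed.

Section MultiHomogeneous.
Variables (m : nat) (k kappa : 'I_m -> nat).
Local Notation N := (\sum_l k l)%N.

Definition mblock (l : 'I_m) (a : 'X_{1..N}) : 'X_{1..k l} :=
  [multinom a (tagnat.Rank l i) | i < k l].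

Definition mhomog_exponents : seq 'X_{1..N} :=
  [seq bmnm a | a in [pred a : 'X_{1..N < (\sum_l kappa l)%N.+1}
     | [forall l, mdeg (mblock l a) == kappa l]]].

Lemma mdeg_mblock a : mdeg a = (\sum_l mdeg (mblock l a))%N.
Proof.
rewrite mdegE (reindex _ tagnat.rank_bij_on) /=.
transitivity (\sum_l \sum_(i < k l) a (tagnat.Rank l i))%N.
  by rewrite sig_big_dep /=; apply: eq_bigr => -[].
by apply: eq_bigr => l _; rewrite mdegE; apply: eq_bigr => i _; rewrite mnmE.
Qed.

Lemma mem_mhomog_exponents a :
  (a \in mhomog_exponents) = [forall l, mdeg (mblock l a) == kappa l].
Proof.
apply/imageP/idP => [[a' a'P ->] //|aP].
have da : mdeg a = (\sum_l kappa l)%N.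
  by rewrite mdeg_mblock; apply: eq_bigr => l _; apply/eqP; move/forallP: aP.
have ab : (mdeg a < (\sum_l kappa l).+1)%N by rewrite da.
by exists (BMultinom ab).
Qed.


Definition mjoin (a : forall l, 'X_{1..k l}) : 'X_{1..N} :=
  [multinom a (tag (tagnat.sig i)) (tagged (tagnat.sig i)) | i < N].

Lemma mjoinK a l : mblock l (mjoin a) = a l.
Proof. by apply/mnmP => i; rewrite !mnmE /tagnat.Rank tagnat.rankK. Qed.

Lemma mblockK a : mjoin (mblock^~ a) = a.
Proof. by apply/mnmP => i; rewrite !mnmE -tagnat.rankE tagnat.sigK. Qed.

Variable K : fieldType.

Definition homog_poly (n d : nat) := mspan K (homog_exponents n d).
HB.instance Definition _ n d := Vector.on (homog_poly n d).

Definition mhomog_poly := mspan K mhomog_exponents.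
HB.instance Definition _ := Vector.on mhomog_poly.

(* The polynomial z |-> p (z_(l)), see [meval_block_poly]. *)
Definition block_poly l (p : {mpoly K[k l]}) : {mpoly K[N]} :=
  p \mPo [tuple 'X_(tagnat.Rank l i) | i < k l].

Lemma meval_block_poly l (p : {mpoly K[k l]}) v :
  meval v (block_poly p) = meval (fun i => v (tagnat.Rank l i)) p.
Proof.
rewrite /block_poly comp_mpoly_meval; apply: meval_eq => i.
by rewrite tnth_mktuple mevalXU.
Qed.

Lemma prod_block_polyX (a : forall l, 'X_{1..k l}) :
  \prod_l block_poly 'X_[a l] = 'X_[mjoin a].
Proof.
rewrite mpolyXE_id (reindex _ tagnat.rank_bij_on) /=.
transitivity (\prod_l \prod_(i < k l)
    ('X_(tagnat.Rank l i) ^+ (a l i) : {mpoly K[N]})).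
  apply: eq_bigr => l _; rewrite /block_poly comp_mpolyX.
  by apply: eq_bigr => i _; rewrite tnth_mktuple.
rewrite sig_big_dep /=; apply: eq_bigr => -[l i] _.
by rewrite mnmE tagnat.rankK.
Qed.

Definition homog_factor (l : 'I_m) : vectType K := homog_poly (k l) (kappa l).
Local Notation V := homog_factor.

Let block_prod (p : forall l, V l) : {mpoly K[N]} :=
  \prod_l block_poly (p l).

Fact block_prod_multilinear : multilinear block_prod.
Proof.
move=> v l a x y.
have E (z : V l) : block_prod (dfwith v z) =
    block_poly z * \prod_(i | i != l) block_poly (v i).
  rewrite /block_prod [LHS](bigD1 l) //= dfwith_in; congr (_ * _).
  by apply: eq_bigr => i il; rewrite dfwith_out // eq_sym.
rewrite !E scalerAl -mulrDl; congr (_ * _).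
by rewrite /block_poly -comp_mpolyZ -comp_mpolyD.
Qed.

Lemma homog_poly_span l (x : V l) :
  x \in <<[seq (mspanX K (homog_exponents (k l) (kappa l)) a : V l)
           | a <- homog_exponents (k l) (kappa l)]>>%VS.
Proof.
rewrite {1}(mspanE x) [X in X \in _]big_seq; apply: rpred_sum => a; rewrite mem_undup => ha.
by apply: rpredZ; apply: memv_span; exact: map_f.
Qed.

Lemma block_prod_homog p : block_prod p \in mspan_pred mhomog_exponents.
Proof.
pose pr (q : {mpoly K[N]}) : {mpoly K[N]} :=
  \sum_(a <- undup mhomog_exponents) q@_a *: 'X_[a].
have prP q : pr q \in mspan_pred mhomog_exponents.
  rewrite /pr [X in X \in _]big_seq; apply: rpred_sum => a; rewrite mem_undup => ha.
  by apply: rpredZ; apply/allP => a'; rewrite msuppX inE => /eqP ->.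
suff -> : block_prod p = pr (block_prod p) by exact: prP.
move: p; apply: (@multilinear_ext _ _ V _ _ (pr \o block_prod)
    (fun l => [seq (mspanX K (homog_exponents (k l) (kappa l)) a : V l)
               | a <- homog_exponents (k l) (kappa l)])).
- exact: block_prod_multilinear.
- move=> v l a x y; rewrite /= block_prod_multilinear /pr scaler_sumr -big_split.
  by apply: eq_bigr => b _; rewrite /= mcoeffD mcoeffZ scalerA -scalerDl.
- exact: homog_poly_span.
move=> v vX /=; suff [a ah ->] : exists2 a, a \in mhomog_exponents &
    block_prod v = 'X_[a].
  rewrite /pr (bigD1_seq a) ?mem_undup ?undup_uniq //= mcoeffX eqxx scale1r.
  rewrite [X in _ + X]big1 ?addr0 // => b ba.
  by rewrite mcoeffX eq_sym (negbTE ba) scale0r.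
have /fin_all_exists2[a ah aE] l := mapP (vX l).
exists (mjoin a).
  rewrite mem_mhomog_exponents; apply/forallP => l.
  by rewrite mjoinK -mem_homog_exponents; exact: ah.
rewrite -prod_block_polyX; apply: eq_bigr => l _; congr block_poly.
by rewrite aE mspanXE.
Qed.

Definition poly_prod (p : forall l, V l) : mhomog_poly :=
  MSpan (block_prod_homog p).

Lemma meval_poly_prod (p : forall l, V l) v :
  meval v (poly_prod p) = \prod_l meval (fun i => v (tagnat.Rank l i)) (p l).
Proof.
rewrite /= (rmorph_prod (meval v)); apply: eq_bigr => l _.
exact: meval_block_poly.
Qed.

Lemma poly_prod_multilinear : multilinear poly_prod.
Proof. by move=> v l a x y; apply: val_inj; exact: block_prod_multilinear. Qed.

(* The isomorphism U_kappa, determined by [poly_tensor_pure] and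
   [meval_poly_prod]. By [poly_tensor_bij], (poly_tensor^-1)%VF is its
   inverse. *)
Definition poly_tensor : 'Hom(tensor V, mhomog_poly) := tlift poly_prod.

Lemma poly_tensor_pure (p : forall l, V l) : poly_tensor (pure p) = poly_prod p.
Proof. by rewrite tlift_pure //; exact: poly_prod_multilinear. Qed.

Let XV (a : 'X_{1..N}) : tensor V :=
  pure (fun l => mspanX K (homog_exponents (k l) (kappa l)) (mblock l a) : V l).

Let U' (p : mhomog_poly) : tensor V :=
  \sum_(a <- undup mhomog_exponents) mcoeff a p *: XV a.

Let poly_prodX (a : forall l, 'X_{1..k l}) :
  (forall l, a l \in homog_exponents (k l) (kappa l)) ->
  poly_prod (fun l => mspanX K _ (a l)) = mspanX K _ (mjoin a).
Proof.
move=> ah; apply: val_inj; rewrite /= mspanXE; last first.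
  rewrite mem_mhomog_exponents; apply/forallP => l.
  by rewrite mjoinK -mem_homog_exponents; exact: ah.
rewrite -prod_block_polyX; apply: eq_bigr => l _; congr block_poly.
by rewrite mspanXE //; exact: ah.
Qed.

Lemma poly_tensor_bij : bijective poly_tensor.
Proof.
have blockh a l : a \in mhomog_exponents ->
    mblock l a \in homog_exponents (k l) (kappa l).
  by rewrite mem_mhomog_exponents mem_homog_exponents => /forallP.
have lU : linear U'.
  move=> c p q; rewrite /U' scaler_sumr -big_split; apply: eq_bigr => a _ /=.
  by rewrite mcoeffD mcoeffZ scalerA -scalerDl.
pose g : {linear mhomog_poly -> tensor V} :=
  HB.pack_for {linear mhomog_poly -> tensor V} U'
    (GRing.isLinear.Build K mhomog_poly (tensor V) _ U' lU).
have UE p : linfun g p = U' p by rewrite lfunE.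
have gX a : a \in mhomog_exponents -> U' (mspanX K _ a) = XV a.
  move=> ah; rewrite /U' (bigD1_seq a) ?mem_undup ?undup_uniq //= mspanXE //.
  rewrite mcoeffX eqxx scale1r [X in _ + X]big1 ?addr0 // => b ba.
  by rewrite mcoeffX eq_sym (negbTE ba) scale0r.
exists U' => [t|p]; last first.
  rewrite /U' linear_sum /= [RHS](mspanE p) [LHS]big_seq [RHS]big_seq.
  apply: eq_bigr => a; rewrite mem_undup => ah.
  rewrite linearZ /= poly_tensor_pure poly_prodX => [|l]; last exact: blockh.
  by rewrite mblockK.
suff E : (linfun g \o poly_tensor = \1)%VF.
  by rewrite -UE -comp_lfunE E id_lfunE.
apply: tensor_ext => p; rewrite id_lfunE comp_lfunE UE poly_tensor_pure.
move: p; apply: (@multilinear_ext _ _ V _ (U' \o poly_prod) _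
    (fun l => [seq (mspanX K (homog_exponents (k l) (kappa l)) a : V l)
               | a <- homog_exponents (k l) (kappa l)])).
- by move=> v l a x y /=; rewrite poly_prod_multilinear lU.
- exact: pure_multilinear.
- exact: homog_poly_span.
move=> v vX /=; have /fin_all_exists2[a ah aE] l := mapP (vX l).
have -> : v = (fun l => mspanX K _ (a l)).
  by apply: functional_extensionality_dep.
rewrite poly_prodX // gX; last first.
  rewrite mem_mhomog_exponents; apply/forallP => l.
  by rewrite mjoinK -mem_homog_exponents; exact: ah.
by congr pure; apply: functional_extensionality_dep => l; rewrite mjoinK.
Qed.

End MultiHomogeneous.
End HomogeneousPolynomials.

Export HomogeneousPolynomials.

From mathcomp Require Import spectral complex.
From mathcomp Require Import all_classical all_reals all_analysis.

Import numFieldNormedType.Exports.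
Local Open Scope classical_set_scope.
Local Open Scope ring_scope.

Section LebesgueTuple.
Context {R : realType}.
Local Notation mR := (measurableTypeR R).

Definition tuple_of_pair d (p : d.-tuple mR * mR) : d.+1.-tuple mR :=
  [tuple of p.2 :: p.1].

Fact measurable_tuple_of_pair d : measurable_fun setT (@tuple_of_pair d).
Proof. exact: measurable_cons. Qed.

Section Step.
Variables (d : nat) (mu : {measure set (d.-tuple mR) -> \bar R}).

Definition lebesgue_tupleS : set (d.+1.-tuple mR) -> \bar R :=
  pushforward (mu \x lebesgue_measure)%E (@tuple_of_pair d).

Let nu : {measure set (d.+1.-tuple mR) -> \bar R} :=
  measure_function_pushforward__canonical__measure_function_Measure
    (mu \x lebesgue_measure)%E (@measurable_tuple_of_pair d).

HB.instance Definition _ := Measure.copy lebesgue_tupleS nu.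

End Step.

(* Lebesgue measure on R^d. *)
Fixpoint lebesgue_tuple (d : nat) : {measure set (d.-tuple mR) -> \bar R} :=
  if d is d'.+1 then lebesgue_tupleS (lebesgue_tuple d') else \d_([tuple]).

End LebesgueTuple.

Definition Gamma {R : realType} (s : R) : R :=
  (\int[lebesgue_measure]_(t in `]0, +oo[) (t `^ (s - 1) * expR (- t)))%R.

Section Bergman.
Context {R : realType}.
Local Notation C := R[i].
Variable n : nat.

Definition sqnorm (z : 'cV[C]_n) : R :=
  \sum_i ComplexField.Normc.normc (z i 0) ^+ 2.

Definition cball : set 'cV[C]_n := [set z | sqnorm z < 1].

(* The identification of R^(2n) with C^n: real parts first. *)
Definition cvec (x : (n + n).-tuple R) : 'cV[C]_n :=
  \col_i (tnth x (lshift n i) +i* tnth x (rshift n i))%C.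

Variable lambda : R.

Definition bergman_const : R :=
  Gamma (n%:R + lambda + 1) / (pi ^+ n * Gamma (lambda + 1)).

Definition bergman_sqnorm (f : 'cV[C]_n -> C) : \bar R :=
  (\int[lebesgue_tuple (n + n)]_(x in cvec @^-1` cball)
    (ComplexField.Normc.normc (f (cvec x)) ^+ 2 *
     (bergman_const * (1 - sqnorm (cvec x)) `^ lambda))%:E)%E.

(* Functions on the ball are represented by their extension by 0, so that two
   elements of the Bergman space are equal iff they agree on the ball. *)
Definition bergman_space : set ('cV[C]_n -> C) :=
  [set f | [/\ forall z : ('cV[C]_n : normedModType C), cball z -> differentiable (f : 'cV[C]_n -> C^o) z,
               forall z, ~ cball z -> f z = 0
             & (bergman_sqnorm f < +oo)%E]].

Definition bergman_norm (f : 'cV[C]_n -> C) : R :=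
  Num.sqrt (fine (bergman_sqnorm f)).

(* The values of T outside the Bergman space are irrelevant. *)
Definition bounded_operator (T : ('cV[C]_n -> C) -> 'cV[C]_n -> C) : Prop :=
  [/\ forall f, bergman_space f -> bergman_space (T f),
      forall (a : C) f g, bergman_space f -> bergman_space g ->
        T (fun z => a * f z + g z) = (fun z => a * T f z + T g z)
    & exists M : R, forall f, bergman_space f ->
        bergman_norm (T f) <= M * bergman_norm f].

Definition unitary_rep (A : 'M[C]_n) (f : 'cV[C]_n -> C) : 'cV[C]_n -> C :=
  fun z => f (invmx A *m z).

(* End_H of the Bergman space, for a subgroup H of U(n); pointwise equality off
   the ball is harmless since both sides vanish there. *)
Definition intertwining (H : set 'M[C]_n) : set (('cV[C]_n -> C) -> 'cV[C]_n -> C) :=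
  [set T | bounded_operator T /\
     forall A f, H A -> bergman_space f ->
       T (unitary_rep A f) = unitary_rep A (T f)].

Definition poly_on_ball (p : mpoly.mpoly n C) : 'cV[C]_n -> C :=
  patch (fun=> 0) cball (fun z => mpoly.meval (fun i => z i 0) p).

End Bergman.

(* U(k, j, T). *)
Definition block_group {R : realType} {m : nat} (k : 'I_m -> nat) (j : 'I_m) :
    set 'M[R[i]]_(\sum_l k l) :=
  [set A | exists B : forall l, 'M[R[i]]_(k l),
     [/\ A = mxdiag B,
         forall l, l != j -> B l \is unitarymx
       & exists2 t : R[i], `|t| = 1 & B j = t%:M]].
Arguments block_group {R m} k j.

Definition mhomog_on_ball {R : realType} {m : nat} (k kappa : 'I_m -> nat) :
    set ('cV[R[i]]_(\sum_l k l) -> R[i]) :=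
  [set poly_on_ball p | p in [set: mhomog_poly k kappa R[i]]].
Arguments mhomog_on_ball {R m} k kappa.

(* I_1 ** ... ** I_(j-1) ** M ** I_(j+1) ** ... ** I_m *)
Definition tmap_at (K : fieldType) (I : finType) (V : I -> vectType K) (j : I)
    (M : 'End(V j)) : 'End(tensor V) :=
  tmap (eqtype.dfwith (fun l => \1%VF : 'End(V l)) M).

(* Main.v *)
(* T maps z^alpha to a holomorphic function g that is an eigenvector of the torus of
   the group.  Differentiating g (t z) = t^d g z along the unit circle gives
   Euler's relation, hence g (r z) = r^d g z for 0 < r <= 1, and g extends to an
   entire homogeneous function of growth d.  By the Cauchy estimate (obtained from
   Goursat's theorem for exp (- w) (f (exp w) - f 0) on the rectangle
   [s1, s2] x [0, 2 pi], with s1 -> - oo) a difference F (z + h) - F z of an entire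
   function of growth d has growth d - 1, so the differences of order d + 1 of g
   vanish, and polarization shows that g is a polynomial.  The torus then fixes
   the degree of g in each block and, outside block j, in each variable:
     T (z^alpha' q) = z^alpha' (M_alpha' q)
   for q in the variables of block j and alpha' the exponents of the others.
   Finally, for blocks l != j, a unitary involution whose first row is positive
   sends z_(l),1^kappa_l to a power of a linear form in which every monomial of
   degree kappa_l occurs; as T commutes with it, M_alpha' does not depend on
   alpha'.  That T acts on polynomials at all rests on the finiteness of
   the integral of (1 - |z|^2)^lambda over the ball, proved by integrating out one
   real coordinate at a time. *)
Require Import Defs.
From HB Require Import structures.
From mathcomp Require Import all_boot all_order all_algebra.
From mathcomp Require Import spectral complex.
From mathcomp Require Import all_classical all_reals all_analysis.
From mathcomp Require Import measurable_realfun.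
From mathcomp Require Import ring lra.
From mathcomp Require mpoly.

Set Implicit Arguments.
Unset Strict Implicit.
Unset Printing Implicit Defensive.

Import Order.TTheory GRing.Theory Num.Theory.
Import numFieldNormedType.Exports.
Local Open Scope classical_set_scope.
Local Open Scope ring_scope.

(** * Integrability of the Bergman weight *)

(** Block [j] only sees scalars of the group, so nothing constrains [T] inside it and an arbitrary
    [M] survives there. In the other blocks the diagonal torus separates monomials, but leaves an
    operator on block [j] that may still depend on the exponents elsewhere. One non-diagonal group
    element removes this dependence: it turns one reference monomial into a product [w] with no
    vanishing coefficient, and a coefficient of [T (w q)], computed in two ways, gives
    [c * M_alpha' q] and [c * M q] coordinatewise with the same nonzero [c], a product of
    coefficients of [w]. Positivity of the row gives [c != 0]; an involution makes the inverse in
    the representation explicit. The analytic obstacle is that [T p] is a priori only holomorphic on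
    the ball, with circle homogeneity. Passing from the circle to radii extends it to the whole
    space, where its growth is known and Cauchy estimates on large discs become available. For
    integrability the exponent is first lowered to some [p] in (-1, 0): integrating [(r - t^2)^p] in
    [t] gives a constant times [r^(p + 1/2)], at most [r^p] when [r <= 1], so one estimate
    reproduces itself in every dimension. *)

Section SigmaFinitePack.
Context {R : realType} (dsp : measure_display) (T : measurableType dsp).
Variables (mu : {measure set T -> \bar R}) (h : sigma_finite setT mu).

(** Carries a proof of sigma-finiteness into the structure that Tonelli's theorem expects, for
    measures such as [lebesgue_tuple] that are only declared as measures. *)
Definition sigma_finite_pack of sigma_finite setT mu : set T -> \bar R := mu.

HB.instance Definition _ := Measure.on (sigma_finite_pack h).
HB.instance Definition _ :=
  Measure_isSigmaFinite.Build _ _ _ (sigma_finite_pack h) h.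

End SigmaFinitePack.

Section BergmanWeight.
Context {R : realType}.
Implicit Types (s t : R).
Local Notation mR := (measurableTypeR R).

(** The integral of a nonnegative function is a supremum over the simple functions below it, which
    is monotone for arbitrary functions. This suits [bergman_sqnorm], whose integrand is an
    arbitrary function times the weight. *)
Lemma le_integral_ge0 (dsp : measure_display) (T : measurableType dsp) (mu : {measure set T -> \bar R})
    (D : set T) (f g : T -> \bar R) :
  (forall x, D x -> (0 <= f x)%E) -> (forall x, D x -> (f x <= g x)%E) ->
  (\int[mu]_(x in D) f x <= \int[mu]_(x in D) g x)%E.
Proof.
move=> f0 fg; have g0 x : D x -> (0 <= g x)%E.
  by move=> Dx; exact: le_trans (f0 _ Dx) (fg _ Dx).
rewrite !ge0_integralE//; apply: ereal_sup_le => /= _ [h hf <-]; exists h => // x.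
apply: le_trans (hf x) _; rewrite /patch; case: ifPn => // /set_mem; exact: fg.
Qed.

Lemma sigma_finite_product (d1 d2 : measure_display) (T1 : measurableType d1)
    (T2 : measurableType d2) (m1 : {sigma_finite_measure set T1 -> \bar R})
    (m2 : {sigma_finite_measure set T2 -> \bar R}) :
  sigma_finite setT (m1 \x m2)%E.
Proof.
have /sigma_finiteP[F [TF ndF mF]] := sigma_finiteT m1.
have /sigma_finiteP[G [TG ndG mG]] := sigma_finiteT m2.
(* Both exhaustions are nondecreasing, so the larger of two indices captures both coordinates of a
   point. *)
exists (fun i => F i `*` G i) => [|i].
  apply/seteqP; split=> [[x y] _|//].
  have [i _ Fx] : (\bigcup_i F i) x by rewrite -TF.
  have [i' _ Gy] : (\bigcup_i G i) y by rewrite -TG.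
  exists (maxn i i') => //; split.
    by move: x Fx; exact/subsetPset/ndF/leq_maxl.
  by move: y Gy; exact/subsetPset/ndG/leq_maxr.
have [mFi Fi] := mF i; have [mGi Gi] := mG i; split; first exact: measurableX.
by rewrite product_measure1E// lte_mul_pinfty// ge0_fin_numE.
Qed.

Lemma sigma_finite_lebesgue_tuple (d : nat) :
  sigma_finite setT (@lebesgue_tuple R d).
Proof.
elim: d => [|d IH].
  exists (fun=> setT) => [|i]; first by rewrite bigcup_const//; exists 0%N.
  by split; rewrite //= diracE ltry.
pose m1 : {sigma_finite_measure set (d.-tuple mR) -> \bar R} := sigma_finite_pack IH.
have [F TF mF] := sigma_finite_product m1 lebesgue_measure.
have mg : measurable_fun setT
    (fun t : d.+1.-tuple mR => ([tuple of behead t], thead t)).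
  apply: measurable_fun_pair; first exact: measurable_behead.
  exact: measurable_tnth.
(* The exhaustion of the product is transported along the inverse of [tuple_of_pair]. *)
exists (fun i => (fun t : d.+1.-tuple mR => ([tuple of behead t], thead t)) @^-1` F i).
  by rewrite -preimage_bigcup -TF preimage_setT.
move=> i; have [mFi Fi] := mF i; split.
  by rewrite -[X in measurable X]setTI; exact: mg.
rewrite /= /lebesgue_tupleS /pushforward.
rewrite (_ : _ @^-1` _ = F i)//; apply/seteqP; split=> -[x y] /=.
  by rewrite theadE (_ : [tuple of _] = x)//; apply: val_inj.
by rewrite theadE (_ : [tuple of _] = x)//; apply: val_inj.
Qed.

Lemma is_derive_powR_sub (s p t : R) : t < s ->
  is_derive t 1 (fun t => (s - t) `^ p) (- (p * (s - t) `^ (p - 1))).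
Proof.
move=> ts; have st0 : 0 < s - t by rewrite subr_gt0.
have h1 := is_derive1_powR p st0.
have h2 : is_derive t 1 (fun t => s - t) (-1 : R).
  by rewrite -[X in is_derive _ _ _ X]add0r; exact: is_deriveB.
have := @is_derive1_comp R (fun x => x `^ p) (fun t => s - t) t _ _ h1 h2.
by rewrite mulrN1.
Qed.

(** For negative [p] the integrand is singular at [s]. The fundamental theorem of calculus is
    applied on [[a, b i]] with [b i] increasing to [s], and monotone convergence gives the bound. *)
Lemma integral_powR_sub (a s p : R) : -1 < p -> a < s ->
  (\int[lebesgue_measure]_(t in `[a, s[) ((s - t) `^ p)%:E <=
   ((s - a) `^ (p + 1) / (p + 1))%:E)%E.
Proof.
move=> p1 ltas; have p10 : 0 < p + 1 by lra.
have sa0 : 0 < s - a by rewrite subr_gt0.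
(* The offset 2 keeps [b i] strictly above [a] already for [i = 0]. *)
pose b (i : nat) := s - (s - a) / (i%:R + 2).
have i20 (i : nat) : 0 < i%:R + 2 :> R by rewrite ltr_wpDl.
have bs i : b i < s by rewrite ltrBlDr ltrDl divr_gt0.
have ab i : a < b i.
  rewrite /b ltrBrDl -ltrBrDr ltr_pdivrMr// ltr_pMr//.
  by rewrite (lt_le_trans (_ : 1 < 2))// ?ltr1n// lerDr.
have Us : `[a, s[%classic = \bigcup_i `[a, b i]%classic.
  apply/seteqP; split => [t|t [i _]]; rewrite /= !in_itv/=; last first.
    by move=> /andP[-> tb]; exact: le_lt_trans tb (bs i).
  move=> /andP[ta ts].
  have st0 : 0 < s - t by rewrite subr_gt0.
  exists (Num.truncn ((s - a) / (s - t))) => //; rewrite /= in_itv/= ta /=.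
  rewrite lerBrDl -lerBrDr ler_pdivrMr// mulrC -ler_pdivrMr//.
  apply: le_trans (ltW (truncnS_gt _)) _; rewrite -natr1; lra.
have cF q (c d : R) : d < s -> {within `[c, d], continuous (fun t => (s - t) `^ q)}.
  move=> ds; apply: continuous_in_subspaceT => t.
  rewrite inE/= in_itv/= => /andP[_ td].
  have h := is_derive_powR_sub q (le_lt_trans td ds).
  apply: differentiable_continuous; apply/derivable1_diffP; exact: ex_derive.
rewrite Us.
have mf i : measurable_fun `[a, b i] (fun t => (s - t) `^ p).
  apply: subspace_continuous_measurable_fun => //.
  exact: cF.
have nd : nondecreasing_seq (fun i => `[a, b i]%classic).
  move=> i i' ii'; rewrite subsetEset => t; rewrite /= !in_itv/= => /andP[-> tb] /=.
  apply: le_trans tb _; rewrite lerD2l lerN2 ler_wpM2l ?(ltW sa0)// lef_pV2 ?posrE//.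
  by rewrite lerD2r ler_nat.
have mF i : measurable `[a, b i] by exact: measurable_itv.
have mf' i := (measurable_EFinP `[a, b i] (fun t => (s - t) `^ p)).2 (mf i).
have h := @ge0_nondecreasing_set_cvg_integral _ _ R _ _ lebesgue_measure nd mF mf'
  (fun _ _ _ => powR_ge0 _ _).
rewrite -(cvg_lim _ h)//; apply: lime_le; first by apply/cvg_ex; eexists; exact: h.
near=> i.
pose G t := - ((s - t) `^ (p + 1) / (p + 1)).
have dG t : t < s -> is_derive t 1 G ((s - t) `^ p).
  move=> ts; have h1 := is_derive_powR_sub (p + 1) ts.
  rewrite addrK in h1.
  have -> : G = ((- (p + 1)^-1) *: (fun t => (s - t) `^ (p + 1))).
    by apply/funext => x; rewrite /G /= mulrC -mulNr.
  have -> : (s - t) `^ p = (- (p + 1)^-1) *: - ((p + 1) * (s - t) `^ p).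
    by rewrite /GRing.scale /= mulrNN mulKf// gt_eqF.
  exact: is_deriveZ.
rewrite (@continuous_FTC2 _ _ G)//.
- rewrite -EFinB lee_fin /G opprK addrC lerBlDr lerDl divr_ge0 ?powR_ge0//.
  exact: ltW.
- exact: cF.
- have cG : {within `[a, b i], continuous G}.
    apply: continuous_in_subspaceT => t; rewrite inE/= in_itv/= => /andP[_ td].
    have h1 := dG t (le_lt_trans td (bs i)).
    by apply: differentiable_continuous; apply/derivable1_diffP; exact: ex_derive.
  have [_ cl cr] := (continuous_within_itvP _ (ab i)).1 cG.
  split => // t; rewrite in_itv/= => /andP[_ td].
  have h1 := dG t (lt_trans td (bs i)); exact: ex_derive.
- move=> t; rewrite in_itv/= => /andP[_ td].
  have h1 := dG t (lt_trans td (bs i)).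
  by rewrite derive1E derive_val.
Unshelve. all: by end_near. Qed.

Lemma ler_powR_neg (p a b : R) : p <= 0 -> 0 < a -> a <= b -> b `^ p <= a `^ p.
Proof.
move=> p0 a0 ab; have b0 : 0 < b by exact: lt_le_trans ab.
rewrite -(opprK p) !(powRN _ (- p)) lef_pV2 ?posrE ?powR_gt0//.
by rewrite ge0_ler_powR ?nnegrE ?oppr_ge0 ?(ltW a0) ?(ltW b0).
Qed.

Lemma integral_lebesgueN (f : R -> \bar R) :
  measurable_fun setT f -> (forall t, (0 <= f t)%E) ->
  (\int[lebesgue_measure]_t f (- t)%R = \int[lebesgue_measure]_t f t)%E.
Proof.
move=> mf f0; have mN : measurable_fun setT (-%R : mR -> mR) by exact: oppr_measurable.
rewrite -[in LHS](preimage_setT (-%R : mR -> mR)).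
rewrite -(@ge0_integral_pushforward _ _ mR mR R _ mN _ setT f)//.
by apply: eq_measure_integral => //= A mA _; exact: lebesgue_measureN.
Qed.

(* Unlike [s `^ p], it vanishes for negative [s]. *)
Definition wpow (p s : R) : R := if 0 < s then s `^ p else 0.

Lemma wpow_ge0 p s : 0 <= wpow p s.
Proof. by rewrite /wpow; case: ifP; rewrite ?powR_ge0. Qed.

Lemma measurable_wpow p : measurable_fun setT (wpow p).
Proof.
by apply: measurable_fun_ifT => //; exact: measurable_fun_ltr.
Qed.

(** With [s = sqrt r], the weight factors as [(s - t)^p (s + t)^p] and each factor has an integrable
    singularity at one end only. The same exponent [p] on both sides is what lets the induction on
    the dimension run. *)
Lemma integral_wpow_sub_sqr (p r : R) : -1 < p -> p < 0 -> r <= 1 ->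
  (\int[lebesgue_measure]_t (wpow p (r - t ^+ 2))%:E <=
   (2 * 2 `^ (p + 1) / (p + 1) * wpow p r)%:E)%E.
Proof.
move=> p1 p0 r1; have [r0|r0] := leP r 0.
  rewrite integral0_eq => [|t _]; last first.
    rewrite /wpow ifN// -leNgt; have := sqr_ge0 t; lra.
  by rewrite lee_fin mulr_ge0 ?wpow_ge0// divr_ge0 ?mulr_ge0 ?powR_ge0//; lra.
pose s := Num.sqrt r; have s0 : 0 < s by rewrite sqrtr_gt0.
have s2 : s ^+ 2 = r by rewrite sqr_sqrtr// ltW.
have p10 : 0 < p + 1 by lra.
pose k := (fun t => (s - t) `^ p) \_ `[- s, s[%classic.
have k0 t : 0 <= k t by rewrite /k /patch; case: ifP; rewrite ?powR_ge0.
have mk : measurable_fun setT k.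
  apply/(measurable_restrictT _ _).1 => //; apply: measurable_funTS.
  apply: (measurableT_comp (measurable_powR _)); exact: measurable_funB.
have mk' : measurable_fun setT (EFin \o k) by exact/measurable_EFinP.
have mkN : measurable_fun setT (fun t => k (- t)).
  by apply: (measurableT_comp mk); exact: oppr_measurable.
(* On each half of the interval one of [s - t], [s + t] is at least [s]; as [p] is negative, its
   power is at most [s^p]. *)
have le_k t : wpow p (r - t ^+ 2) <= s `^ p * (k t + k (- t)).
  rewrite /wpow; case: ifPn => [rt|_]; last by rewrite mulr_ge0 ?powR_ge0 ?addr_ge0.
  have := rt; rewrite -s2 subr_sqr => st.
  have [ts ts'] : - s < t /\ t < s by split; nra.
  have kE x : - s <= x -> x < s -> k x = (s - x) `^ p.
    by move=> xs xs'; rewrite /k patchT// inE/= in_itv/= xs xs'.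
  have st1 : 0 < s - t by lra.
  have st2 : 0 < s + t by lra.
  rewrite powRM ?(ltW st1) ?(ltW st2)//.
  have [t0|t0] := leP 0 t.
    rewrite mulrC; apply: ler_pM; rewrite ?powR_ge0//.
      by apply: ler_powR_neg; lra.
    by rewrite (kE t) ?(ltW ts)// lerDl k0.
  apply: ler_pM; rewrite ?powR_ge0//; first by apply: ler_powR_neg; lra.
  by rewrite (kE (- t)) ?opprK ?lerDr ?k0//; lra.
apply: (le_trans (y := (\int[lebesgue_measure]_t
    ((s `^ p)%:E * ((k t)%:E + (k (- t))%:E)))%E)).
  apply: le_integral_ge0 => t _; first by rewrite lee_fin wpow_ge0.
  by rewrite -EFinD -EFinM lee_fin le_k.
rewrite ge0_integralZl//; last 3 first.
- by apply/emeasurable_funD => //; exact/measurable_EFinP.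
- by move=> t _; rewrite adde_ge0// lee_fin.
- by rewrite lee_fin powR_ge0.
rewrite ge0_integralD//; last 3 first.
- by move=> t _; rewrite lee_fin.
- by move=> t _; rewrite lee_fin.
- exact/measurable_EFinP.
rewrite (integral_lebesgueN mk')/=; last by move=> t; rewrite lee_fin.
have Ik : (\int[lebesgue_measure]_t (k t)%:E <=
    ((2 * s) `^ (p + 1) / (p + 1))%:E)%E.
  rewrite (_ : (fun t => (k t)%:E) =
      (EFin \o (fun t => (s - t) `^ p)) \_ `[- s, s[%classic); last first.
    by apply/funext => t; rewrite /k /patch /=; case: ifP.
  rewrite -integral_mkcond /=.
  apply: (le_trans (integral_powR_sub p1 _)); first lra.
  by rewrite opprK -mulr2n mulr_natl.
apply: (le_trans (y := ((s `^ p)%:E * (((2 * s) `^ (p + 1) / (p + 1))%:E +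
   ((2 * s) `^ (p + 1) / (p + 1))%:E))%E)).
  by rewrite lee_wpmul2l ?lee_fin ?powR_ge0// leeD.
rewrite -EFinD -EFinM lee_fin /wpow r0 -s2.
have -> : (s ^+ 2) `^ p = s `^ p * s `^ p by rewrite expr2 powRM// ltW.
rewrite powRM ?(ltW s0)// (@powRD _ s)// ?gt_eqF ?implybT// powRr1 ?(ltW s0)//.
have s1 : s <= 1 by rewrite -[leRHS]sqrtr1 ler_wsqrtr.
have -> : s `^ p * (2 `^ (p + 1) * (s `^ p * s) / (p + 1) +
    2 `^ (p + 1) * (s `^ p * s) / (p + 1)) =
    2 * 2 `^ (p + 1) / (p + 1) * (s `^ p * s `^ p) * s by ring.
(* The surplus factor [s <= 1] is dropped here, which turns [r^(p + 1/2)] into [r^p]. *)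
rewrite ler_piMr// mulr_ge0 ?mulr_ge0 ?powR_ge0 ?invr_ge0//; lra.
Qed.

Definition sumsq (d : nat) (x : d.-tuple R) : R := \sum_i tnth x i ^+ 2.

Lemma sumsq_tuple_of_pair (d : nat) (p : d.-tuple mR * mR) :
  sumsq (tuple_of_pair p) = p.2 ^+ 2 + sumsq p.1.
Proof. by rewrite /sumsq big_ord_recl; congr (_ + _); apply: eq_bigr => i _; rewrite tnthS. Qed.

Lemma measurable_sumsq (d : nat) : measurable_fun setT (@sumsq d : d.-tuple mR -> mR).
Proof.
by apply: measurable_sum => i; apply: measurable_funX; exact: measurable_tnth.
Qed.

Lemma integral_wpow_sumsq_lty (p : R) (d : nat) : -1 < p -> p < 0 ->
  (\int[lebesgue_tuple d]_x (wpow p (1 - sumsq x))%:E < +oo)%E.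
Proof.
move=> p1 p0.
have mw e : measurable_fun setT (fun x : e.-tuple mR => (wpow p (1 - sumsq x))%:E).
  apply/measurable_EFinP; apply: (measurableT_comp (measurable_wpow p)).
  by apply: measurable_funB => //; exact: measurable_sumsq.
elim: d => [|d IH].
  rewrite [ltLHS]integral_dirac //=; last exact: mw.
  by rewrite /dirac indicE in_setT mul1e ltry.
rewrite /= /lebesgue_tupleS.
rewrite (@ge0_integral_pushforward _ _ _ _ R _ (@measurable_tuple_of_pair R d)
  _ setT (fun x => (wpow p (1 - sumsq x))%:E))//; last 2 first.
- exact: mw.
- by move=> x _; rewrite lee_fin wpow_ge0.
rewrite preimage_setT.
pose m1 : {sigma_finite_measure set (d.-tuple mR) -> \bar R} :=
  sigma_finite_pack (sigma_finite_lebesgue_tuple d).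
have mwp : measurable_fun setT (fun x : d.-tuple mR * mR =>
    (wpow p (1 - sumsq (tuple_of_pair x)))%:E).
  apply: (measurableT_comp (mw d.+1)); exact: measurable_tuple_of_pair.
have := @fubini_tonelli1 _ _ _ _ R m1 lebesgue_measure _ mwp.
move=> /(_ (fun=> wpow_ge0 _ _)) E; rewrite [ltLHS]E {E mwp} /fubini_F. 
apply: (@le_lt_trans _ _ (\int[lebesgue_tuple d]_x
   ((2 * 2 `^ (p + 1) / (p + 1))%:E * (wpow p (1 - sumsq x))%:E))%E).
  apply: le_integral_ge0 => x _.
    by apply: integral_ge0 => y _; rewrite lee_fin wpow_ge0.
  rewrite -EFinM; have := @integral_wpow_sub_sqr p (1 - sumsq x) p1 p0.
  under eq_integral do rewrite sumsq_tuple_of_pair /= opprD addrA addrAC.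
  apply; rewrite gerDl oppr_le0; apply: sumr_ge0 => i _; exact: sqr_ge0.
rewrite ge0_integralZl//; last 3 first.
- exact: mw.
- by move=> x _; rewrite lee_fin wpow_ge0.
- by rewrite lee_fin divr_ge0 ?mulr_ge0 ?powR_ge0//; lra.
by rewrite lte_mul_pinfty// ?lee_fin ?divr_ge0 ?mulr_ge0 ?powR_ge0//; lra.
Qed.

(** Only the majorant is nonnegative: [bergman_const] enters the integrand with a sign that is left
    undetermined, so the negative part is discarded. *)
Lemma le_integral_ub_ge0 (dsp : measure_display) (T : measurableType dsp)
    (mu : {measure set T -> \bar R}) (D : set T) (f g : T -> \bar R) :
  (forall x, D x -> (0 <= g x)%E) -> (forall x, D x -> (f x <= g x)%E) ->
  (\int[mu]_(x in D) f x <= \int[mu]_(x in D) g x)%E.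
Proof.
move=> g0 fg; rewrite integralE; apply: (@le_trans _ _ (\int[mu]_(x in D) f^\+ x)%E).
  by rewrite -[leRHS]sube0 leeB// integral_ge0.
by apply: le_integral_ge0 => // x Dx; rewrite funeposE ge_max fg// g0.
Qed.

Lemma sqnorm_cvec (n : nat) (x : (n + n).-tuple R) : sqnorm (cvec x) = sumsq x.
Proof.
rewrite /sqnorm /sumsq big_split_ord /= -big_split /=; apply: eq_bigr => i _ /=.
by rewrite mxE /= sqr_sqrtr// addr_ge0 ?sqr_ge0.
Qed.

Lemma bergman_sqnorm_lty (n : nat) (lambda K : R) (f : 'cV[R[i]]_n -> R[i]) :
  -1 < lambda -> (forall z, cball z -> ComplexField.Normc.normc (f z) <= K) ->
  (bergman_sqnorm lambda f < +oo)%E.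
Proof.
(* Since [1 - |z|^2] lies in (0, 1], lowering the exponent enlarges the weight; the minimum stays
   above -1 and becomes negative, as the one-variable estimate asks. *)
move=> l1 fK; pose p := Num.min lambda (- 2^-1).
have p1 : -1 < p by rewrite lt_min l1; lra.
have p0 : p < 0 by rewrite gt_min; apply/orP; right; lra.
set c := bergman_const n lambda.
have Kc0 : 0 <= K ^+ 2 * `|c| by rewrite mulr_ge0 ?sqr_ge0.
have mw : measurable_fun setT (fun x : (n + n).-tuple mR => (wpow p (1 - sumsq x))%:E).
  apply/measurable_EFinP; apply: (measurableT_comp (measurable_wpow p)).
  by apply: measurable_funB => //; exact: measurable_sumsq.
rewrite /bergman_sqnorm integral_mkcond.
apply: (@le_lt_trans _ _ (\int[lebesgue_tuple (n + n)]_x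
   ((K ^+ 2 * `|c|)%:E * (wpow p (1 - sumsq x))%:E))%E).
  apply: le_integral_ub_ge0 => x _.
    by rewrite -EFinM lee_fin mulr_ge0 ?wpow_ge0.
  rewrite /patch; case: ifPn => [|_]; last first.
    by rewrite -EFinM lee_fin mulr_ge0 ?wpow_ge0.
  rewrite inE => xB; rewrite -EFinM lee_fin.
  have q1 : sumsq x < 1 by rewrite -sqnorm_cvec.
  have q0 : 0 <= sumsq x by apply: sumr_ge0 => i _; exact: sqr_ge0.
  have f0 : 0 <= ComplexField.Normc.normc (f (cvec x)) by case: (f _) => ? ?; exact: sqrtr_ge0.
  rewrite sqnorm_cvec -[leRHS]mulrA.
  apply: (@le_trans _ _ (ComplexField.Normc.normc (f (cvec x)) ^+ 2 *
      (`|c| * (1 - sumsq x) `^ lambda))).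
    apply: ler_wpM2l; first exact: sqr_ge0.
    by apply: ler_wpM2r; [exact: powR_ge0|exact: ler_norm].
  apply: ler_pM; rewrite ?sqr_ge0 ?(mulr_ge0 _ (powR_ge0 _ _))//.
    by rewrite ler_pXn2r ?nnegrE ?fK// (le_trans f0)// fK.
  rewrite ler_wpM2l// /wpow subr_gt0 q1 ger_powR//; first by apply/andP; split; lra.
  by rewrite ge_min lexx.
rewrite ge0_integralZl//.
- by rewrite lte_mul_pinfty// ?lee_fin// integral_wpow_sumsq_lty.
- by move=> x _; rewrite lee_fin wpow_ge0.
Qed.

End BergmanWeight.

(** * Complex derivatives, Goursat's theorem and the Cauchy estimate *)

Section ComplexNorm.
Context {R : realType}.
Local Notation C := R[i].
Local Notation nc := (@ComplexField.Normc.normc R).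
Implicit Types (x y : C).

Lemma nc_ge0 x : 0 <= nc x.
Proof. by case: x => ? ?; exact: sqrtr_ge0. Qed.

Lemma nc_def x : `|x| = (nc x)%:C%C.
Proof. by case: x => a b; rewrite normc_def. Qed.

Lemma ncD x y : nc (x + y) <= nc x + nc y.
Proof. exact: le_normcD. Qed.

Lemma ncN x : nc (- x) = nc x.
Proof. exact: normcN. Qed.

Lemma ncB x y : nc (x - y) <= nc x + nc y.
Proof. by rewrite -[nc y]ncN; exact: ncD. Qed.

Lemma ncM x y : nc (x * y) = nc x * nc y.
Proof. exact: ComplexField.Normc.normcM. Qed.

Lemma ncX x n : nc (x ^+ n) = nc x ^+ n.
Proof.
elim: n => [|n IH]; first by rewrite !expr0 ComplexField.Normc.normc1.
by rewrite !exprS ncM IH.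
Qed.

Lemma nc0 : nc 0 = 0.
Proof. exact: ComplexField.Normc.normc0. Qed.

Lemma nc_eq0 x : (nc x == 0) = (x == 0).
Proof.
apply/eqP/eqP => [|->]; last exact: nc0.
exact: ComplexField.Normc.eq0_normc.
Qed.

Lemma nc_gt0 x : (0 < nc x) = (x != 0).
Proof. by rewrite lt_def nc_ge0 andbT nc_eq0. Qed.

Lemma nc_real (a : R) : nc a%:C%C = `|a|.
Proof. by rewrite /= expr0n /= addr0 sqrtr_sqr. Qed.

Lemma nc_i : nc (0 +i* 1)%C = 1.
Proof. by rewrite /= expr0n /= add0r expr1n sqrtr1. Qed.

Lemma nc_le_ReIm x : nc x <= `|complex.Re x| + `|complex.Im x|.
Proof.
case: x => a b /=.
rewrite -[leRHS]ger0_norm ?addr_ge0// -sqrtr_sqr ler_wsqrtr// -real_normK ?num_real//.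
rewrite -(real_normK (num_real b)) sqrrD lerD2r lerDl mulrn_wge0// mulr_ge0//.
Qed.

Lemma Re_le_nc x : `|complex.Re x| <= nc x.
Proof. by case: x => a b /=; rewrite -sqrtr_sqr ler_wsqrtr// lerDl sqr_ge0. Qed.

Lemma Im_le_nc x : `|complex.Im x| <= nc x.
Proof. by case: x => a b /=; rewrite -sqrtr_sqr ler_wsqrtr// lerDr sqr_ge0. Qed.

Lemma nc_le0 x : (forall e : R, 0 < e -> nc x <= e) -> x = 0.
Proof.
move=> h; apply/eqP; rewrite -nc_eq0 eq_le nc_ge0 andbT.
by apply/ler_addgt0Pl => e e0; rewrite addr0; exact: h.
Qed.

End ComplexNorm.

Section ComplexDerivative.
Context {R : realType}.
Local Notation C := R[i].
Local Notation nc := (@ComplexField.Normc.normc R).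
Implicit Types (F G : C -> C) (w c : C).

(** Remainder form with real moduli instead of a difference quotient: [h = 0] is no exception, and
    estimates combine by linear arithmetic. *)
Definition cderiv F w c := forall e : R, 0 < e -> exists2 d : R, 0 < d &
  forall h, nc h < d -> nc (F (w + h) - F w - c * h) <= e * nc h.

Lemma cderiv_cst k w : cderiv (fun=> k) w 0.
Proof.
move=> e e0; exists 1 => // h _.
by rewrite /= subrr mul0r subr0 nc0 mulr_ge0 ?nc_ge0// ltW.
Qed.

Lemma cderiv_id w : cderiv id w 1.
Proof.
move=> e e0; exists 1 => // h _.
by rewrite /= mul1r (addrC w) addrK subrr nc0 mulr_ge0 ?nc_ge0// ltW.
Qed.

Lemma cderivD F G w a b :
  cderiv F w a -> cderiv G w b -> cderiv (fun z => F z + G z) w (a + b).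
Proof.
move=> dF dG e e0; have e20 : 0 < e / 2 by rewrite divr_gt0.
have [d1 d10 h1] := dF _ e20; have [d2 d20 h2] := dG _ e20.
exists (Num.min d1 d2) => [|h]; first by rewrite lt_min d10.
rewrite lt_min => /andP[/h1 {}h1 /h2 {}h2].
rewrite (_ : _ - _ - _ = (F (w + h) - F w - a * h) + (G (w + h) - G w - b * h)); last by ring.
apply: le_trans (ncD _ _) _; lra.
Qed.

Lemma cderiv_lip F w c : cderiv F w c -> exists2 d : R, 0 < d &
  forall h, nc h < d -> nc (F (w + h) - F w) <= (nc c + 1) * nc h.
Proof.
move=> /(_ _ ltr01)[d d0 hd]; exists d => // h /hd {}hd.
rewrite (_ : _ - _ = (F (w + h) - F w - c * h) + c * h); last by ring.
by apply: le_trans (ncD _ _) _; rewrite ncM; lra.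
Qed.

Lemma cderivM F G w a b : cderiv F w a -> cderiv G w b ->
  cderiv (fun z => F z * G z) w (a * G w + F w * b).
Proof.
move=> dF dG e e0.
(* [K] collects the coefficients of [e / K * nc h] in the three error terms, plus 1 for positivity.
   The extra bound [nc h < e / K] makes the product of the two increments small enough. *)
pose K := nc (G w) + nc (F w) + (nc a + 1) * (nc b + 1) + 1.
have K0 : 0 < K by rewrite ltr_wpDl// !addr_ge0 ?mulr_ge0 ?addr_ge0 ?nc_ge0.
have eK0 : 0 < e / K by rewrite divr_gt0.
have [d1 d10 h1] := dF _ eK0; have [d2 d20 h2] := dG _ eK0.
have [d3 d30 h3] := cderiv_lip dF; have [d4 d40 h4] := cderiv_lip dG.
exists (Num.min (Num.min d1 d2) (Num.min (Num.min d3 d4) (e / K))).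
  by rewrite !lt_min d10 d20 d30 d40.
move=> h; rewrite !lt_min => /andP[/andP[/h1 {}h1 /h2 {}h2]].
move=> /andP[/andP[/h3 {}h3 /h4 {}h4] heK].
rewrite (_ : _ - _ - _ = (F (w + h) - F w - a * h) * G w +
  F w * (G (w + h) - G w - b * h) + (F (w + h) - F w) * (G (w + h) - G w)); last by ring.
apply: le_trans (ncD _ _) _; apply: le_trans (lerD (ncD _ _) (lexx _)) _.
rewrite !ncM.
have p1 : nc (F (w + h) - F w - a * h) * nc (G w) <= e / K * nc h * nc (G w).
  by rewrite ler_wpM2r ?nc_ge0.
have p2 : nc (F w) * nc (G (w + h) - G w - b * h) <= nc (F w) * (e / K * nc h).
  by rewrite ler_wpM2l ?nc_ge0.
have p3 : nc (F (w + h) - F w) * nc (G (w + h) - G w) <=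
    (nc a + 1) * nc h * ((nc b + 1) * (e / K)).
  apply: ler_pM => //; rewrite ?nc_ge0//; apply: le_trans h4 _.
  by rewrite ler_wpM2l ?addr_ge0 ?nc_ge0// ltW.
have -> : e * nc h = (e / K * nc h) * (nc (G w) + nc (F w) + (nc a + 1) * (nc b + 1)) +
    e / K * nc h.
  by rewrite -{1}(divfK (lt0r_neq0 K0) e) /K; ring.
have : 0 <= e / K * nc h by rewrite mulr_ge0 ?nc_ge0// ltW.
lra.
Qed.

Lemma cderiv_comp F G w a b : cderiv G w b -> cderiv F (G w) a ->
  cderiv (fun z => F (G z)) w (a * b).
Proof.
move=> dG dF e e0.
have [d3 d30 h3] := cderiv_lip dG.
have nb : 0 < nc b + 1 by rewrite ltr_wpDl ?nc_ge0.
have na : 0 < nc a + 1 by rewrite ltr_wpDl ?nc_ge0.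
have e1 : 0 < e / 2 / (nc b + 1) by rewrite !divr_gt0.
have e2 : 0 < e / 2 / (nc a + 1) by rewrite !divr_gt0.
have [d1 d10 h1] := dF _ e1; have [d2 d20 h2] := dG _ e2.
exists (Num.min (Num.min d2 d3) (d1 / (nc b + 1))).
  by rewrite !lt_min d20 d30 divr_gt0.
move=> h; rewrite !lt_min => /andP[/andP[/h2 {}h2 /h3 {}h3] hd].
pose k := G (w + h) - G w.
have kd : nc k < d1 by apply: le_lt_trans h3 _; rewrite mulrC -ltr_pdivlMr.
have Ek : G w + k = G (w + h) by rewrite /k addrC subrK.
have := h1 _ kd; rewrite Ek /k => {}h1.
rewrite (_ : _ - _ - _ = (F (G (w + h)) - F (G w) - a * (G (w + h) - G w)) +
  a * (G (w + h) - G w - b * h)); last by ring.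
apply: le_trans (ncD _ _) _; rewrite ncM.
have q1 : e / 2 / (nc b + 1) * nc (G (w + h) - G w) <= e / 2 * nc h.
  rewrite [leLHS]mulrAC ler_pdivrMr// -[leRHS]mulrA.
  by apply: ler_wpM2l; [rewrite divr_ge0// ltW|rewrite mulrC].
have q2 : nc a * nc (G (w + h) - G w - b * h) <= e / 2 * nc h.
  apply: (@le_trans _ _ ((nc a + 1) * (e / 2 / (nc a + 1) * nc h))).
    by rewrite ler_pM ?nc_ge0// lerDl.
  by rewrite mulrA [X in X * _]mulrC divfK// gt_eqF.
lra.
Qed.

End ComplexDerivative.

Section RealDerivative.
Context {R : realType}.
Implicit Types (f : R -> R).

Lemma is_derive_epsP f (t a : R) : is_derive t 1 f a <->
  forall e : R, 0 < e -> exists2 d : R, 0 < d &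
    forall h, `|h| < d -> `|f (t + h) - f t - a * h| <= e * `|h|.
Proof.
split=> [df e e0|h].
  have dd : derivable f t 1 by exact: ex_derive.
  move/eqaddoP : (derivable_nbhs dd) => /(_ e e0) [d /= d0 hd].
  exists d => // h hh; have := hd h; rewrite /= sub0r normrN => /(_ hh).
  rewrite derive_val -[X in `|X| <= _ -> _]/(f (h *: 1 + t) - (f t + h * a)).
  by rewrite [_ *: 1]mulr1 (addrC h t) (mulrC a) opprD addrA.
have cv : h^-1 *: (f (h *: 1 + t) - f t) @[h --> 0^'] --> a.
  apply/cvgrPdist_le => /= e e0; have [d d0 hd] := h _ e0.
  exists d => //= x; rewrite /= sub0r normrN => xd x0.
  have -> : x *: 1 + t = t + x by rewrite addrC [_ *: _]mulr1.
  have := hd _ xd; rewrite /GRing.scale /= => H.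
  rewrite -(ler_pM2r (_ : 0 < `|x|)) ?normr_gt0// -normrM mulrBl.
  by rewrite mulrAC mulVf// mul1r distrC.
by split; [apply/cvg_ex; exists a|apply/cvg_lim].
Qed.

Lemma is_derive_continuous f (t a : R) : is_derive t 1 f a -> {for t, continuous f}.
Proof.
move=> df; apply: differentiable_continuous; apply/derivable1_diffP; exact: ex_derive.
Qed.

Lemma MVT_le f df (a b K : R) : a <= b ->
  (forall t, a <= t -> t <= b -> is_derive t 1 f (df t)) ->
  (forall t, a <= t -> t <= b -> `|df t| <= K) -> `|f b - f a| <= K * (b - a).
Proof.
move=> ab hd hK.
have [||c] := @MVT_segment R f df a b ab.
- by move=> x; rewrite in_itv/= => /andP[/ltW ? /ltW ?]; exact: hd.
- apply: continuous_in_subspaceT => t; rewrite inE/= in_itv/= => /andP[ta tb].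
  exact: is_derive_continuous (hd _ ta tb).
rewrite in_itv/= => /andP[ac cb] ->.
by rewrite normrM (ger0_norm (_ : 0 <= b - a)) ?subr_ge0// ler_wpM2r ?subr_ge0// hK.
Qed.

(** [A] is a base point chosen to the left of every point where the primitive is used. *)
Definition prim (A : R) f : R -> R := fun x => (\int[lebesgue_measure]_(t in `[A, x]) f t)%R.

Lemma is_derive_prim (A : R) f t : continuous f -> A < t -> is_derive t 1 (prim A f) (f t).
Proof.
move=> cf At.
have [||dP P'] := @continuous_FTC1_closed R f A t (t + 1) _ _ At (cf t).
- by rewrite ltrDl.
- apply: continuous_compact_integrable; first exact: segment_compact.
  by apply: continuous_subspaceT.
by split => //; rewrite -derive1E.
Qed.

End RealDerivative.

Section CurveDerivative.
Context {R : realType}.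
Local Notation C := R[i].
Local Notation nc := (@ComplexField.Normc.normc R).
Implicit Types (f : R -> C) (F : C -> C).

Definition rderiv f (t : R) (c : C) :=
  is_derive t 1 (fun t => complex.Re (f t)) (complex.Re c) /\
  is_derive t 1 (fun t => complex.Im (f t)) (complex.Im c).

Lemma rderivP f t c : rderiv f t c <->
  forall e : R, 0 < e -> exists2 d : R, 0 < d &
    forall h : R, `|h| < d -> nc (f (t + h) - f t - c * h%:C%C) <= e * `|h|.
Proof.
have ReE h : complex.Re (f (t + h) - f t - c * h%:C%C) =
    complex.Re (f (t + h)) - complex.Re (f t) - complex.Re c * h.
  by case: (f (t + h)) (f t) (c) => ? ? [? ?] [? ?] /=; ring.
have ImE h : complex.Im (f (t + h) - f t - c * h%:C%C) =
    complex.Im (f (t + h)) - complex.Im (f t) - complex.Im c * h.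
  by case: (f (t + h)) (f t) (c) => ? ? [? ?] [? ?] /=; ring.
split=> [[/is_derive_epsP dR /is_derive_epsP dI] e e0|h].
  have e20 : 0 < e / 2 by rewrite divr_gt0.
  have [d1 d10 h1] := dR _ e20; have [d2 d20 h2] := dI _ e20.
  exists (Num.min d1 d2) => [|h]; first by rewrite lt_min d10.
  rewrite lt_min => /andP[/h1 {}h1 /h2 {}h2]; apply: le_trans (nc_le_ReIm _) _.
  by rewrite ReE ImE; lra.
split; apply/is_derive_epsP => e e0; have [d d0 hd] := h _ e0; exists d => // x xd.
  by rewrite -ReE; apply: le_trans (Re_le_nc _) (hd _ xd).
by rewrite -ImE; apply: le_trans (Im_le_nc _) (hd _ xd).
Qed.

Lemma cderiv_line F (w v c : C) (t : R) : cderiv F (w + t%:C%C * v) c ->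
  rderiv (fun t => F (w + t%:C%C * v)) t (c * v).
Proof.
move=> dF; apply/rderivP => e e0.
have v0 : 0 < nc v + 1 by rewrite ltr_wpDl ?nc_ge0.
have [d d0 hd] := dF _ (divr_gt0 e0 v0).
exists (d / (nc v + 1)) => [|h hh]; first by rewrite divr_gt0.
have hv : nc (h%:C%C * v) <= `|h| * (nc v + 1).
  by rewrite ncM nc_real ler_wpM2l// lerDl.
have /hd : nc (h%:C%C * v) < d by apply: le_lt_trans hv _; rewrite -ltr_pdivlMr.
rewrite (_ : _ + h%:C%C * v = w + (t + h)%:C%C * v); last by rewrite rmorphD/=; ring.
rewrite [h%:C%C * v]mulrC mulrA in hv * => H; apply: le_trans H _.
by rewrite mulrAC ler_pdivrMr// -[leRHS]mulrA ler_wpM2l// ltW.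
Qed.

(** The mean value theorem is applied to the real and imaginary parts separately, whence the factor
    2; it reappears in all later constants. *)
Lemma rderiv_bound f df (a b K : R) : a <= b ->
  (forall t, a <= t -> t <= b -> rderiv f t (df t)) ->
  (forall t, a <= t -> t <= b -> nc (df t) <= K) -> nc (f b - f a) <= 2 * K * (b - a).
Proof.
move=> ab hd hK; apply: le_trans (nc_le_ReIm _) _.
have -> : complex.Re (f b - f a) = complex.Re (f b) - complex.Re (f a) by case: (f b) (f a) => ? ? [].
have -> : complex.Im (f b - f a) = complex.Im (f b) - complex.Im (f a) by case: (f b) (f a) => ? ? [].
have h1 := @MVT_le R (fun t => complex.Re (f t)) (fun t => complex.Re (df t)) a b K ab.
have h2 := @MVT_le R (fun t => complex.Im (f t)) (fun t => complex.Im (df t)) a b K ab.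
have {}h1 : `|complex.Re (f b) - complex.Re (f a)| <= K * (b - a).
  apply: h1 => t ta tb; first by have [] := hd t ta tb.
  exact: le_trans (Re_le_nc _) (hK _ ta tb).
have {}h2 : `|complex.Im (f b) - complex.Im (f a)| <= K * (b - a).
  apply: h2 => t ta tb; first by have [] := hd t ta tb.
  exact: le_trans (Im_le_nc _) (hK _ ta tb).
lra.
Qed.

Lemma rderivB f g t a b : rderiv f t a -> rderiv g t b -> rderiv (fun t => f t - g t) t (a - b).
Proof.
move=> [f1 f2] [g1 g2]; split.
  have -> : (fun t => complex.Re (f t - g t)) =
     (fun t => complex.Re (f t)) \- (fun t => complex.Re (g t)).
    by apply/funext => x /=; case: (f x) (g x) => ? ? [].
  by rewrite (_ : complex.Re (a - b) = complex.Re a - complex.Re b); [exact: is_deriveB|case: a b {f1 f2 g1 g2} => ? ? []].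
have -> : (fun t => complex.Im (f t - g t)) =
   (fun t => complex.Im (f t)) \- (fun t => complex.Im (g t)).
  by apply/funext => x /=; case: (f x) (g x) => ? ? [].
by rewrite (_ : complex.Im (a - b) = complex.Im a - complex.Im b); [exact: is_deriveB|case: a b {f1 f2 g1 g2} => ? ? []].
Qed.

Definition cprim (A : R) f (t : R) : C :=
  (prim A (fun t => complex.Re (f t)) t +i* prim A (fun t => complex.Im (f t)) t)%C.

Lemma rderiv_cprim (A : R) f df : (forall t, rderiv f t (df t)) ->
  forall t, A < t -> rderiv (cprim A f) t (f t).
Proof.
move=> hd t At; split; apply: is_derive_prim => // x.
  exact: is_derive_continuous (hd x).1.
exact: is_derive_continuous (hd x).2.
Qed.

End CurveDerivative.

(** * Nested bisection of intervals and rectangles *)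

Section Bisection.
Context {R : realType}.

Lemma half_exp2 (s : R) n : s / 2 ^+ n = s / 2 ^+ n.+1 + s / 2 ^+ n.+1.
Proof. by rewrite exprS invfM mulrCA [2^-1 * _]mulrC -splitr. Qed.

(** The intervals [[u n, u n + s / 2 ^ n]] are nested, and the supremum of the left ends lies in all
    of them. *)
Lemma halving_cvg (u : nat -> R) (s : R) : 0 <= s ->
  (forall n, u n <= u n.+1 /\ u n.+1 <= u n + s / 2 ^+ n.+1) ->
  exists p, forall n, u n <= p /\ p <= u n + s / 2 ^+ n.
Proof.
move=> s0 hu.
have h1 n k : u n <= u (n + k)%N.
  elim: k => [|k IH]; first by rewrite addn0.
  by rewrite addnS; apply: le_trans IH (hu _).1.
have h2 n k : u (n + k)%N + s / 2 ^+ (n + k) <= u n + s / 2 ^+ n.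
  elim: k => [|k IH]; first by rewrite addn0.
  rewrite addnS; apply: le_trans IH; have [_ h] := hu (n + k)%N.
  by rewrite [in leRHS]half_exp2 addrA lerD2r.
have s2 n : 0 <= s / 2 ^+ n by rewrite divr_ge0// exprn_ge0.
have ub n m : u m <= u n + s / 2 ^+ n.
  have [nm|/ltnW mn] := leqP n m.
    rewrite -(subnKC nm); apply: le_trans (h2 n (m - n)%N).
    by rewrite lerDl s2.
  have := h1 m (n - m)%N; rewrite subnKC// => /le_trans; apply.
  by rewrite lerDl s2.
have hs : has_sup (range u).
  by split; [exists (u 0%N), 0%N|exists (u 0%N + s / 2 ^+ 0) => _ [m _ <-]; exact: ub].
exists (sup (range u)) => n; split.
  by apply: ub_le_sup; [case: hs|exists n].
by apply: ge_sup; [case: hs|move=> _ [m _ <-]; exact: ub].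
Qed.

Lemma rectangle_bisection (P : R -> R -> nat -> Prop) (a0 c0 al be : R) :
  0 <= al -> 0 <= be -> P a0 c0 0%N ->
  (forall a c n, P a c n -> exists a' c',
     [/\ a <= a' <= a + al / 2 ^+ n.+1, c <= c' <= c + be / 2 ^+ n.+1 & P a' c' n.+1]) ->
  exists p q, forall n, exists a c,
     [/\ a <= p <= a + al / 2 ^+ n, c <= q <= c + be / 2 ^+ n & P a c n].
Proof.
move=> al0 be0 P0 step.
(* Bundling a corner with its proof of [P] lets a plain recursion iterate the choice of the next
   rectangle. *)
pose S n := {x : R * R | P x.1 x.2 n}.
have next n (x : S n) : {y : S n.+1 |
    (sval x).1 <= (sval y).1 <= (sval x).1 + al / 2 ^+ n.+1 /\
    (sval x).2 <= (sval y).2 <= (sval x).2 + be / 2 ^+ n.+1}.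
  apply: cid; case: x => -[a c] /= /step[a' [c' [h1 h2 h3]]].
  by exists (exist _ (a', c') h3).
pose f := fix f n : S n := if n is k.+1 then sval (next k (f k)) else exist _ (a0, c0) P0.
have hf n := svalP (next n (f n)).
have [p hp] := @halving_cvg (fun n => (sval (f n)).1) al al0
  (fun n => andP (hf n).1).
have [q hq] := @halving_cvg (fun n => (sval (f n)).2) be be0
  (fun n => andP (hf n).2).
exists p, q => n; exists (sval (f n)).1, (sval (f n)).2.
by split; [apply/andP; exact: hp|apply/andP; exact: hq|exact: (svalP (f n))].
Qed.

Lemma div_exp2_lt (s d : R) : 0 < d -> exists n, s / 2 ^+ n < d.
Proof.
move=> d0; exists (Num.truncn (s / d)).+1.
rewrite ltr_pdivrMr ?exprn_gt0// mulrC -ltr_pdivrMr//.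
apply: lt_trans (truncnS_gt _) _.
by rewrite -natrX ltr_nat ltn_expl.
Qed.

End Bisection.

(** * Goursat's theorem on rectangles *)

Section Goursat.
Context {R : realType}.
Local Notation C := R[i].
Local Notation nc := (@ComplexField.Normc.normc R).
Local Notation iC := ((0 +i* 1)%C : C).

Lemma rderiv_hline (F : C -> C) (t y : R) c : cderiv F (t +i* y)%C c ->
  rderiv (fun t => F (t +i* y)%C) t c.
Proof.
have E s : (s +i* y)%C = (0 +i* y)%C + s%:C%C * 1 by simpc.
rewrite E => /cderiv_line; rewrite mulr1.
by under [in X in X -> _]eq_fun do rewrite -E.
Qed.

Lemma rderiv_vline (F : C -> C) (x t : R) c : cderiv F (x +i* t)%C c ->
  rderiv (fun t => F (x +i* t)%C) t (c * iC).
Proof.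
have E s : (x +i* s)%C = (x +i* 0)%C + s%:C%C * iC by simpc.
rewrite E => /cderiv_line.
by under [in X in X -> _]eq_fun do rewrite -E.
Qed.

Variables (g dg : C -> C) (A : R).
Hypothesis dgP : forall w, cderiv g w (dg w).

(** Primitives of [g dz] along horizontal and vertical lines; the factor [iC] in [vprim] is
    [dz = i dt]. *)
Definition hprim (y : R) := cprim A (fun t => g (t +i* y)%C).
Definition vprim (x : R) := cprim A (fun t => iC * g (x +i* t)%C).

Lemma rderiv_hprim y t : A < t -> rderiv (hprim y) t (g (t +i* y)%C).
Proof. by apply: rderiv_cprim => s; exact: rderiv_hline (dgP _). Qed.

Lemma rderiv_vprim x t : A < t -> rderiv (vprim x) t (iC * g (x +i* t)%C).
Proof.
apply: rderiv_cprim => s; apply: (@rderiv_vline (fun z => iC * g z)).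
by apply: cderivM; [exact: cderiv_cst|exact: dgP].
Qed.

(** The counterclockwise contour integral of [g] over the boundary of [[a, b] x [c, d]]: bottom,
    top, right, left. *)
Definition rect (a b c d : R) : C :=
  (hprim c b - hprim c a) - (hprim d b - hprim d a) + (vprim b d - vprim b c) - (vprim a d - vprim a c).

(** An affine function has a primitive [Q], whose corner values cancel around the contour. Only the
    deviation [E] from the affine function is left, counted twice per side by [rderiv_bound] on two
    sides in each direction. *)
Lemma rect_affine_bound (a b c d : R) (k l : C) (E : R) :
  A < a -> A < c -> a <= b -> c <= d ->
  (forall x y, a <= x <= b -> c <= y <= d -> nc (g (x +i* y)%C - (k + l * (x +i* y)%C)) <= E) ->
  nc (rect a b c d) <= 4 * E * ((b - a) + (d - c)).
Proof.
move=> Aa Ac ab cd hE.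
pose Q (z : C) := k * z + l / 2 * (z * z).
have dQ z : cderiv Q z (k + l * z).
  have := cderivD (cderivM (cderiv_cst k z) (@cderiv_id R z))
    (cderivM (cderiv_cst (l / 2) z) (cderivM (@cderiv_id R z) (@cderiv_id R z))).
  rewrite (_ : _ + _ = k + l * z)// mul0r add0r mulr1 mul0r add0r mul1r mulr1.
  by rewrite mulrDr -mulrDl -splitr.
have H y : c <= y <= d -> nc ((hprim y b - Q (b +i* y)%C) - (hprim y a - Q (a +i* y)%C)) <= 2 * E * (b - a).
  move=> ycd; apply: (@rderiv_bound R (fun t => hprim y t - Q (t +i* y)%C) _ a b E ab) => t ta tb.
    apply: rderivB; first exact: rderiv_hprim (lt_le_trans Aa ta).
    exact: rderiv_hline (dQ _).
  by apply: hE => //; rewrite ta tb.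
have V x : a <= x <= b -> nc ((vprim x d - Q (x +i* d)%C) - (vprim x c - Q (x +i* c)%C)) <= 2 * E * (d - c).
  move=> xab; apply: (@rderiv_bound R (fun t => vprim x t - Q (x +i* t)%C) _ c d E cd) => t tc td.
    apply: rderivB; first exact: rderiv_vprim (lt_le_trans Ac tc).
    exact: rderiv_vline (dQ _).
  rewrite /= [iC * _]mulrC -mulrBl ncM nc_i mulr1; apply: hE => //; by rewrite tc td.
have -> : rect a b c d =
  ((hprim c b - Q (b +i* c)%C) - (hprim c a - Q (a +i* c)%C))
  - ((hprim d b - Q (b +i* d)%C) - (hprim d a - Q (a +i* d)%C))
  + ((vprim b d - Q (b +i* d)%C) - (vprim b c - Q (b +i* c)%C))
  - ((vprim a d - Q (a +i* d)%C) - (vprim a c - Q (a +i* c)%C)) by rewrite /rect; ring.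
apply: le_trans (ncB _ _) _; apply: le_trans (lerD (ncD _ _) (lexx _)) _.
apply: le_trans (lerD (lerD (ncB _ _) (lexx _)) (lexx _)) _.
have := H c; have := H d; have := V a; have := V b; rewrite !lexx ab cd.
move=> /(_ isT) ? /(_ isT) ? /(_ isT) ? /(_ isT) ?; lra.
Qed.

Lemma rect_eq0 (a b c d : R) : A < a -> A < c -> a <= b -> c <= d -> rect a b c d = 0.
Proof.
move=> Aa Ac ab cd; apply: nc_le0 => e e0.
pose al := b - a; pose be := d - c.
have al0 : 0 <= al by rewrite subr_ge0.
have be0 : 0 <= be by rewrite subr_ge0.
pose I0 := nc (rect a b c d).
pose r x y n := rect x (x + al / 2 ^+ n) y (y + be / 2 ^+ n).
(* The invariant of the bisection: the integral over the n-th rectangle has lost at most a factor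
   [4 ^ n]. *)
pose P x y n := [/\ A < x, A < y & I0 / 4 ^+ n <= nc (r x y n)].
have P0 : P a c 0%N.
  by split => //; rewrite /r /I0 !expr0 !divr1 /al /be !(addrC _ (_ - _)) !subrK.
have step x y n : P x y n -> exists x' y',
   [/\ x <= x' <= x + al / 2 ^+ n.+1, y <= y' <= y + be / 2 ^+ n.+1 & P x' y' n.+1].
  move=> [Ax Ay hI].
  pose xm := x + al / 2 ^+ n.+1; pose ym := y + be / 2 ^+ n.+1.
  (* The integrals over the inner edges cancel in pairs. *)
  have E : r x y n = r x y n.+1 + r xm y n.+1 + r x ym n.+1 + r xm ym n.+1.
    rewrite /r /xm /ym (half_exp2 al) (half_exp2 be) !addrA.
    by rewrite /rect; ring.
  have xm1 : x <= xm by rewrite lerDl divr_ge0// exprn_ge0.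
  have ym1 : y <= ym by rewrite lerDl divr_ge0// exprn_ge0.
  have I4 : I0 / 4 ^+ n = 4 * (I0 / 4 ^+ n.+1).
    by rewrite exprS invfM [RHS]mulrCA mulVKf.
  have [h|h1] := leP (I0 / 4 ^+ n.+1) (nc (r x y n.+1)).
    by exists x, y; rewrite !lexx xm1 ym1; split.
  have [h|h2] := leP (I0 / 4 ^+ n.+1) (nc (r xm y n.+1)).
    by exists xm, y; rewrite !lexx xm1 ym1; split => //; split => //; exact: lt_le_trans xm1.
  have [h|h3] := leP (I0 / 4 ^+ n.+1) (nc (r x ym n.+1)).
    by exists x, ym; rewrite !lexx xm1 ym1; split => //; split => //; exact: lt_le_trans ym1.
  exists xm, ym; rewrite !lexx xm1 ym1; split => //; split.
  - exact: lt_le_trans xm1.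
  - exact: lt_le_trans ym1.
  rewrite leNgt; apply/negP => h4; move: hI; rewrite E I4 leNgt => /negP; apply.
  apply: le_lt_trans (ncD _ _) _; apply: le_lt_trans (lerD (ncD _ _) (lexx _)) _.
  apply: le_lt_trans (lerD (lerD (ncD _ _) (lexx _)) (lexx _)) _; lra.
have [p [q hpq]] := rectangle_bisection al0 be0 P0 step.
(* The affine bound at scale [h] is [4 (e / K) h^2] with [h^2 = (al + be)^2 / 4^n]; the power [4^n]
   cancels against the invariant and [K] absorbs the rest. *)
pose K := 4 * (al + be) ^+ 2 + 1.
have K0 : 0 < K by have := sqr_ge0 (al + be); rewrite /K; lra.
have [dl dl0 hd] := dgP (p +i* q)%C (divr_gt0 e0 K0).
have [n hn] := div_exp2_lt (al + be) dl0.
have [x [y [/andP[xp px] /andP[yq qy] [Ax Ay hI]]]] := hpq n.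
set h := (al + be) / 2 ^+ n in hn.
have h0 : 0 <= h by apply: divr_ge0; [exact: addr_ge0|exact: exprn_ge0].
have := @rect_affine_bound x (x + al / 2 ^+ n) y (y + be / 2 ^+ n)
  (g (p +i* q)%C - dg (p +i* q)%C * (p +i* q)%C) (dg (p +i* q)%C) (e / K * h) Ax Ay.
rewrite !lerDl !divr_ge0 ?exprn_ge0//.
move=> /(_ isT isT) H.
have {}H : nc (r x y n) <= 4 * (e / K * h) * h.
  have hE : h = x + al / 2 ^+ n - x + (y + be / 2 ^+ n - y) by rewrite /h mulrDl; ring.
  rewrite [X in _ <= _ * X]hE.
  apply: H => u v /andP[u1 u2] /andP[v1 v2].
  pose z : C := ((u - p) +i* (v - q))%C.
  have -> : (u +i* v)%C = (p +i* q)%C + z by rewrite /z; simpc; rewrite !subrKC.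
  have zh : nc z <= h.
    apply: le_trans (nc_le_ReIm _) _; rewrite /z /= /h mulrDl.
    by apply: lerD; rewrite ler_norml; apply/andP; split; lra.
  rewrite (_ : _ - _ = g ((p +i* q)%C + z) - g (p +i* q)%C - dg (p +i* q)%C * z); last by ring.
  apply: le_trans (hd _ (le_lt_trans zh hn)) _.
  by rewrite ler_wpM2l// divr_ge0// ltW.
have h4 : h * h = (al + be) ^+ 2 / 4 ^+ n.
  have -> : 4 = 2 * 2 :> R by rewrite -natrM.
  by rewrite /h exprMn invfM expr2; ring.
have := le_trans hI H; rewrite ler_pdivrMr ?exprn_gt0//.
rewrite -[4 * _ * h]mulrA -[e / K * h * h]mulrA h4 -!mulrA mulVf ?expf_neq0// mulr1.
move=> {}H; apply: le_trans H _.
rewrite mulrCA -[leRHS]mulr1 ler_wpM2l ?(ltW e0)//.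
rewrite mulrCA mulrC ler_pdivrMr// mul1r /K; lra.
Qed.

End Goursat.

(** * Complex exponential and the Cauchy estimate at the origin *)

Section CauchyEstimate.
Context {R : realType}.
Local Notation C := R[i].
Local Notation nc := (@ComplexField.Normc.normc R).
Local Notation iC := ((0 +i* 1)%C : C).

Definition cexp (z : C) : C :=
  ((expR (complex.Re z) * cos (complex.Im z)) +i*
   (expR (complex.Re z) * sin (complex.Im z)))%C.

Lemma cexpD (z w : C) : cexp (z + w) = cexp z * cexp w.
Proof.
case: z w => a b [c d]; rewrite /cexp /= expRD cosD sinD; simpc.
by apply/eqP; rewrite eq_complex /=; apply/andP; split; apply/eqP; ring.
Qed.

Lemma cexp0 : cexp 0 = 1.
Proof. by rewrite /cexp /= expR0 cos0 sin0 mulr0 mulr1. Qed.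

Lemma cexpN (z : C) : cexp (- z) * cexp z = 1.
Proof. by rewrite -cexpD addNr cexp0. Qed.

Lemma cexpNV (z : C) : cexp (- z) = (cexp z)^-1.
Proof.
have := cexpN z => h; have z0 : cexp z != 0.
  by apply/eqP => z0; move/eqP: h; rewrite z0 mulr0 eq_sym oner_eq0.
by rewrite -[RHS]mul1r -h mulfK.
Qed.

Lemma nc_cexp (z : C) : nc (cexp z) = expR (complex.Re z).
Proof.
by rewrite /cexp /= !exprMn -mulrDr cos2Dsin2 mulr1 sqrtr_sqr ger0_norm// expR_ge0.
Qed.

Lemma cexp_2pi (x : R) : cexp (x +i* (2 * pi))%C = cexp (x +i* 0)%C.
Proof. by rewrite /cexp /= mulr_natl cos2pi sin2pi cos0 sin0. Qed.

Lemma cderiv_cexp0 : cderiv cexp 0 1.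
Proof.
(* The error terms below add up to at most [3 e' |s| + 6 e' |t|], hence to [9 e' |h|]; the cap 1
   gives [|s| <= 1]. *)
move=> e e0; pose e' := Num.min (e / 9) 1.
have e'0 : 0 < e' by rewrite lt_min divr_gt0 ?ltr01.
have e'1 : e' <= 1 by rewrite ge_min lexx orbT.
have e'9 : 9 * e' <= e by rewrite mulrC -ler_pdivlMr// ge_min lexx.
clearbody e'.
have [d1 d10 h1] := (is_derive_epsP _ _ _).1 (is_derive_expR (0 : R)) _ e'0.
have [d2 d20 h2] := (is_derive_epsP _ _ _).1 (is_derive_cos (0 : R)) _ e'0.
have [d3 d30 h3] := (is_derive_epsP _ _ _).1 (is_derive_sin (0 : R)) _ e'0.
exists (Num.min (Num.min d1 d2) (Num.min d3 e')); first by rewrite !lt_min d10 d20 d30 e'0.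
move=> h; rewrite !lt_min => /andP[/andP[hd1 hd2] /andP[hd3 hde]].
pose s := complex.Re h; pose t := complex.Im h; pose H := nc h.
have sH : `|s| <= H by exact: Re_le_nc.
have tH : `|t| <= H by exact: Im_le_nc.
pose A := expR s - 1 - s; pose B := cos t - 1; pose D := sin t - t.
have hA : `|A| <= e' * `|s|.
  by have := h1 s (le_lt_trans sH hd1); rewrite add0r expR0 mul1r.
have hB : `|B| <= e' * `|t|.
  by have := h2 t (le_lt_trans tH hd2); rewrite add0r cos0 sin0 oppr0 mul0r subr0.
have hD : `|D| <= e' * `|t|.
  by have := h3 t (le_lt_trans tH hd3); rewrite add0r cos0 sin0 mul1r subr0.
have hE : h = (s +i* t)%C by rewrite /s /t; case: (h).
have s1 : `|s| <= 1 by apply: le_trans sH _; rewrite (le_trans (ltW hde)).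
have te : `|t| <= e' by apply: le_trans tH _; exact: ltW.
have As : `|A| <= `|s| by apply: le_trans hA _; rewrite ler_piMl.
have U : `|1 + s + A| <= 3.
  apply: le_trans (ler_normD _ _) _; apply: le_trans (lerD (ler_normD _ _) (lexx _)) _.
  by rewrite normr1; lra.
have V : `|s + A| <= 2 * `|s| by apply: le_trans (ler_normD _ _) _; lra.
have Es : expR s = 1 + s + A by rewrite /A; ring.
have Ec : cos t = 1 + B by rewrite /B; ring.
have Et : sin t = t + D by rewrite /D; ring.
rewrite -/H; apply: le_trans (nc_le_ReIm _) _.
rewrite hE /= !add0r Es Ec Et expR0 cos0 sin0.
set X := (X in `|X| + _ <= _); set Y := (Y in _ + `|Y| <= _).
have -> : X = A + B * (1 + s + A) by rewrite /X; ring.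
have -> : Y = D * (1 + s + A) + (s + A) * t by rewrite /Y; ring.
apply: le_trans (lerD (ler_normD _ _) (ler_normD _ _)) _; rewrite !normrM.
have hB' : `|B| * `|1 + s + A| <= e' * `|t| * 3 by apply: ler_pM.
have hD' : `|D| * `|1 + s + A| <= e' * `|t| * 3 by apply: ler_pM.
have hV' : `|s + A| * `|t| <= 2 * `|s| * e' by apply: ler_pM.
have sH' : e' * `|s| <= e' * H by rewrite ler_wpM2l// ltW.
have tH' : e' * `|t| <= e' * H by rewrite ler_wpM2l// ltW.
have : 9 * e' * H <= e * H by rewrite ler_wpM2r// nc_ge0.
lra.
Qed.

Lemma cderiv_cexp (w : C) : cderiv cexp w (cexp w).
Proof.
move=> e e0; have ew0 : 0 < nc (cexp w) by rewrite nc_cexp expR_gt0.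
have [d d0 hd] := cderiv_cexp0 (divr_gt0 e0 ew0); exists d => // h /hd.
rewrite add0r cexp0 mul1r => H.
rewrite cexpD (_ : _ - _ - _ = cexp w * (cexp h - 1 - h)); last by ring.
by rewrite ncM mulrC -ler_pdivlMr// mulrAC.
Qed.

(** The rectangle in the logarithmic coordinate stands for an annulus whose outer circle has radius
    [r]. The constant 4 is 2 from [rderiv_bound] times 2 from bounding [F w - F 0] by [2 M]. *)
Lemma cauchy_estimate (F dF : C -> C) (M r : R) :
  (forall w, cderiv F w (dF w)) -> 0 < r ->
  (forall w, nc w <= r -> nc (F w) <= M) -> nc (dF 0) <= 4 * (M / r).
Proof.
move=> hF r0 hM; apply/ler_addgt0Pr => e e0.
have e20 : 0 < e / 2 by rewrite divr_gt0.
pose g z := cexp (- z) * (F (cexp z) - F 0).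
have hg w : cderiv g w (cexp (- w) * -1 * (F (cexp w) - F 0) +
    cexp (- w) * (dF (cexp w) * cexp w + 0)).
  apply: (@cderivM _ (fun z => cexp (- z)) (fun z => F (cexp z) - F 0)).
    apply: (@cderiv_comp _ cexp -%R); last exact: cderiv_cexp.
    have := cderivM (cderiv_cst (-1) w) (@cderiv_id R w).
    rewrite mul0r add0r mulr1; congr cderiv.
    by apply/funext => z /=; rewrite mulN1r.
  apply: (@cderivD _ (fun z => F (cexp z)) (fun=> - F 0)); last exact: cderiv_cst.
  apply: cderiv_comp; [exact: cderiv_cexp|exact: hF].
have [d d0 hd] := hF 0 _ e20.
(* The inner circle has radius below [d], where [F] is close to its linear part, and at most [r]. *)
pose s2 := ln r; pose s1 := ln (Num.min d r / 2).
have m0 : 0 < Num.min d r by rewrite lt_min d0.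
have s12 : s1 <= s2.
  rewrite /s1 /s2 ler_ln ?posrE ?divr_gt0//.
  have : Num.min d r <= r by rewrite ge_min lexx orbT.
  lra.
have es1 : expR s1 < d.
  rewrite /s1 lnK ?posrE ?divr_gt0//.
  have : Num.min d r <= d by rewrite ge_min lexx.
  lra.
have es2 : expR s2 = r by rewrite /s2 lnK.
clearbody s1 s2.
(* One base point serves both directions, so it must lie left of [s1] and below the ordinate 0. *)
pose A := Num.min s1 0 - 1.
have m1 : Num.min s1 0 <= s1 by rewrite ge_min lexx.
have m2 : Num.min s1 0 <= 0 by rewrite ge_min lexx orbT.
have A1 : A < s1 by rewrite /A; lra.
have A2 : A < 0 by rewrite /A; lra.
have pi0 : 0 <= 2 * pi :> R by rewrite mulr_ge0// pi_ge0.
have := rect_eq0 hg A1 A2 s12 pi0.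
(* By periodicity of the exponential the two horizontal sides cancel. *)
have -> : rect g A s1 s2 0 (2 * pi) = (vprim g A s2 (2 * pi) - vprim g A s2 0) -
     (vprim g A s1 (2 * pi) - vprim g A s1 0).
  rewrite /rect (_ : hprim g A (2 * pi) = hprim g A 0); first by rewrite subrr add0r.
  rewrite /hprim; congr cprim; apply/funext => t.
  by rewrite /g !cexpNV cexp_2pi.
move/eqP; rewrite subr_eq0 => /eqP J12.
(* On the left side [g] is within [e / 2] of [dF 0]; subtracting the linear path of slope
   [iC * dF 0] leaves a path with small derivative. *)
have b1 : nc ((vprim g A s1 (2 * pi) - (0 + (2 * pi)%:C%C * (iC * dF 0))) -
    (vprim g A s1 0 - (0 + 0%:C%C * (iC * dF 0)))) <= 2 * (e / 2) * (2 * pi - 0).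
  apply: (@rderiv_bound R (fun y => vprim g A s1 y - (0 + y%:C%C * (iC * dF 0)))
     _ 0 (2 * pi) (e / 2) pi0) => t t0 _.
    apply: rderivB; first exact: (rderiv_vprim hg s1 (lt_le_trans A2 t0)).
    exact: (@cderiv_line _ id 0 _ 1 t (cderiv_id _)).
  rewrite /= mul1r -mulrBr ncM nc_i mul1r /g; set z := (s1 +i* t)%C.
  have -> : cexp (- z) * (F (cexp z) - F 0) - dF 0 =
     cexp (- z) * (F (cexp z) - F 0 - dF 0 * cexp z).
    by rewrite !mulrBr mulrCA cexpN mulr1.
  have := hd (cexp z); rewrite nc_cexp => /(_ es1); rewrite add0r => H.
  rewrite ncM nc_cexp /= expRN mulrC ler_pdivrMr ?expR_gt0//.
have b2 : nc (vprim g A s2 (2 * pi) - vprim g A s2 0) <= 2 * (2 * M / r) * (2 * pi - 0).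
  apply: (@rderiv_bound R (vprim g A s2) _ 0 (2 * pi) (2 * M / r) pi0) => t t0 _.
    exact: (rderiv_vprim hg s2 (lt_le_trans A2 t0)).
  rewrite ncM nc_i mul1r /g; set z := (s2 +i* t)%C.
  rewrite ncM.
  have -> : nc (cexp (- z)) = r^-1 by rewrite nc_cexp /= expRN es2.
  rewrite [leRHS]mulrC; apply: ler_wpM2l; first by rewrite invr_ge0 ltW.
  have c1 : nc (F (cexp z)) <= M by apply: hM; rewrite nc_cexp /= es2.
  have c2 : nc (F 0) <= M by apply: hM; rewrite nc0 ltW.
  apply: le_trans (ncB _ _) _; lra.
rewrite J12 in b2.
have : nc (dF 0) * (2 * pi) <= (e + 4 * (M / r)) * (2 * pi).
  have -> : nc (dF 0) * (2 * pi) = nc (iC * dF 0 * (2 * pi)%:C%C).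
    by rewrite !ncM nc_i mul1r nc_real ger0_norm.
  have -> : iC * dF 0 * (2 * pi)%:C%C = (vprim g A s1 (2 * pi) - vprim g A s1 0) -
      ((vprim g A s1 (2 * pi) - (0 + (2 * pi)%:C%C * (iC * dF 0))) -
       (vprim g A s1 0 - (0 + 0%:C%C * (iC * dF 0)))).
    by rewrite (rmorph0 (real_complex R)); ring.
  apply: le_trans (ncB _ _) _; apply: le_trans (lerD b2 b1) _.
  lra.
rewrite ler_pM2r; first by rewrite addrC.
by apply: mulr_gt0; [rewrite ltr0n|exact: pi_gt0].
Qed.

End CauchyEstimate.

(** * Homogeneous holomorphic functions of several variables *)

Section EntireVector.
Context {R : realType} {N : nat}.
Local Notation C := R[i].
Local Notation nc := (@ComplexField.Normc.normc R).
Local Notation V := 'cV[C]_N.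
Implicit Types (F G : V -> C) (z h v : V).

Definition vn z : R := \sum_i nc (z i 0).

Lemma vn_ge0 z : 0 <= vn z.
Proof. by apply: sumr_ge0 => i _; exact: nc_ge0. Qed.

Lemma vnD z v : vn (z + v) <= vn z + vn v.
Proof. by rewrite /vn -big_split ler_sum// => i _; rewrite mxE ncD. Qed.

Lemma vnZ (c : C) z : vn (c *: z) = nc c * vn z.
Proof. by rewrite /vn mulr_sumr; apply: eq_bigr => i _; rewrite mxE ncM. Qed.

Lemma vn0 : vn 0 = 0.
Proof. by rewrite /vn big1// => i _; rewrite mxE nc0. Qed.

Lemma nc_le_vn z i : nc (z i 0) <= vn z.
Proof. by rewrite /vn (bigD1 i)//= lerDl sumr_ge0// => k _; exact: nc_ge0. Qed.

Definition lin (L : 'I_N -> C) h : C := \sum_i L i * h i 0.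

Lemma linZ L (c : C) h : lin L (c *: h) = c * lin L h.
Proof. by rewrite /lin mulr_sumr; apply: eq_bigr => i _; rewrite mxE mulrCA. Qed.

Definition vderiv F z (L : 'I_N -> C) := forall e : R, 0 < e -> exists2 d : R, 0 < d &
  forall h, vn h < d -> nc (F (z + h) - F z - lin L h) <= e * vn h.

Definition vdiff F z := exists L, vderiv F z L.

Lemma vderiv_line F z v (w : C) L : vderiv F (z + w *: v) L ->
  cderiv (fun w => F (z + w *: v)) w (lin L v).
Proof.
move=> dF e e0; have v0 : 0 < vn v + 1 by rewrite ltr_wpDl ?vn_ge0.
have [d d0 hd] := dF _ (divr_gt0 e0 v0).
exists (d / (vn v + 1)) => [|h hh]; first by rewrite divr_gt0.
have hv : vn (h *: v) <= nc h * (vn v + 1) by rewrite vnZ ler_wpM2l ?nc_ge0// lerDl.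
have /hd : vn (h *: v) < d by apply: le_lt_trans hv _; rewrite -ltr_pdivlMr.
rewrite /= scalerDl addrA linZ [h * lin L v]mulrC => H; apply: le_trans H _.
by rewrite mulrAC ler_pdivrMr// -[leRHS]mulrA ler_wpM2l// ltW.
Qed.

Lemma vdiff_shift F h z : vdiff F (z + h) -> vdiff (fun z => F (z + h)) z.
Proof.
move=> [L dF]; exists L => e /dF[d d0 hd]; exists d => // k /hd.
by rewrite (addrAC z h k).
Qed.

Lemma vdiffB F G z : vdiff F z -> vdiff G z -> vdiff (fun z => F z - G z) z.
Proof.
move=> [L dF] [M dG]; exists (fun i => L i - M i) => e e0.
have e20 : 0 < e / 2 by rewrite divr_gt0.
have [d1 d10 h1] := dF _ e20; have [d2 d20 h2] := dG _ e20.
exists (Num.min d1 d2) => [|h]; first by rewrite lt_min d10.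
rewrite lt_min => /andP[/h1 {}h1 /h2 {}h2].
have -> : lin (fun i => L i - M i) h = lin L h - lin M h.
  by rewrite /lin -sumrB; apply: eq_bigr => i _; rewrite mulrBl.
rewrite (_ : _ - _ - _ = (F (z + h) - F z - lin L h) - (G (z + h) - G z - lin M h)); last by ring.
apply: le_trans (ncB _ _) _; lra.
Qed.

Definition entire F := forall z, vdiff F z.

Definition growth (d : nat) F := exists K : R, forall z, nc (F z) <= K * (1 + vn z) ^+ d.

Definition delta h F : V -> C := fun z => F (z + h) - F z.

Lemma entire_delta h F : entire F -> entire (delta h F).
Proof. by move=> eF z; apply: vdiffB => //; apply: vdiff_shift. Qed.

(** Discs of radius [r] around points of the unit disc stay in [nc w <= 1 + r], so the Cauchy
    estimate bounds the derivative along the segment from 0 to 1; 8 is 4 times the 2 of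
    [rderiv_bound]. *)
Lemma cauchy_increment (f df : C -> C) (M r : R) :
  (forall w, cderiv f w (df w)) -> 0 < r ->
  (forall w, nc w <= 1 + r -> nc (f w) <= M) -> nc (f 1 - f 0) <= 8 * (M / r).
Proof.
move=> hf r0 hM.
have bd s : nc s <= 1 -> nc (df s) <= 4 * (M / r).
  move=> s1.
  have hg w : cderiv (fun w => f (s + w)) w (df (s + w) * 1).
    apply: (@cderiv_comp _ f (fun w => s + w)); last exact: hf.
    by have := cderivD (cderiv_cst s w) (@cderiv_id R w); rewrite add0r.
  have := cauchy_estimate hg r0; rewrite addr0 mulr1; apply => w wr.
  by apply: hM; apply: le_trans (ncD _ _) _; rewrite lerD.
suff H : nc (f (0 + (1 : R)%:C%C * 1) - f (0 + (0 : R)%:C%C * 1)) <= 2 * (4 * (M / r)) * (1 - 0).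
  by move: H; rewrite rmorph1 rmorph0 mul0r mulr1 addr0 add0r; lra.
apply: (@rderiv_bound R (fun t => f (0 + t%:C%C * 1)) (fun t => df t%:C%C) 0 1 _ ler01) => t t0 t1.
  by have := @cderiv_line R f 0 1 (df t%:C%C) t; rewrite !mulr1 add0r; apply; exact: hf.
by apply: bd; rewrite nc_real ger0_norm.
Qed.

Lemma entire_line F z v : entire F ->
  exists df, forall w, cderiv (fun w => F (z + w *: v)) w (df w).
Proof.
move=> eF; have ex w : exists c, cderiv (fun w => F (z + w *: v)) w c.
  by have [L /vderiv_line dL] := eF (z + w *: v); exists (lin L v).
by have [df hdf] := boolp.choice ex; exists df.
Qed.

Lemma delta_le h F z (M r : R) : entire F -> 0 < r ->
  (forall w, nc w <= 1 + r -> nc (F (z + w *: h)) <= M) -> nc (delta h F z) <= 8 * (M / r).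
Proof.
move=> eF r0 hM; have [df hdf] := entire_line z h eF.
by have := cauchy_increment hdf r0 hM; rewrite scale1r scale0r addr0.
Qed.

(** The Cauchy estimate is used with radius [1 + vn z]. On that disc [F] is still of order
    [(1 + vn z)^(d+1)], and dividing by the radius removes one power. *)
Lemma growth_delta d h F : entire F -> growth d.+1 F -> growth d (delta h F).
Proof.
move=> eF [K hK]; exists (8 * K * (1 + 2 * vn h) ^+ d.+1) => z.
have K0 : 0 <= K.
  by have := hK 0; rewrite vn0 addr0 expr1n mulr1; apply: le_trans; exact: nc_ge0.
have r0 : 0 < 1 + vn z by rewrite ltr_pwDl ?vn_ge0.
have hp : 0 <= vn h by exact: vn_ge0.
have zp : 0 <= vn z by exact: vn_ge0.
have := @delta_le h F z (K * ((1 + vn z) * (1 + 2 * vn h)) ^+ d.+1) _ eF r0.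
move=> H; apply: (le_trans (H _)) => [w hw|].
  apply: le_trans (hK _) _; apply: ler_wpM2l => //; rewrite ler_pXn2r ?nnegrE//; last 2 first.
  - have := vn_ge0 (z + w *: h); lra.
  - by rewrite mulr_ge0//; lra.
  apply: (@le_trans _ _ (1 + (vn z + (1 + (1 + vn z)) * vn h))).
    by rewrite lerD2l; apply: le_trans (vnD _ _) _; rewrite vnZ lerD2l ler_wpM2r.
  have : 0 <= vn z * vn h by rewrite mulr_ge0.
  nra.
rewrite exprMn [(1 + vn z) ^+ d.+1]exprS le_eqVlt; apply/orP; left; apply/eqP.
by field; rewrite gt_eqF.
Qed.

(** Liouville's theorem: the radius in [delta_le] is arbitrary. *)
Lemma delta_growth0 h F z : entire F -> growth 0 F -> delta h F z = 0.
Proof.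
move=> eF [K hK]; apply: nc_le0 => e e0.
have K0 : 0 <= K.
  by have := hK 0; rewrite expr0 mulr1; apply: le_trans; exact: nc_ge0.
have r0 : 0 < 8 * (K + 1) / e by rewrite divr_gt0// mulr_gt0// ltr_wpDl.
have := @delta_le h F z K _ eF r0.
move=> H; apply: (le_trans (H _)) => [w _|].
  by have := hK (z + w *: h); rewrite expr0 mulr1.
have K1 : K + 1 != 0 by rewrite gt_eqF// ltr_wpDl.
rewrite invf_div mulrA mulrCA -[leRHS]mulr1 ler_wpM2l ?(ltW e0)//.
by rewrite ler_pdivrMr ?mulr_gt0 ?ltr_wpDl// mul1r ler_wpM2l// lerDl.
Qed.

Fixpoint deltas (hs : seq V) F : V -> C :=
  if hs is h :: hs' then delta h (deltas hs' F) else F.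

Lemma entire_deltas hs F : entire F -> entire (deltas hs F).
Proof. by elim: hs => //= h hs IH /IH; exact: entire_delta. Qed.

Lemma growth_deltas hs d F : entire F -> growth (size hs + d) F -> growth d (deltas hs F).
Proof.
elim: hs d => //= h hs IH d eF gF; apply: growth_delta; first exact: entire_deltas.
by apply: IH => //; rewrite addnS.
Qed.

Lemma deltas_eq0 h hs F z : entire F -> growth (size hs) F -> deltas (h :: hs) F z = 0.
Proof.
move=> eF gF; apply: delta_growth0; first exact: entire_deltas.
by apply: growth_deltas => //; rewrite addn0.
Qed.

Lemma deltas_swap (h k : V) hs F : deltas [:: h, k & hs] F = deltas [:: k, h & hs] F.
Proof. by apply/funext => z /=; rewrite /delta (addrAC z h k); ring. Qed.

Lemma deltas_nseq h z k hs F : deltas (h :: nseq k z ++ hs) F = deltas (nseq k z ++ h :: hs) F.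
Proof. by elim: k => //= k <-; exact: deltas_swap. Qed.

(* [F - F 0] is additive and differentiable at the origin, so it equals its
   derivative there. *)
Lemma affine_of_deltas F : entire F -> (forall h k z, deltas [:: h; k] F z = 0) ->
  exists L, forall z, F z = F 0 + lin L z.
Proof.
move=> eF F2; have [L dF] := eF 0; exists L => z.
have add h k : F (h + k) - F 0 = (F h - F 0) + (F k - F 0).
  by apply/eqP; rewrite -subr_eq0; apply/eqP; rewrite -(F2 h k 0) /= /delta !add0r; ring.
have addn n h : F (h *+ n) - F 0 = (F h - F 0) *+ n.
  by elim: n => [|n IH]; rewrite ?mulr0n ?subrr// mulrS add IH -mulrS.
apply/eqP; rewrite addrC -subr_eq -subr_eq0; apply/eqP; apply: nc_le0 => e e0.
have v0 : 0 < vn z + 1 by rewrite ltr_wpDl ?vn_ge0.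
have [d d0 hd] := dF _ (divr_gt0 e0 v0).
have [n hn] : exists n : nat, vn z / n.+1%:R < d.
  exists (Num.truncn (vn z / d)).
  by rewrite ltr_pdivrMr// mulrC -ltr_pdivrMr// truncnS_gt.
have nz : (n.+1%:R : C) != 0 by rewrite pnatr_eq0.
have ncn : nc (n.+1%:R : C) = n.+1%:R.
  by rewrite -(rmorph_nat (real_complex R)) nc_real ger0_norm.
pose y := (n.+1%:R : C)^-1 *: z.
have zy : z = y *+ n.+1 by rewrite /y -scaler_nat scalerA divff// scale1r.
have ncV : nc ((n.+1%:R : C)^-1) = n.+1%:R^-1 by rewrite ComplexField.Normc.normcV ncn.
have vy : vn y = vn z / n.+1%:R by rewrite /y vnZ ncV mulrC.
have := hd y; rewrite vy add0r => /(_ hn) H.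
have -> : F z - F 0 - lin L z = n.+1%:R * (F y - F 0 - lin L y).
  rewrite [in LHS]zy addn -scaler_nat linZ -mulr_natl; ring.
rewrite ncM ncn; apply: le_trans (ler_wpM2l _ H) _ => //.
rewrite mulrC -mulrA divfK ?pnatr_eq0// mulrAC ler_pdivrMr// ler_wpM2l ?(ltW e0)// lerDl//.
Qed.

End EntireVector.

Import -(notations) mpoly.

(** * Finite differences of univariate polynomials *)

Section FiniteDifference.
Variable K : comNzRingType.
Implicit Types p : {poly K}.

Definition pdelta p := p \Po ('X + 1%:P) - p.

Lemma coefXD1n (n k : nat) : ((('X + 1%:P) ^+ n : {poly K})`_k) = 'C(n, k)%:R.
Proof.
rewrite addrC exprDn_comm; last exact: commr_polyX.
rewrite coef_sum; under eq_bigr do rewrite coefMn -rmorphXn expr1n mul1r coefXn.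
have [kn|nk] := leqP k n; last first.
  rewrite bin_small// big1// => i _; case: eqP => [ki|_]; last by rewrite mul0rn.
  by move: (ltn_ord i); rewrite -ki ltnS leqNgt nk.
rewrite (bigD1 (inord k : 'I_n.+1))//= inordK// eqxx big1 ?addr0// => i ik.
rewrite (_ : (k == i) = false) ?mul0rn//; apply: contraNF ik => /eqP ki.
by apply/eqP/val_inj; rewrite /= inordK.
Qed.

Lemma coef_pdelta p (n k : nat) : (size p <= n)%N ->
  (pdelta p)`_k = \sum_(i < n) p`_i *+ 'C(i, k) - p`_k.
Proof.
move=> pn; rewrite coefB comp_polyE coef_sum; congr (_ - _).
rewrite (big_ord_widen n (fun i => (p`_i *: ('X + 1%:P) ^+ i)`_k))//.
rewrite big_mkcond /=; apply: eq_bigr => i _; rewrite coefZ coefXD1n mulr_natr.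
by case: ltnP => // h; rewrite nth_default// mul0rn.
Qed.

Lemma size_pdelta p n : (size p <= n.+2)%N -> (size (pdelta p) <= n.+1)%N.
Proof.
move=> pn; apply/leq_sizeP => k nk; rewrite (coef_pdelta k pn).
have [->|kn] := eqVneq k n.+1.
  rewrite big_ord_recr /= binn mulr1n big1 ?add0r ?subrr// => i _.
  by rewrite bin_small ?mulr0n.
have {kn nk}kn : (n.+2 <= k)%N by rewrite ltn_neqAle eq_sym kn.
rewrite big1 ?sub0r => [|i _]; last by rewrite bin_small ?mulr0n// (leq_trans (ltn_ord i)).
by rewrite nth_default ?oppr0// (leq_trans pn).
Qed.

Lemma lead_pdelta p n : (size p <= n.+2)%N -> (pdelta p)`_n = p`_n.+1 *+ n.+1.
Proof.
move=> pn; rewrite (coef_pdelta n pn) 2!big_ord_recr /= binn binSn mulr1n.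
rewrite big1 => [|i _]; last by rewrite bin_small ?mulr0n.
by rewrite add0r addrAC subrr add0r.
Qed.

(** Each difference lowers the degree by one and multiplies the leading coefficient by the old
    degree. Applied to [y -> G (y z)], this recovers [d! G z] from differences of [G]. *)
Lemma iter_pdelta p n : (size p <= n.+1)%N -> iter n pdelta p = (p`_n *+ n`!)%:P.
Proof.
elim: n p => [|n IH] p pn; first by rewrite /= mulr1n; exact: size1_polyC.
rewrite iterSr IH; last exact: size_pdelta.
by rewrite lead_pdelta// -mulrnA factS.
Qed.

Lemma horner_pdelta p x : (pdelta p).[x] = p.[x + 1] - p.[x].
Proof. by rewrite /pdelta hornerD hornerN horner_comp hornerD hornerX hornerC. Qed.

End FiniteDifference.

(** * Polarization: homogeneous entire functions of finite growth are polynomials *)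

Section HomogeneousEntire.
Context {R : realType} {N : nat}.
Local Notation C := R[i].
Local Notation nc := (@ComplexField.Normc.normc R).
Local Notation V := 'cV[C]_N.
Implicit Types (F G : V -> C) (z h v : V).

Definition polyfun F :=
  exists p : mpoly N C, forall z, F z = meval (fun i => z i 0) p.

Lemma polyfun_cst c : polyfun (fun=> c).
Proof. by exists (mpolyC N c) => z; rewrite mevalC. Qed.

Lemma polyfun_sum (I : Type) (s : seq I) (F : I -> V -> C) :
  (forall i, polyfun (F i)) -> polyfun (fun z => \sum_(i <- s) F i z).
Proof.
move=> pF; elim: s => [|i s [p hp]].
  by exists 0 => z; rewrite big_nil rmorph0.
have [q hq] := pF i; exists (q + p) => z.
by rewrite big_cons rmorphD /= hp hq.
Qed.

Lemma polyfun_coordM (i : 'I_N) F : polyfun F -> polyfun (fun z => z i 0 * F z).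
Proof.
move=> [p hp]; exists (mpolyX C (mnm1 i) * p) => z.
by rewrite rmorphM /= mevalXU hp.
Qed.

Lemma polyfunZ c F : polyfun F -> polyfun (fun z => c * F z).
Proof.
move=> [p hp]; exists (mpolyC N c * p) => z.
by rewrite rmorphM /= mevalC hp.
Qed.

Lemma deltas_nseq_poly F z (p : {poly C}) : (forall y : nat, F (y%:R *: z) = p.[y%:R]) ->
  forall k (y : nat), deltas (nseq k z) F (y%:R *: z) = (iter k (@pdelta C) p).[y%:R].
Proof.
move=> Fp; elim=> [|k IH] y //=.
have E : y%:R *: z + z = y.+1%:R *: z by rewrite -natr1 scalerDl scale1r.
by rewrite /delta E !IH horner_pdelta natr1.
Qed.

(** Differences of order [d + 1] vanish, so a difference of order [d] at 0 is linear in each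
    direction. Expanding one occurrence of [z] in the standard basis produces a coordinate and
    leaves [e - 1] occurrences. *)
Lemma polyfun_deltas d G : entire G -> growth d G ->
  forall e hs, (size hs + e)%N = d -> polyfun (fun z => deltas (nseq e z ++ hs) G 0).
Proof.
move=> eG gG; elim=> [|e IH] hs hsd; first exact: polyfun_cst.
pose f z := \sum_(i < N) z i 0 * deltas (nseq e z ++ delta_mx i 0 :: hs) G 0.
suff -> : (fun z => deltas (nseq e.+1 z ++ hs) G 0) = f.
  apply: polyfun_sum => i; apply: polyfun_coordM; apply: IH.
  by rewrite /= addSnnS.
apply/funext => z; set rest := nseq e z ++ hs.
have srest : (size rest).+1 = d by rewrite size_cat size_nseq addnC -hsd addnS.
(* [rest] has [d - 1] directions, so two further differences give 0 and [deltas rest G] is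
   affine. *)
have [||L hL] := @affine_of_deltas R N (deltas rest G).
- exact: entire_deltas.
- move=> h k y; apply: (@deltas_eq0 _ _ h (k :: rest)) => //.
  by rewrite /= srest.
have dl h : deltas (h :: rest) G 0 = lin L h.
  by rewrite /= /delta add0r hL [LHS]addrC addKr.
rewrite -[LHS]/(deltas (z :: rest) G 0) dl /f /lin; apply: eq_bigr => i _.
rewrite -deltas_nseq -/rest dl mulrC; congr (_ * _).
rewrite /lin (bigD1 i)//= mxE !eqxx mulr1 big1 ?addr0// => j ji.
by rewrite mxE (negbTE ji) mulr0.
Qed.

(* Polarization: the [d]-th difference at the origin is multilinear, and its
   diagonal is [d`!] times a homogeneous function of degree [d]. *)
Lemma homogeneous_entire_polyfun d G : entire G -> growth d G ->
  (forall (n : nat) z, G (n%:R *: z) = n%:R ^+ d * G z) -> polyfun G.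
Proof.
move=> eG gG hG.
have d0 : (d`!%:R : C) != 0 by rewrite pnatr_eq0 -lt0n fact_gt0.
have -> : G = fun z => d`!%:R^-1 * deltas (nseq d z ++ [::]) G 0.
  apply/funext => z; rewrite cats0.
  have := @deltas_nseq_poly G z (G z *: 'X^d) _ d 0%N.
  rewrite scale0r => -> => [|y]; last by rewrite hornerZ hornerXn mulrC hG.
  rewrite iter_pdelta; last by rewrite (leq_trans (size_scale_leq _ _))// size_polyXn.
  by rewrite hornerC coefZ coefXn eqxx mulr1 -[G z *+ _]mulr_natl mulKf.
by apply: polyfunZ; apply: (polyfun_deltas eG gG); rewrite add0n.
Qed.

End HomogeneousEntire.

(** * From circle homogeneity on the ball to an entire homogeneous function *)

Section HomogeneousOnBall.
Context {R : realType} {N : nat}.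
Local Notation C := R[i].
Local Notation nc := (@ComplexField.Normc.normc R).
Local Notation V := 'cV[C]_N.
Implicit Types (F G : V -> C) (z h v : V).

Lemma sqnormZ (c : C) z : sqnorm (c *: z) = nc c ^+ 2 * sqnorm z.
Proof. by rewrite /sqnorm mulr_sumr; apply: eq_bigr => i _; rewrite mxE ncM exprMn. Qed.

Lemma sqnorm_ge0 z : 0 <= sqnorm z.
Proof. by apply: sumr_ge0 => i _; exact: sqr_ge0. Qed.

Lemma cball_scale (c : C) z : nc c <= 1 -> cball z -> cball (c *: z).
Proof.
rewrite /cball /= sqnormZ => c1 z1; apply: le_lt_trans z1.
by rewrite ler_piMl ?sqnorm_ge0// exprn_ile1 ?nc_ge0.
Qed.

Lemma vn_lt1_cball z : vn z < 1 -> cball z.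
Proof.
move=> z1; apply: (@le_lt_trans _ _ (vn z)) => //.
apply: ler_sum => i _; rewrite expr2 ler_piMl ?nc_ge0//.
exact: le_trans (nc_le_vn z i) (ltW z1).
Qed.

(** Rational parametrization of the circle: [t = (1 + iu) / (1 - iu)], with
    [t - 1 = 2iu / (1 - iu)]. *)
Lemma unit_near1 (d : R) : 0 < d -> exists t : C, [/\ nc t = 1, t != 1 & nc (t - 1) < d].
Proof.
move=> d0; pose u := Num.min (d / 4) 1.
have u0 : 0 < u by rewrite lt_min divr_gt0 ?ltr01.
have ud : 4 * u <= d by rewrite mulrC -ler_pdivlMr// ge_min lexx.
clearbody u; pose a : C := (1 +i* u)%C; pose b : C := (1 +i* (- u))%C.
have nb1 : 1 <= nc b by have := Re_le_nc b; rewrite /= normr1.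
have b0 : b != 0 by rewrite -nc_gt0 (lt_le_trans _ nb1).
have nab : nc a = nc b by rewrite /= sqrrN.
have tb : a / b - 1 = (0 +i* (2 * u))%C / b.
  rewrite -[X in _ - X](divff b0) -mulrBl; congr (_ / _).
  by apply/eqP; rewrite eq_complex /= subrr opprK mulr2n mulrDl mul1r !eqxx.
have nu : nc (0 +i* (2 * u))%C = 2 * u.
  by rewrite /= expr0n add0r sqrtr_sqr ger0_norm// mulr_ge0// ltW.
exists (a / b); split.
- by rewrite ncM ComplexField.Normc.normcV nab divff// gt_eqF// (lt_le_trans _ nb1).
- by rewrite -subr_eq0 tb mulf_eq0 invr_eq0 negb_or b0 andbT -nc_eq0 nu mulf_neq0// gt_eqF.
- rewrite tb ncM ComplexField.Normc.normcV nu.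
  apply: (@le_lt_trans _ _ (2 * u)); last lra.
  by rewrite ler_piMr ?invf_le1 ?(lt_le_trans _ nb1)// mulr_ge0// ltW.
Qed.

Lemma nc_expB1 (t : C) n : nc t = 1 -> nc (t ^+ n - 1) <= n%:R * nc (t - 1).
Proof.
move=> t1; elim: n => [|n IH]; first by rewrite expr0 subrr nc0 mul0r.
have -> : t ^+ n.+1 - 1 = t * (t ^+ n - 1) + (t - 1) by rewrite exprS; ring.
apply: le_trans (ncD _ _) _; rewrite ncM t1 mul1r -natr1 mulrDl mul1r.
by rewrite lerD2r.
Qed.

(* Differentiate [g (t *: x) = t ^+ d * g x] along the unit circle at [t = 1]. *)
Lemma euler_circle (g : V -> C) d x L : vderiv g x L ->
  (forall t, nc t = 1 -> g (t *: x) = t ^+ d * g x) -> lin L x = d%:R * g x.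
Proof.
move=> dg hg; apply/eqP; rewrite -subr_eq0; apply/eqP; apply: nc_le0 => e e0.
have x0 : 0 < vn x + 1 by rewrite ltr_wpDl ?vn_ge0.
have e1 : 0 < e / 2 / (vn x + 1) by rewrite !divr_gt0.
have [dl dl0 hd] := dg _ e1.
pose K := (d%:R * d%:R) * nc (g x) + 1.
have K0 : 0 < K by rewrite ltr_wpDl// mulr_ge0 ?nc_ge0// mulr_ge0.
have [t [t1 tn1 td]] : exists t : C, [/\ nc t = 1, t != 1 &
    nc (t - 1) < Num.min (dl / (vn x + 1)) (e / 2 / K)].
  by apply: unit_near1; rewrite lt_min !divr_gt0.
move: td; rewrite lt_min => /andP[td1 td2].
pose eta := t - 1.
have eta0 : eta != 0 by rewrite subr_eq0.
(* [S] is the quotient [(t^d - 1) / (t - 1)], which tends to [d] as [t] tends to 1. *)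
pose S := \sum_(i < d) t ^+ i.
have tS : t ^+ d - 1 = eta * S by rewrite subrX1.
have Sd : nc (S - d%:R) <= d%:R * d%:R * nc eta.
  have -> : S - d%:R = \sum_(i < d) (t ^+ i - 1) by rewrite sumrB sumr_const card_ord.
  apply: (@le_trans _ _ (\sum_(i < d) nc (t ^+ i - 1))).
    elim/big_ind2 : _ => [|? ? ? ? H1 H2|//]; first by rewrite nc0.
    by apply: le_trans (ncD _ _) (lerD H1 H2).
  apply: (@le_trans _ _ (\sum_(i < d) d%:R * nc eta)).
    apply: ler_sum => i _; apply: le_trans (nc_expB1 i t1) _.
    by rewrite ler_wpM2r ?nc_ge0// ler_nat ltnW.
  by rewrite sumr_const card_ord -[(_ * _) *+ _]mulr_natl mulrA.
have vd : vn (eta *: x) < dl.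
  rewrite vnZ; apply: (@le_lt_trans _ _ (nc eta * (vn x + 1))).
    by rewrite ler_wpM2l ?nc_ge0// lerDl.
  by rewrite -ltr_pdivlMr.
have := hd _ vd; rewrite linZ.
have -> : x + eta *: x = t *: x by rewrite /eta scalerBl scale1r addrC subrK.
rewrite hg// vnZ.
have -> : t ^+ d * g x - g x - eta * lin L x = eta * (S * g x - lin L x).
  by rewrite mulrBr mulrA -tS; ring.
rewrite ncM mulrCA ler_pM2l ?nc_gt0// => H.
have -> : lin L x - d%:R * g x = (S - d%:R) * g x - (S * g x - lin L x) by ring.
apply: le_trans (ncB _ _) _; rewrite ncM.
have H1 : nc (S - d%:R) * nc (g x) <= e / 2.
  apply: (@le_trans _ _ (d%:R * d%:R * nc eta * nc (g x))).
    by rewrite ler_wpM2r ?nc_ge0.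
  apply: (@le_trans _ _ (nc eta * K)); last by rewrite -ler_pdivlMr// ltW.
  by rewrite mulrAC mulrC ler_wpM2l ?nc_ge0// lerDl.
have H2 : e / 2 / (vn x + 1) * vn x <= e / 2.
  by rewrite mulrAC ler_pdivrMr// ler_wpM2l ?divr_ge0 ?(ltW e0)// lerDl.
lra.
Qed.

Variables (g : V -> C) (d : nat).
Hypothesis gdiff : forall z, cball z -> vdiff g z.
Hypothesis ghomog : forall t z, nc t = 1 -> cball z -> g (t *: z) = t ^+ d * g z.

(** By Euler's relation, [exp (- d w) g (exp w z)] has derivative 0 wherever [exp w z] is kept in
    the ball by [Re w <= 0]; it is therefore constant on the real segment from [ln r] to 0. *)
Lemma ball_radial (r : R) z : 0 < r -> r <= 1 -> cball z -> g (r%:C%C *: z) = r%:C%C ^+ d * g z.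
Proof.
move=> r0 r1 zB; pose k : C := - d%:R.
pose f (w : C) := cexp (k * w) * g (0 + cexp w *: z).
have hf (w : C) : complex.Re w <= 0 -> cderiv f w 0.
  move=> w0; have nw : nc (cexp w) <= 1.
    by rewrite nc_cexp -expR0 ler_expR.
  have [L dL] := gdiff (cball_scale nw zB).
  have eul := euler_circle dL (fun t t1 => ghomog t1 (cball_scale nw zB)).
  have c1 : cderiv (fun w => cexp (k * w)) w (cexp (k * w) * k).
    apply: (@cderiv_comp _ cexp (fun w => k * w)); last exact: cderiv_cexp.
    by have := cderivM (cderiv_cst k w) (@cderiv_id R w); rewrite mul0r add0r mulr1.
  have c2 : cderiv (fun w => g (0 + cexp w *: z)) w (lin L z * cexp w).
    apply: (@cderiv_comp _ (fun u => g (0 + u *: z)) cexp); first exact: cderiv_cexp.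
    by apply: vderiv_line; rewrite add0r.
  have := cderivM c1 c2; congr cderiv.
  by rewrite add0r [lin L z * _]mulrC -linZ eul /k; ring.
pose s := ln r.
have s0 : s <= 0 by rewrite /s -ln1 ler_ln ?posrE.
have es : expR s = r by rewrite lnK ?posrE.
have cexpr (x : R) : cexp x%:C%C = (expR x)%:C%C.
  by rewrite /cexp /= cos0 sin0 mulr1 mulr0.
have kE n : cexp (n%:R * s%:C%C) = r%:C%C ^+ n.
  elim: n => [|n IH]; first by rewrite mul0r cexp0 expr0.
  by rewrite -natr1 mulrDl mul1r cexpD IH cexpr es exprSr.
clearbody s.
have := @rderiv_bound R (fun x => f (0 + x%:C%C * 1)) (fun=> 0 * 1) s 0 0 s0.
rewrite mulr0 mul0r => H.
have {}H : nc (f (0 + (0 : R)%:C%C * 1) - f (0 + s%:C%C * 1)) <= 0.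
  apply: H => x sx x0; last by rewrite mul0r nc0.
  by apply: cderiv_line; apply: hf; rewrite mulr1 add0r.
have /eqP : nc (f (0 + (0 : R)%:C%C * 1) - f (0 + s%:C%C * 1)) == 0.
  by rewrite eq_le H nc_ge0.
move/ComplexField.Normc.eq0_normc/eqP; rewrite subr_eq0 rmorph0 mul0r mulr1 !add0r => /eqP.
rewrite /f mulr0 cexp0 mul1r scale1r cexpr es !add0r => ->.
by rewrite /k mulNr cexpNV kE mulVKf// expf_neq0// -nc_gt0 nc_real normr_gt0 gt_eqF.
Qed.

Lemma ball_scale2 (a b : R) z : 0 < a -> 0 < b ->
  cball (a%:C%C *: z) -> cball (b%:C%C *: z) ->
  (a%:C%C ^+ d)^-1 * g (a%:C%C *: z) = (b%:C%C ^+ d)^-1 * g (b%:C%C *: z).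
Proof.
wlog ab : a b / a <= b.
  move=> H a0 b0 aB bB; have [/H|/ltW/H] := leP a b; first by apply.
  by move=> h; apply/esym/h.
move=> a0 b0 aB bB.
have nzC (c : R) : 0 < c -> c%:C%C != 0 :> C by move=> c0; rewrite -nc_gt0 nc_real normr_gt0 gt_eqF.
have -> : a%:C%C *: z = (a / b)%:C%C *: (b%:C%C *: z).
  by rewrite scalerA -rmorphM /= divfK// gt_eqF.
rewrite ball_radial ?divr_gt0// ?ler_pdivrMr ?mul1r//.
rewrite mulrA; congr (_ * _); rewrite rmorphM /= exprMn mulKf ?expf_neq0 ?nzC//.
by rewrite fmorphV exprVn.
Qed.

(** [s z] shrinks [z] into the ball. The 2 leaves room for a unit perturbation, so one factor serves
    a neighbourhood of [z] and differentiability of [g] passes to the homogeneous extension [G]. *)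
Let s z : R := (2 + vn z)^-1.
Let G z : C := ((s z)%:C%C ^+ d)^-1 * g ((s z)%:C%C *: z).

Let s_gt0 z : 0 < s z.
Proof. by rewrite invr_gt0 ltr_pwDl// vn_ge0. Qed.

Let s_cball z h : vn h < 1 -> cball ((s z)%:C%C *: (z + h)).
Proof.
move=> h1; apply: vn_lt1_cball; rewrite vnZ nc_real gtr0_norm// mulrC /s.
rewrite ltr_pdivrMr ?mul1r; last by rewrite ltr_pwDl// vn_ge0.
by apply: le_lt_trans (vnD _ _) _; lra.
Qed.

Let s_cball0 z : cball ((s z)%:C%C *: z).
Proof. by rewrite -{2}[z]addr0; apply: s_cball; rewrite vn0. Qed.

Let G_def (a : R) z : 0 < a -> cball (a%:C%C *: z) -> G z = (a%:C%C ^+ d)^-1 * g (a%:C%C *: z).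
Proof. by move=> a0 aB; apply: ball_scale2. Qed.

Let G_scale (r : R) z : 0 < r -> G (r%:C%C *: z) = r%:C%C ^+ d * G z.
Proof.
move=> r0; have nzC (c : R) : 0 < c -> c%:C%C != 0 :> C.
  by move=> c0; rewrite -nc_gt0 nc_real normr_gt0 gt_eqF.
have E : (s z / r)%:C%C *: (r%:C%C *: z) = (s z)%:C%C *: z.
  by rewrite scalerA -rmorphM /= divfK// gt_eqF.
rewrite (@G_def (s z / r)) ?divr_gt0 ?E// rmorphM exprMn invfM /G mulrA; congr (_ * _).
by rewrite mulrC fmorphV exprVn invrK.
Qed.

Let entireG : entire G.
Proof.
move=> z; have [L dL] := gdiff (s_cball0 z).
pose a := (s z)%:C%C : C; have a0 : 0 < nc a by rewrite nc_real gtr0_norm.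
exists (fun i => (a ^+ d)^-1 * a * L i) => e e0.
pose K := nc ((a ^+ d)^-1) * nc a + 1.
have K0 : 0 < K by rewrite ltr_wpDl// mulr_ge0 ?nc_ge0.
have [dl dl0 hd] := dL _ (divr_gt0 e0 K0).
exists (Num.min 1 (dl / nc a)) => [|h]; first by rewrite lt_min ltr01 divr_gt0.
rewrite lt_min => /andP[h1 h2].
rewrite (G_def (s_gt0 z) (s_cball z h1)) -/a (G_def (s_gt0 z) (s_cball0 z)) -/a scalerDr.
have -> : lin (fun i => (a ^+ d)^-1 * a * L i) h = (a ^+ d)^-1 * lin L (a *: h).
  by rewrite linZ /lin mulrA mulr_sumr; apply: eq_bigr => i _; rewrite mulrA.
rewrite -!mulrBr ncM.
have /hd : vn (a *: h) < dl by rewrite vnZ mulrC -ltr_pdivlMr.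
rewrite vnZ => H; apply: le_trans (ler_wpM2l (nc_ge0 _) H) _.
have -> : nc (a ^+ d)^-1 * (e / K * (nc a * vn h)) = e / K * (nc (a ^+ d)^-1 * nc a) * vn h by ring.
by rewrite ler_wpM2r ?vn_ge0// mulrAC ler_pdivrMr// ler_wpM2l ?(ltW e0)// lerDl.
Qed.

(** Differentiability at 0 bounds [G] near the origin; homogeneity spreads the bound by shrinking
    [z] to length below [dl]. *)
Let growthG : growth d G.
Proof.
have [L dL] := entireG 0; have [dl dl0 hd] := dL 1 ltr01.
pose K0 := nc (G 0) + \sum_i nc (L i) * dl + dl.
have Kb h : vn h < dl -> nc (G h) <= K0.
  move=> hh; have := hd h hh; rewrite add0r mul1r => H.
  have -> : G h = (G h - G 0 - lin L h) + G 0 + lin L h by ring.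
  apply: le_trans (ncD _ _) _; apply: le_trans (lerD (ncD _ _) (lexx _)) _.
  have : nc (lin L h) <= \sum_i nc (L i) * dl.
    rewrite /lin; elim/big_ind2 : _ => [|? ? ? ? H1 H2|i _]; first by rewrite nc0.
      by apply: le_trans (ncD _ _) (lerD H1 H2).
    by rewrite ncM ler_wpM2l ?nc_ge0// (le_trans (nc_le_vn h i))// ltW.
  rewrite /K0; lra.
exists (K0 * (2 / dl) ^+ d) => z.
pose r := dl / (2 * (1 + vn z)).
have z0 : 0 < 1 + vn z by rewrite ltr_pwDl ?vn_ge0.
have r0 : 0 < r by rewrite divr_gt0// mulr_gt0.
have : nc (G (r%:C%C *: z)) <= K0.
  apply: Kb; rewrite vnZ nc_real gtr0_norm// /r mulrAC ltr_pdivrMr ?mulr_gt0//.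
  by rewrite ltr_pM2l//; have := vn_ge0 z; lra.
rewrite G_scale// ncM ncX nc_real gtr0_norm// mulrC -ler_pdivlMr ?exprn_gt0//.
move=> H; apply: le_trans H _; rewrite -mulrA -exprMn -exprVn.
by rewrite /r invf_div mulrAC.
Qed.

Lemma ball_homogeneous_polynomial :
  exists p : mpoly N C, forall z, cball z -> g z = meval (fun i => z i 0) p.
Proof.
have [|p hp] := @homogeneous_entire_polyfun R N d G entireG growthG.
  (* [G_scale] covers positive factors only. At factor 0, Liouville settles [d = 0], and
     [G 0 = 2^d G 0] settles [d > 0]. *)
  move=> [|n] z; last first.
    have -> : (n.+1%:R : C) = (n.+1%:R : R)%:C%C by rewrite rmorph_nat.
    by rewrite G_scale// ltr0n.
  rewrite scale0r; have [d0|d0] := posnP d.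
    rewrite d0 expr0 mul1r; have g0 : growth 0 G by have := growthG; rewrite d0.
    have := delta_growth0 z 0 entireG g0; rewrite /delta add0r => /eqP.
    by rewrite subr_eq0 => /eqP.
  have := @G_scale 2 0; rewrite scaler0 expr0n (gtn_eqF d0) mul0r => /(_ (ltr0n _ 2)) /eqP.
  rewrite -subr_eq0 -{1}[G 0]mul1r -mulrBl mulf_eq0 => /orP[|/eqP//].
  rewrite subr_eq0 => /eqP/(congr1 nc); rewrite ComplexField.Normc.normc1 ncX nc_real.
  rewrite ger0_norm// => /eqP; rewrite lt_eqF// exprn_egt1 ?ltr1n//.
  by rewrite -lt0n.
exists p => z zB; rewrite -hp (@G_def 1)//; first by rewrite rmorph1 expr1n invr1 mul1r scale1r.
by rewrite rmorph1 scale1r.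
Qed.

End HomogeneousOnBall.

(** * Polynomials on the ball *)

Section DifferentiableBridge.
Context {R : realType} {N : nat}.
Local Notation C := R[i].
Local Notation nc := (@ComplexField.Normc.normc R).
Local Notation V := ('cV[C]_N : normedModType C).
Implicit Types (f g : 'cV[C]_N -> C) (z h : 'cV[C]_N).

Lemma mx_norm_le_vn h : `|(h : V)| <= (vn h)%:C%C.
Proof.
rewrite -[leLHS]/(mx_norm h); have [->|/mx_norm_neq0[[i j] ->]] := eqVneq (mx_norm h) 0.
  by rewrite lecR vn_ge0.
by rewrite nc_def lecR (ord1 j) nc_le_vn.
Qed.

Lemma nbhs_vnP (P : 'cV[C]_N -> Prop) : (\forall h \near (0 : V), P h) ->
  exists2 d : R, 0 < d & forall h, vn h < d -> P h.
Proof.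
move=> /nbhs_ballP[e /= e0 eP].
(* A positive element for the order of the complex numbers is real. *)
have [d de] : exists d : R, e = d%:C%C.
  by exists (complex.Re e); case: e e0 {eP} => a b /=; rewrite ltcE /= => /andP[/eqP -> _].
move: e0 eP; rewrite de ltcR => d0 dP; exists d => // h hd; apply: dP.
rewrite mx_norm_ball /ball_ /= sub0r normrN.
by apply: le_lt_trans (mx_norm_le_vn h) _; rewrite ltcR.
Qed.

Lemma differentiable_vdiff f (z : V) : differentiable (f : V -> C^o) z -> vdiff f z.
Proof.
move=> df; pose D : {linear V -> C^o} := 'd (f : V -> C^o) z.
exists (fun i => D (delta_mx i 0)) => e e0.
have ltec : 0 < e%:C%C :> C by rewrite ltcR.
move/eqaddoP : (diff_locally df) => /(_ _ ltec) /nbhs_vnP[d d0 hd]; exists d => // h /hd.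
have -> : lin (fun i => D (delta_mx i 0)) h = D h.
  rewrite [in RHS](matrix_sum_delta h) linear_sum /=; apply: eq_bigr => i _.
  by rewrite big_ord1 linearZ /= mulrC.
rewrite -[X in `|X|]/(f (h + z) - (f z + D h)) [h + z]addrC opprD addrA.
move=> H; have {}H := le_trans H (ler_wpM2l (ltW ltec) (mx_norm_le_vn h)).
by move: H; rewrite nc_def -rmorphM /= lecR.
Qed.

(** Meant for [poly_on_ball p], which agrees with a polynomial only near the points of the ball. *)
Lemma near_differentiable (f g : V -> C^o) (z : V) :
  (\forall h \near (0 : V), f (h + z) = g (h + z)) -> f z = g z ->
  differentiable g z -> differentiable f z.
Proof.
move=> fg fgz dg.
have E : f \o shift z = cst (f z) + ('d g z : V -> C^o) +o_ (0 : V) id.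
  apply/eqaddoP => e e0; move/eqaddoP : (diff_locally dg) => /(_ _ e0).
  rewrite fgz; apply: filterS2 fg => h fgh.
  by rewrite -[X in `|X|]/(g (h + z) - (g z + 'd g z h)) -fgh.
have [cdg _] := (diff_locallyP _ _).1 dg.
have U := diff_unique cdg E.
have := conj cdg E; rewrite -{}U => H.
exact: (diff_locallyP z f).2 H.
Qed.

Lemma differentiable_meval (p : mpoly N C) (z : V) :
  differentiable ((fun z : 'cV[C]_N => meval (fun i => z i 0) p) : V -> C^o) z.
Proof.
elim/mpolyind: p => [|c m p _ _ IH].
  rewrite (_ : (fun z : 'cV[C]_N => _) = cst 0); first exact: differentiable_cst.
  by apply/funext => x; rewrite meval0.
rewrite (_ : (fun z : 'cV[C]_N => _) = (fun z : V => c * \prod_i z i 0 ^+ m i : C^o) +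
    (fun z : V => meval (fun i => z i 0) p : C^o)); last first.
  by apply/funext => x; rewrite mevalD mevalZ mevalX.
apply: differentiableD => //.
apply: (@differentiableM _ V (cst c) (fun z : V => \prod_i z i 0 ^+ m i)).
  exact: differentiable_cst.
elim: (index_enum _) => [|i s IHs].
  rewrite (_ : (fun z : V => _) = cst 1); first exact: differentiable_cst.
  by apply/funext => x; rewrite big_nil.
rewrite (_ : (fun z : V => _) = (fun z : V => z i 0 ^+ m i) *
    (fun z : V => \prod_(i <- s) z i 0 ^+ m i)); last first.
  by apply/funext => x; rewrite big_cons.
apply: differentiableM => //.
elim: (m i) => [|n IHn]; first exact: differentiable_cst.
rewrite (_ : (fun z : V => _) = (fun z : V => z i 0 : C) * (fun z : V => z i 0 ^+ n)).
  by apply: differentiableM => //; exact: differentiable_coord.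
by apply/funext => x; rewrite exprS.
Qed.

Lemma near_cball (z : V) : cball z -> \forall h \near (0 : V), cball (h + z).
Proof.
move=> zB; pose r := 1 - sqnorm (z : 'cV[C]_N).
have r0 : 0 < r by rewrite subr_gt0.
(* If all coordinates of [h] are at most [d <= 1], then [|z + h|^2 <= |z|^2 + d (2 vn z + N)]; the
   added 1 makes the inequality strict. *)
pose K : R := 2 * vn z + N%:R + 1.
have K0 : 0 < K by rewrite ltr_wpDl// addr_ge0// mulr_ge0// vn_ge0.
pose d := Num.min 1 (r / K); have d0 : 0 < d by rewrite lt_min ltr01 divr_gt0.
have dr : d * K <= r by rewrite -ler_pdivlMr// ge_min lexx orbT.
have d1 : d <= 1 by rewrite ge_min lexx.
clearbody d; apply/nbhs_ballP; exists (d / N.+1%:R)%:C%C => /=.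
  by rewrite ltcR divr_gt0.
move=> h [_ hd].
have hi i : nc (h i 0) <= d / N.+1%:R.
  have : `|0 - h i 0| < (d / N.+1%:R)%:C%C by have := hd i 0; rewrite mxE.
  by rewrite sub0r normrN nc_def ltcR => /ltW.
have vh : vn h <= d.
  apply: (@le_trans _ _ (\sum_(i < N) d / N.+1%:R)); first exact: ler_sum.
  rewrite sumr_const card_ord -[_ *+ N]mulr_natl mulrCA ler_piMr ?(ltW d0)//.
  by rewrite ler_pdivrMr// mul1r ler_nat.
have hh i : nc (h i 0) <= d by exact: le_trans (nc_le_vn h i) vh.
rewrite /cball /=; apply: (@le_lt_trans _ _ (\sum_i (nc (z i 0) ^+ 2 + d * (2 * nc (z i 0) + 1)))).
  apply: ler_sum => i _; rewrite mxE.
  apply: (@le_trans _ _ ((d + nc (z i 0)) ^+ 2)).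
    rewrite ler_pXn2r ?nnegrE ?nc_ge0 ?addr_ge0 ?nc_ge0 ?(ltW d0)//.
    by apply: le_trans (ncD _ _) _; rewrite lerD2r.
  have : d * d <= d * 1 by rewrite ler_wpM2l// ltW.
  by rewrite sqrrD expr2; lra.
rewrite big_split /= -mulr_sumr big_split /= -mulr_sumr sumr_const card_ord.
rewrite -/(sqnorm (z : 'cV[C]_N)) -/(vn (z : 'cV[C]_N)).
have : d * (2 * vn z + N%:R) < d * K by rewrite ltr_pM2l// /K ltrDl.
move: dr; rewrite /r; lra.
Qed.

Lemma cball_coord_le1 (z : 'cV[C]_N) i : cball z -> nc (z i 0) <= 1.
Proof.
move=> zB; rewrite leNgt; apply/negP => h.
have : nc (z i 0) ^+ 2 <= sqnorm z.
  by rewrite /sqnorm (bigD1 i)//= lerDl sumr_ge0// => k _; exact: sqr_ge0.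
move=> /le_lt_trans/(_ zB); rewrite ltNge => /negP; apply.
by rewrite expr_ge1 ?nc_ge0// ltW.
Qed.

Lemma nc_meval_cball (p : mpoly N C) : exists K, forall z : 'cV[C]_N, cball z ->
  nc (meval (fun i => z i 0) p) <= K.
Proof.
exists (\sum_(m <- msupp p) nc (mcoeff m p)) => z zB; rewrite mevalE.
elim: (msupp p) => [|m s IH]; first by rewrite !big_nil nc0.
rewrite !big_cons; apply: le_trans (ncD _ _) _; rewrite lerD// ncM ler_piMr ?nc_ge0//.
elim/big_ind : _ => [|x y x1 y1|i _]; first by rewrite ComplexField.Normc.normc1.
  by rewrite ncM mulr_ile1 ?nc_ge0.
by rewrite ncX exprn_ile1 ?nc_ge0// cball_coord_le1.
Qed.

Lemma bergman_poly_on_ball (lambda : R) (p : mpoly N C) : -1 < lambda ->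
  bergman_space lambda (poly_on_ball p).
Proof.
move=> l1; have pE z : cball z -> poly_on_ball p z = meval (fun i => z i 0) p.
  by move=> zB; rewrite /poly_on_ball patchT// inE.
have p0 z : ~ cball z -> poly_on_ball p z = 0.
  by move=> zB; rewrite /poly_on_ball patchC// inE.
split => //.
- move=> z zB; apply: (near_differentiable _ (pE z zB)); last exact: differentiable_meval.
  by apply: filterS (near_cball zB) => h hB; exact: pE.
- have [K hK] := nc_meval_cball p.
  by apply: (bergman_sqnorm_lty (K := K)) => // z zB; rewrite pE ?hK.
Qed.

End DifferentiableBridge.

(** * Equivariance under the torus and under a reflection *)

Section TensorFactor.
Variables (K : fieldType) (m : nat) (k kappa : 'I_m -> nat) (j : 'I_m).
Local Notation N := (\sum_l k l)%N.
Local Notation V := (homog_factor k kappa K).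
Local Notation W := (mhomog_poly k kappa K).
Implicit Types (v w : forall l, V l) (a b : forall l, multinom (k l)).

Definition mon b : forall l, V l := fun l => mspanX K (homog_exponents (k l) (kappa l)) (b l).

Definition homog_index b := forall l, b l \in homog_exponents (k l) (kappa l).

Definition hcoef l (b : multinom (k l)) (x : V l) : K^o := mcoeff b (mspan_val x).

Lemma hcoef_linear l (b : multinom (k l)) c (x y : V l) :
  hcoef b (c *: x + y) = c * hcoef b x + hcoef b y.
Proof. by rewrite /hcoef -mcoeffZ -mcoeffD. Qed.

Lemma hcoef_mon a b l : homog_index a -> hcoef (b l) (mon a l) = (a l == b l)%:R.
Proof. by move=> ah; rewrite /hcoef /mon mspanXE ?mcoeffX//; exact: ah. Qed.

Lemma prod_multilinear (f : forall l, V l -> K^o) :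
  (forall l c (x y : V l), f l (c *: x + y) = c * f l x + f l y) ->
  multilinear (fun v => \prod_l f l (v l) : K^o).
Proof.
move=> fl v i c x y; rewrite !(bigD1 (P := predT) i) //= !eqtype.dfwith_in fl mulrDl.
rewrite -mulrA; congr (_ * (_ * _) + _ * _);
  by apply: eq_bigr => i' ii'; rewrite !eqtype.dfwith_out // eq_sym.
Qed.

Lemma mon_span l (x : V l) :
  x \in <<[seq (mspanX K (homog_exponents (k l) (kappa l)) g : V l)
           | g <- homog_exponents (k l) (kappa l)]>>%VS.
Proof. exact: homog_poly_span. Qed.

Lemma multilinear_mon (Z : lmodType K) (phi psi : (forall l, V l) -> Z) :
  multilinear phi -> multilinear psi ->
  (forall a, homog_index a -> phi (mon a) = psi (mon a)) -> phi =1 psi.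
Proof.
move=> mphi mpsi eq_mon; apply: (multilinear_ext mphi mpsi mon_span) => v vX.
have /fin_all_exists2[a ah aE] l := mapP (vX l).
have -> : v = mon a by apply: functional_extensionality_dep => l; rewrite aE.
exact: eq_mon.
Qed.

Lemma mcoeff_poly_prod v b : homog_index b ->
  mcoeff (mjoin b) (mspan_val (poly_prod v)) = \prod_l hcoef (b l) (v l).
Proof.
move=> bh; move: v.
apply: (@multilinear_mon K^o (fun v => mcoeff (mjoin b) (mspan_val (poly_prod v)))
   (fun v => \prod_l hcoef (b l) (v l))).
- by move=> v l c x y; rewrite poly_prod_multilinear mcoeffD mcoeffZ.
- by apply: (@prod_multilinear (fun l => @hcoef l (b l))) => l c x y; exact: hcoef_linear.
move=> a ah /=.
have -> : \prod_l block_poly (mspan_val (mon a l)) = mpolyX K (mjoin a).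
  rewrite -prod_block_polyX; apply: eq_bigr => l _; congr block_poly.
  by rewrite mspanXE //; exact: ah.
rewrite mcoeffX; have [ab|ab] := eqVneq (mjoin a) (mjoin b).
  rewrite big1// => l _; rewrite hcoef_mon// -(mjoinK a l) ab mjoinK eqxx//.
have [l al] : exists l, a l != b l.
  apply/existsP; apply: contraR ab; rewrite negb_exists => /forallP ab.
  apply/eqP; congr mjoin; apply: functional_extensionality_dep => l.
  by apply/eqP; move: (ab l); rewrite negbK.
by rewrite [RHS](bigD1 l)//= hcoef_mon// (negbTE al) mul0r.
Qed.

Lemma mhomog_ext (p q : W) :
  (forall b, homog_index b -> mcoeff (mjoin b) (mspan_val p) = mcoeff (mjoin b) (mspan_val q)) ->
  p = q.
Proof.
move=> pq; apply: val_inj; apply/mpolyP => c /=.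
have [ch|ch] := boolP (c \in mhomog_exponents k kappa).
  rewrite -(mblockK c); apply: pq => l; rewrite mem_homog_exponents.
  by move: ch; rewrite mem_mhomog_exponents => /forallP.
have out (x : W) : mcoeff c (mspan_val x) = 0.
  by apply/eqP; rewrite mcoeff_eq0; apply: contra ch; apply/allP; case: x.
by rewrite !out.
Qed.


(** An abstract form of [T] on one multidegree: [S_diag] is what the torus provides, and [S_w] is
    what the block reflection provides by carrying [mon e] to [w]. *)
Variable S : {linear W -> W}.

Hypothesis S_diag : forall a b, homog_index a -> homog_index b ->
  (exists2 l, l != j & a l != b l) ->
  mcoeff (mjoin b) (mspan_val (S (poly_prod (mon a)))) = 0.

Variables (e : forall l, multinom (k l)) (w : forall l, V l).
Hypothesis eh : homog_index e.
Hypothesis w_neq0 : forall l (b : multinom (k l)), l != j ->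
  b \in homog_exponents (k l) (kappa l) -> hcoef b (w l) != 0.
Hypothesis S_w : forall q q' : V j,
  S (poly_prod (eqtype.dfwith (mon e) q)) = poly_prod (eqtype.dfwith (mon e) q') ->
  S (poly_prod (eqtype.dfwith w q)) = poly_prod (eqtype.dfwith w q').

(** The coefficient at [b j] of [M_b q], where [M_b] is the operator on block [j] attached to the
    exponents of [b] in the other blocks. *)
Let Nb b (q : V j) : K^o := mcoeff (mjoin b) (mspan_val (S (poly_prod (eqtype.dfwith (mon b) q)))).

Let Nb_linear b c (x y : V j) : Nb b (c *: x + y) = c * Nb b x + Nb b y.
Proof. by rewrite /Nb poly_prod_multilinear linearP /= mcoeffD mcoeffZ. Qed.

Let f b l : V l -> K^o := eqtype.dfwith (fun l (x : V l) => hcoef (b l) x) (Nb b) l.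

Let f_linear b l c (x y : V l) : f b (c *: x + y) = c * f b x + f b y.
Proof.
rewrite /f; case: eqtype.dfwithP x y => [|l' lj] x y; last exact: hcoef_linear.
exact: Nb_linear.
Qed.

(** Both sides are multilinear in [v], so monomials suffice. If their exponents agree with [b] off
    block [j], this is the definition of [Nb]; otherwise both sides vanish, the left one by
    [S_diag]. *)
Let S_coef b v : homog_index b ->
  mcoeff (mjoin b) (mspan_val (S (poly_prod v))) = \prod_l f b (v l).
Proof.
move=> bh; move: v; apply: (@multilinear_mon K^o
   (fun v => mcoeff (mjoin b) (mspan_val (S (poly_prod v))))
   (fun v => \prod_l f b (v l))).
- by move=> v l c x y; rewrite poly_prod_multilinear linearP /= mcoeffD mcoeffZ.
- by apply: (@prod_multilinear (f b)) => l c x y; exact: f_linear.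
move=> a ah; rewrite [RHS](bigD1 j)//= {1}/f eqtype.dfwith_in.
have [/forallP/= ab|] := boolP [forall l, (l != j) ==> (a l == b l)].
  rewrite [X in _ = _ * X]big1 ?mulr1 => [|l lj]; last first.
    rewrite /f eqtype.dfwith_out 1?eq_sym// hcoef_mon//.
    by have /implyP/(_ lj)/eqP -> := ab l; rewrite eqxx.
  rewrite /Nb; congr (mcoeff _ (mspan_val (S (poly_prod _)))).
  apply: functional_extensionality_dep => l.
  case: eqtype.dfwithP => [//|l' lj]; rewrite /mon.
  by have := ab l'; rewrite eq_sym lj => /eqP ->.
rewrite negb_forall => /existsP[l]; rewrite negb_imply => /andP[lj lab].
rewrite S_diag//; last by exists l.
rewrite [X in _ = _ * X](bigD1 l)//= {1}/f eqtype.dfwith_out 1?eq_sym// hcoef_mon// (negbTE lab).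
by rewrite mul0r mulr0.
Qed.

Let eg (g : multinom (k j)) : forall l, multinom (k l) := eqtype.dfwith e g.

(** The operator attached to the reference exponents [e], assembled from its coefficients. *)
Let M_fun (q : V j) : V j :=
  \sum_(g <- undup (homog_exponents (k j) (kappa j)))
     Nb (eg g) q *: (mspanX K (homog_exponents (k j) (kappa j)) g : V j).

Let M_linear : linear M_fun.
Proof.
move=> c x y; rewrite /M_fun scaler_sumr -big_split /=; apply: eq_bigr => g _.
by rewrite Nb_linear scalerDl scalerA.
Qed.

Let M_linear' := GRing.isLinear.Build K (V j) (V j) _ M_fun M_linear.
Let M_lin : {linear V j -> V j} := HB.pack M_fun M_linear'.

Definition tensor_factor_map : 'End(V j) := linfun M_lin.
Local Notation M := tensor_factor_map.

Let hcoef_M g q : g \in homog_exponents (k j) (kappa j) -> hcoef g (M q) = Nb (eg g) q.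
Proof.
move=> gh; rewrite lfunE /= /M_fun.
have hsum (s : seq (multinom (k j))) (F : multinom (k j) -> V j) :
    hcoef g (\sum_(h <- s) F h) = \sum_(h <- s) hcoef g (F h).
  elim: s => [|h s IH]; first by rewrite !big_nil /hcoef /= mcoeff0.
  by rewrite !big_cons -[F h]scale1r hcoef_linear mul1r IH !scale1r.
rewrite hsum (bigD1_seq g) ?mem_undup ?undup_uniq //=.
have hz c h : h \in homog_exponents (k j) (kappa j) ->
    hcoef g (c *: (mspanX K (homog_exponents (k j) (kappa j)) h : V j)) = c * (h == g)%:R.
  by move=> hh; rewrite /hcoef mspan_valZ mcoeffZ mspanXE// mcoeffX.
rewrite hz// eqxx mulr1 big_seq_cond big1 ?addr0// => h; rewrite mem_undup => /andP[hh hg].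
by rewrite hz// (negbTE hg) mulr0.
Qed.

Let S_e q : S (poly_prod (eqtype.dfwith (mon e) q)) = poly_prod (eqtype.dfwith (mon e) (M q)).
Proof.
apply: mhomog_ext => b bh; rewrite S_coef// mcoeff_poly_prod//.
rewrite [LHS](bigD1 j)//= [RHS](bigD1 j)//= {1}/f !eqtype.dfwith_in hcoef_M; last exact: bh.
have [/forallP/= eb|] := boolP [forall l, (l != j) ==> (e l == b l)]; last first.
  rewrite negb_forall => /existsP[l]; rewrite negb_imply => /andP[lj leb].
  rewrite [X in _ * X = _](bigD1 l)//= [X in _ = _ * X](bigD1 l)//= /f !eqtype.dfwith_out 1?eq_sym// hcoef_mon// (negbTE leb).
  by rewrite !mul0r !mulr0.
congr (_ * _); last first.
  by apply: eq_bigr => l lj; rewrite /f !eqtype.dfwith_out 1?eq_sym.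
rewrite (_ : eg (b j) = b)//; apply: functional_extensionality_dep => l.
rewrite /eg; case: eqtype.dfwithP => [//|l' lj].
by have := eb l'; rewrite eq_sym lj => /eqP.
Qed.

(** The independence of the exponents: the coefficient of [S (w q)] at [b] is computed once by
    [S_coef] and once by [S_w]. Both contain the same product of coefficients of [w], which is
    nonzero and cancels. *)
Let Nb_M b q : homog_index b -> Nb b q = hcoef (b j) (M q).
Proof.
move=> bh; have := S_w (S_e q) => /(congr1 (fun p => mcoeff (mjoin b) (mspan_val p))).
rewrite S_coef// mcoeff_poly_prod//.
rewrite [X in X = _ -> _](bigD1 j)//= [X in _ = X -> _](bigD1 j)//= {1}/f !eqtype.dfwith_in.
have -> : \prod_(l | l != j) f b (eqtype.dfwith w q l) = \prod_(l | l != j) hcoef (b l) (w l).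
  by apply: eq_bigr => l lj; rewrite /f !eqtype.dfwith_out 1?eq_sym.
have -> : \prod_(l | l != j) hcoef (b l) (eqtype.dfwith w (M q) l) =
     \prod_(l | l != j) hcoef (b l) (w l).
  by apply: eq_bigr => l lj; rewrite !eqtype.dfwith_out 1?eq_sym.
by apply: mulIf; apply/prodf_neq0 => l lj; apply: w_neq0.
Qed.

Lemma tensor_factor p :
  let U := poly_tensor k kappa K in
  S p = (U \o tmap_at (V := V) tensor_factor_map \o U^-1)%VF p.
Proof.
move=> U.
have SU : (linfun S \o U = U \o tmap_at (V := V) M)%VF.
  apply: tensor_ext => v; rewrite !comp_lfunE lfunE /= /tmap_at tmap_pure !poly_tensor_pure.
  apply: mhomog_ext => b bh; rewrite S_coef// mcoeff_poly_prod//.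
  rewrite [LHS](bigD1 j)//= [RHS](bigD1 j)//= {1}/f !eqtype.dfwith_in Nb_M//; congr (_ * _).
  by apply: eq_bigr => l lj; rewrite /f !eqtype.dfwith_out 1?eq_sym// id_lfunE.
have [U' UK U'K] := poly_tensor_bij k kappa K.
have kU : lker U == 0%VS by apply/lker0P; exact: can_inj UK.
have -> : p = U ((U^-1)%VF p).
  rewrite -[in RHS](U'K p) -/U lker0_lfunK// U'K//.
rewrite -[S _]/(S (U _)) -(lfunE S) -comp_lfunE SU !comp_lfunE.
by rewrite lker0_lfunK.
Qed.

End TensorFactor.

Section Dilation.
Variables (K : comNzRingType) (n : nat).
Implicit Types (p : mpoly n K) (t v : 'I_n -> K) (b : multinom n).

(** Substitution of [t i * z i], written on coefficients because the torus is diagonal on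
    monomials. *)
Definition dilation t p : mpoly n K :=
  \sum_(b <- msupp p) (mcoeff b p * \prod_i t i ^+ b i) *: mpolyX K b.

Lemma mcoeff_dilation t p b : mcoeff b (dilation t p) = mcoeff b p * \prod_i t i ^+ b i.
Proof.
rewrite /dilation raddf_sum /=.
have [bp|bp] := boolP (b \in msupp p).
  rewrite (bigD1_seq b) ?msupp_uniq//= mcoeffZ mcoeffX eqxx mulr1 [X in _ + X]big1 ?addr0// => c cb.
  by rewrite mcoeffZ mcoeffX (negbTE cb) mulr0.
rewrite (memN_msupp_eq0 bp) mul0r big_seq big1// => c cp.
by rewrite mcoeffZ mcoeffX; case: eqP cp bp => [-> ->//|_ _ _]; rewrite mulr0.
Qed.

Lemma meval_dilation t p v : meval v (dilation t p) = meval (fun i => t i * v i) p.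
Proof.
rewrite /dilation raddf_sum /= [RHS]mevalE; apply: eq_bigr => b _.
rewrite mevalZ mevalX -mulrA; congr (_ * _); rewrite -big_split /=.
by apply: eq_bigr => i _; rewrite exprMn.
Qed.

End Dilation.

Section BallPolynomials.
Context {R : realType} {N : nat}.
Local Notation C := R[i].
Local Notation nc := (@ComplexField.Normc.normc R).
Implicit Types (p q : mpoly N C) (z : 'cV[C]_N).

Definition scale_by (t : 'I_N -> C) z : 'cV[C]_N := \col_i (t i * z i 0).

Lemma cball_scale_by t z : (forall i, nc (t i) <= 1) -> cball z -> cball (scale_by t z).
Proof.
move=> t1; apply: le_lt_trans; apply: ler_sum => i _; rewrite mxE ncM exprMn.
by rewrite ler_piMl ?sqr_ge0// exprn_ile1 ?nc_ge0.
Qed.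

Lemma meval_scale_by t p z :
  meval (fun i => scale_by t z i 0) p = meval (fun i => z i 0) (dilation t p).
Proof. by rewrite meval_dilation; apply: meval_eq => i; rewrite mxE. Qed.

Let half1 : nc (2^-1 : C) <= 1.
Proof.
rewrite ComplexField.Normc.normcV invf_le1.
  by rewrite -(rmorph_nat (real_complex R)) nc_real ger0_norm// ler1n.
by rewrite nc_gt0 pnatr_eq0.
Qed.

(* If two monomials of [p] differ in the exponent of the [i]-th variable, then
   [p (z_1, .., z_i / 2, .., z_n) - p z / 2 ^ (a i)] vanishes on the ball too
   and has fewer monomials. *)
Lemma mpoly_ball_eq0 p : (forall z, cball z -> meval (fun i => z i 0) p = 0) -> p = 0.
Proof.
have [n] := ubnP (size (msupp p)); elim: n p => // n IH p hn p0.
have [//|/eqP pn0] := eqVneq p 0.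
have : msupp p != [::] by rewrite msupp_eq0; apply/eqP.
case E : (msupp p) => [//|a s] _.
have ap : mcoeff a p != 0 by rewrite -mcoeff_msupp E mem_head.
case: s E => [|b s] E.
  have pE : p = mcoeff a p *: mpolyX C a by rewrite {1}[p]mpolyE E big_seq1.
  (* The constant vector [c] lies in the ball, as [N c < 1], and has no zero coordinate, so no
     monomial vanishes there. *)
  pose c : R := (N%:R + 1)^-1 / 2.
  have c0 : 0 < c by rewrite divr_gt0// invr_gt0 ltr_wpDl.
  pose z : 'cV[C]_N := const_mx c%:C%C.
  have zB : cball z.
    apply: vn_lt1_cball; rewrite /vn (eq_bigr (fun=> c)) => [|i _]; last first.
      by rewrite mxE nc_real gtr0_norm.
    rewrite sumr_const card_ord -[_ *+ N]mulr_natr /c mulrAC ltr_pdivrMr// mul1r.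
    rewrite mulrC ltr_pdivrMr ?ltr_wpDl//; have : 0 <= N%:R :> R by []; lra.
  have /eqP := p0 z zB; rewrite {1}pE mevalZ mevalX mulf_eq0 (negbTE ap) /=.
  move=> /prodf_eq0/=[i _]; rewrite expf_eq0 mxE => /andP[_].
  by rewrite -nc_eq0 nc_real normr_eq0 gt_eqF.
have ab : a != b by have := msupp_uniq p; rewrite E /= inE negb_or => /andP[/andP[]].
have [i abi] : exists i, a i != b i.
  apply/existsP; apply: contraR ab; rewrite negb_exists => /forallP ab.
  by apply/eqP/mnmP => i; apply/eqP; move: (ab i); rewrite negbK.
pose t k : C := if k == i then 2^-1 else 1.
have t1 k : nc (t k) <= 1 by rewrite /t; case: eqP => _; rewrite ?half1 ?ComplexField.Normc.normc1.
have tprod (c : multinom N) : \prod_k t k ^+ c k = 2^-1 ^+ c i.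
  rewrite (bigD1 i)//= /t eqxx big1 ?mulr1// => k /negbTE ->; exact: expr1n.
pose q := dilation t p - 2^-1 ^+ a i *: p.
have qc c : mcoeff c q = mcoeff c p * (2^-1 ^+ c i - 2^-1 ^+ a i).
  by rewrite /q mcoeffB mcoeffZ mcoeff_dilation tprod; ring.
have sub : {subset msupp q <= [seq c <- msupp p | c != a]}.
  move=> c; rewrite mem_filter !mcoeff_msupp qc mulf_eq0 negb_or => /andP[-> c2].
  by rewrite andbT; apply: contra c2 => /eqP ->; rewrite subrr.
have q0 : q = 0.
  apply: IH => [|z zB].
    apply: leq_ltn_trans (uniq_leq_size (msupp_uniq q) sub) _.
    move: hn; rewrite size_filter E => hn /=; rewrite eqxx add0n.
    exact: leq_ltn_trans (count_size _ (b :: s)) hn.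
  rewrite mevalB mevalZ -meval_scale_by !p0 ?mulr0 ?subrr//.
  exact: cball_scale_by.
have bp : mcoeff b p != 0 by rewrite -mcoeff_msupp E !inE eqxx orbT.
have := qc b; rewrite q0 mcoeff0 => /esym/eqP; rewrite mulf_eq0 (negbTE bp) /=.
rewrite subr_eq0 !exprVn (inj_eq invr_inj) => /eqP h.
case/eqP: abi; apply/eqP; rewrite eq_sym -(@eqn_exp2l 2)// -(eqr_nat C).
by rewrite !natrX h.
Qed.

Lemma poly_on_ballE p z : cball z -> poly_on_ball p z = meval (fun i => z i 0) p.
Proof. by move=> zB; rewrite /poly_on_ball patchT// inE. Qed.

Lemma poly_on_ball0 p z : ~ cball z -> poly_on_ball p z = 0.
Proof. by move=> zB; rewrite /poly_on_ball patchC// inE. Qed.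

Lemma poly_on_ball_inj : injective (@poly_on_ball R N).
Proof.
move=> p q pq; apply/eqP; rewrite -subr_eq0; apply/eqP; apply: mpoly_ball_eq0 => z zB.
by rewrite mevalB -!poly_on_ballE// pq subrr.
Qed.

Lemma poly_on_ball_linear c p q :
  poly_on_ball (c *: p + q) = (fun z => c * poly_on_ball p z + poly_on_ball q z).
Proof.
apply/funext => z; have [zB|zB] := pselect (cball z).
  by rewrite !poly_on_ballE// mevalD mevalZ.
by rewrite !poly_on_ball0// mulr0 addr0.
Qed.

Lemma poly_on_ball_scale_by t p : (forall i, nc (t i) = 1) ->
  (fun z => poly_on_ball p (scale_by t z)) = poly_on_ball (dilation t p).
Proof.
move=> t1; have tB z : cball (scale_by t z) <-> cball z.
  rewrite /cball /= (_ : sqnorm (scale_by t z) = sqnorm z)//.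
  by apply: eq_bigr => i _; rewrite mxE ncM t1 mul1r.
apply/funext => z; have [zB|zB] := pselect (cball z).
  by rewrite !poly_on_ballE ?meval_scale_by//; apply/tB.
by rewrite !poly_on_ball0//; move/tB.
Qed.

Lemma ex_unit_root (n : nat) : (0 < n)%N -> exists t : C, nc t = 1 /\ t ^+ n = -1.
Proof.
move=> n0; exists (cexp (0 +i* (pi / n%:R))%C); split; first by rewrite nc_cexp /= expR0.
have cX (z : C) k : cexp z ^+ k = cexp (k%:R * z).
  elim: k => [|k IH]; first by rewrite expr0 mul0r cexp0.
  by rewrite exprSr IH -cexpD -natr1 mulrDl mul1r.
rewrite cX; have -> : n%:R * (0 +i* (pi / n%:R))%C = (0 +i* pi)%C :> C.
  rewrite -(rmorph_nat (real_complex R)); simpc.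
  by rewrite mulrC divfK// pnatr_eq0 -lt0n.
by rewrite /cexp /= expR0 cospi sinpi mulr0 mul1r -[RHS](rmorphN1 (real_complex R)).
Qed.

(** A unimodular [t] with [t^(b - a) = -1] gives [t^b = - t^a]; such [t] let the torus tell
    exponents apart. *)
Lemma unit_expr_inj (a b : nat) : a != b -> exists t : C, nc t = 1 /\ t ^+ a != t ^+ b.
Proof.
wlog ab : a b / (a < b)%N.
  move=> H ab; have [h|h|h] := ltngtP a b; first exact: H.
    by have [||t [t1 tab]] := H b a; rewrite 1?eq_sym//; exists t; split; rewrite // eq_sym.
  by move/eqP: ab.
move=> _; have [t [t1 tn]] : exists t : C, nc t = 1 /\ t ^+ (b - a) = -1.
  by apply: ex_unit_root; rewrite subn_gt0.
exists t; split => //; rewrite -(subnK (ltnW ab)) exprD tn mulN1r -subr_eq0 opprK -mulr2n.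
by rewrite mulrn_eq0 /= expf_neq0// -nc_gt0 t1.
Qed.

End BallPolynomials.

(** * Powers of linear forms with positive coefficients *)

Section LinearFormPowers.
Context {R : realType} {n : nat}.
Local Notation C := R[i].
Implicit Types (p q : mpoly n C).

Definition linform (u : 'I_n -> C) : mpoly n C := \sum_i u i *: mpolyX C (mnm1 i).

Lemma meval_linform u v : meval v (linform u) = \sum_i u i * v i.
Proof.
by rewrite /linform raddf_sum; apply: eq_bigr => i _; rewrite /= mevalZ mevalXU.
Qed.

Lemma msupp_linformX u d b : b \in msupp (linform u ^+ d) -> mdeg b = d.
Proof.
elim: d b => [|d IH] b; first by rewrite expr0 msupp1 inE => /eqP ->; rewrite mdeg0.
rewrite exprS => /msuppM_le/allpairsP[[b1 b2] /= [b1u /IH <- ->]]; rewrite mdegD.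
suff -> : mdeg b1 = 1%N by rewrite add1n.
move: b1u; rewrite mcoeff_msupp /linform raddf_sum /= => h.
have [i hi] : exists i, mcoeff b1 (u i *: mpolyX C (mnm1 i)) != 0.
  apply/existsP; apply: contraR h; rewrite negb_exists => /forallP h.
  by rewrite big1// => i _; apply/eqP; move: (h i); rewrite negbK.
move: hi; rewrite mcoeffZ mcoeffX; have [<- _|_] := eqVneq (mnm1 i) b1; first by rewrite mdeg1.
by rewrite mulr0 eqxx.
Qed.

Definition coef_nneg p := forall b, 0 <= mcoeff b p.

Lemma coef_nnegM p q : coef_nneg p -> coef_nneg q -> coef_nneg (p * q).
Proof. by move=> p0 q0 b; rewrite mcoeffM; apply: sumr_ge0 => i _; exact: mulr_ge0. Qed.

Lemma coef_nneg_sum (u : 'I_n -> C) (P : pred 'I_n) : (forall i, 0 < u i) ->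
  coef_nneg (\sum_(i | P i) u i *: mpolyX C (mnm1 i)).
Proof.
move=> u0 b; rewrite raddf_sum; apply: sumr_ge0 => i _ /=.
by rewrite mcoeffZ mcoeffX mulr_ge0 ?ler0n// ltW.
Qed.

Lemma coef_nneg_linformX u d : (forall i, 0 < u i) -> coef_nneg (linform u ^+ d).
Proof.
move=> u0; elim: d => [|d IH]; first by move=> b; rewrite expr0 mcoeff1 ler0n.
by rewrite exprS; apply: coef_nnegM => //; exact: coef_nneg_sum.
Qed.

(** Nonnegative coefficients cannot cancel, so one positive contribution suffices: remove one
    variable occurring in [b] and use induction. *)
Lemma mcoeff_linformX_gt0 u d b : (forall i, 0 < u i) -> mdeg b = d ->
  0 < mcoeff b (linform u ^+ d).
Proof.
move=> u0; elim: d b => [|d IH] b.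
  by move/eqP; rewrite mdeg_eq0 => /eqP ->; rewrite expr0 mcoeff1 eqxx ltr01.
move=> bd; have [i bi] : exists i, b i != 0%N.
  apply/existsP; rewrite -[[exists _, _]]negbK negb_exists; apply/negP => /forallP h.
  suff b0 : b = mnm0 by move: bd; rewrite b0 mdeg0.
  by apply/mnmP => i; rewrite mnm0E; apply/eqP; move: (h i); rewrite negbK.
pose b' := mnm_sub b (mnm1 i).
have bE : b = mnm_add (mnm1 i) b'.
  apply/mnmP => i'; rewrite mnmDE mnmBE mnm1E; case: eqP => [<-|_]; last by rewrite subn0.
  by rewrite subnKC// lt0n.
have b'd : mdeg b' = d by move: bd; rewrite bE mdegD mdeg1 add1n => -[].
rewrite exprS {1}/linform (bigD1 i)//= mulrDl mcoeffD.
apply: ltr_wpDr.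
  by apply: coef_nnegM; [exact: coef_nneg_sum|exact: coef_nneg_linformX].
rewrite -scalerAl mcoeffZ mulr_gt0// mulrC bE mcoeffMX; exact: IH.
Qed.

End LinearFormPowers.

Section Reflection.
Context {R : realType} {n : nat}.
Local Notation C := R[i].

(* The reflection along [v = (n + 1, 1, .., 1)], with [n + 1] at position [i0]. *)
Lemma unitary_involution_pos_row (i0 : 'I_n) : exists A : 'M[C]_n,
  [/\ A *m A = 1%:M, A \is unitarymx & forall i, 0 < A i0 i].
Proof.
pose x (i : 'I_n) : nat := if i == i0 then n.+1 else 1%N.
pose v : 'cV[C]_n := \col_i (x i)%:R.
pose s : nat := (\sum_i x i ^ 2)%N.
have vv : v^T *m v = (s%:R)%:M.
  apply/matrixP => a b; rewrite !ord1 !mxE eqxx mulr1n /s natr_sum.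
  by apply: eq_bigr => i _; rewrite !mxE -natrM expnS expn1.
(* The large entry [n + 1] gives [s < 2 (n + 1)^2], which makes the diagonal entry
   [2 (n + 1)^2 / s - 1] positive; the rest of the row is positive outright. *)
have sE : s = (n.+1 ^ 2 + n.-1)%N.
  rewrite /s (bigD1 i0)//= /x eqxx; congr (_ + _)%N.
  rewrite (eq_bigr (fun=> 1%N)) => [|i /negbTE ->]; last by rewrite exp1n.
  by rewrite sum1_card -[in RHS](card_ord n) -(cardC1 i0); apply: eq_card => i; rewrite !inE.
have s0 : (0 < s)%N by rewrite sE addn_gt0 expn_gt0.
have sC : (s%:R : C) != 0 by rewrite pnatr_eq0 -lt0n.
pose A : 'M[C]_n := (2 / s%:R) *: (v *m v^T) - 1%:M.
have AE i i' : A i i' = 2 / s%:R * ((x i)%:R * (x i')%:R) - (i == i')%:R.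
  by rewrite !mxE big_ord1 !mxE.
have AA : A *m A = 1%:M.
  rewrite mulmxBl mulmxBr !mul1mx mulmx1 -scalemxAl -scalemxAr mulmxA -(mulmxA v) vv.
  rewrite mul_mx_scalar -scalemxAl !scalerA /A.
  have -> : 2 / s%:R * (2 / s%:R * s%:R) = 2 / s%:R + 2 / s%:R :> C.
    by rewrite divfK// mulr_natr mulr2n.
  by rewrite scalerDl addrK subKr.
exists A; split => //.
  apply/unitarymxP; rewrite -[RHS]AA; congr (_ *m _); apply/matrixP => i i'.
  rewrite 2!mxE !AE rmorphB rmorphM fmorph_div !rmorph_nat rmorphM !rmorph_nat.
  by rewrite eq_sym [(x i')%:R * _]mulrC.
move=> i; rewrite AE subr_gt0.
have x0 : (0 < x i)%N by rewrite /x; case: ifP.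
have [ii|ii] := eqVneq i0 i; last first.
  by rewrite !mulr_gt0 ?invr_gt0 ?ltr0n//; rewrite /x; case: ifP.
rewrite -ii /x eqxx -natrM mulrAC ltr_pdivlMr ?ltr0n// mul1r -natrM ltr_nat sE.
rewrite mulnn mul2n -addnn ltn_add2l (leq_ltn_trans (leq_pred n))//.
by rewrite -mulnn leq_pmulr.
Qed.

End Reflection.

Section BlockMatrices.
Variables (F : fieldType) (m : nat) (k : 'I_m -> nat).
Local Notation N := (\sum_l k l)%N.
Implicit Types (B D : forall l, 'M[F]_(k l)).

Lemma mxdiag_mul_inv B D : (forall l, B l *m D l = 1%:M) -> mxdiag B *m mxdiag D = 1%:M.
Proof.
move=> BD; rewrite -[LHS]mulmx1 -[X in _ *m X]submxcolK -mulmxA !mul_mxdiag_mxcol.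
rewrite -[RHS]submxcolK; apply/eq_mxcolP => l.
by rewrite mulmxA BD mul1mx.
Qed.

Lemma invmx_mxdiag B D : (forall l, B l *m D l = 1%:M) -> invmx (mxdiag D) = mxdiag B.
Proof.
move=> /mxdiag_mul_inv BD; have [_ Du] := mulmx1_unit BD.
by rewrite -[LHS]mul1mx -BD mulmxK.
Qed.

Lemma mxdiag_mulE B (z : 'cV[F]_N) l i :
  (mxdiag B *m z) (tagnat.Rank l i) 0 = \sum_i' B l i i' * z (tagnat.Rank l i') 0.
Proof.
rewrite -[X in mxdiag B *m X]submxcolK mul_mxdiag_mxcol.
transitivity ((submxcol (\mxcol_l (B l *m submxcol z l)) l) i 0); first by rewrite !mxE.
by rewrite mxcolK mxE; apply: eq_bigr => i' _; rewrite mxE.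
Qed.

End BlockMatrices.

(** * Restriction of the intertwining operator to polynomials *)

Section Intertwining.
Context {R : realType} (lambda : R) (m : nat) (k : 'I_m -> nat) (j : 'I_m).
Local Notation C := R[i].
Local Notation nc := (@ComplexField.Normc.normc R).
Local Notation N := (\sum_l k l)%N.
Variable T : ('cV[C]_N -> C) -> 'cV[C]_N -> C.
Hypothesis lambda1 : -1 < lambda.
Hypothesis kpos : forall l, (0 < k l)%N.
Hypothesis hT : intertwining lambda (block_group k j) T.

Local Notation pob := (@poly_on_ball R N).

Let bergman_pob p : bergman_space lambda (pob p).
Proof. exact: bergman_poly_on_ball. Qed.

Lemma T_linear c p q : T (pob (c *: p + q)) = (fun z => c * T (pob p) z + T (pob q) z).
Proof. by case: hT => -[_ Tl _] _; rewrite poly_on_ball_linear Tl. Qed.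

Lemma T_scale c p : T (pob (c *: p)) = (fun z => c * T (pob p) z).
Proof.
rewrite (_ : c *: p = (c - 1) *: p + p); last by rewrite scalerBl scale1r subrK.
by rewrite T_linear; apply/funext => z; ring.
Qed.

(** [unitary_rep] substitutes the inverse matrix: [mxdiag D] is the group element and [mxdiag B]
    acts on the argument. *)
Lemma T_block (B D : forall l, 'M[C]_(k l)) p : (forall l, B l *m D l = 1%:M) ->
  block_group k j (mxdiag D) ->
  T (fun z => pob p (mxdiag B *m z)) = (fun z => T (pob p) (mxdiag B *m z)).
Proof.
move=> BD gD; case: hT => _ /(_ _ _ gD (bergman_pob p)).
by rewrite /unitary_rep (invmx_mxdiag BD).
Qed.

(** The diagonal matrices of the group: arbitrary phases off block [j], one common phase on it. *)
Definition admissible (t : 'I_N -> C) := (forall a, nc (t a) = 1) /\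
  exists t0, forall i, t (tagnat.Rank j i) = t0.

Lemma unitary_diag n (t : 'I_n -> C) : (forall i, nc (t i) = 1) ->
  diag_mx (\row_i t i) \is unitarymx.
Proof.
move=> t1; apply/unitarymxP; apply/matrixP => a b.
rewrite mul_diag_mx !mxE; have [->|ab] := eqVneq a b; last first.
  by rewrite mulr0n rmorph0 mulr0.
by rewrite mulr1n -normCK nc_def t1 rmorph1 expr1n.
Qed.

Lemma T_torus t p : admissible t ->
  T (fun z => pob p (scale_by t z)) = (fun z => T (pob p) (scale_by t z)).
Proof.
move=> [t1 [t0 tj]].
pose B l : 'M[C]_(k l) := diag_mx (\row_i t (tagnat.Rank l i)).
pose D l : 'M[C]_(k l) := diag_mx (\row_i (t (tagnat.Rank l i))^-1).
have tn0 a : t a != 0 by rewrite -nc_gt0 t1.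
have BE z : mxdiag B *m z = scale_by t z.
  apply/matrixP => a b; rewrite (ord1 b) -[a]tagnat.sigK tagnat.rankE mxdiag_mulE mxE.
  rewrite [LHS](bigD1 (tagged (tagnat.sig a)))//= [X in _ + X = _]big1 ?addr0 => [|i ia].
    by rewrite !mxE eqxx mulr1n.
  by rewrite !mxE eq_sym (negbTE ia) mulr0n mul0r.
have BD l : B l *m D l = 1%:M.
  apply/matrixP => a b; rewrite mul_diag_mx !mxE.
  by have [->|_] := eqVneq a b; rewrite ?mulr1n ?mulr0n ?mulr0// divff.
have := @T_block B D p BD.
have -> : (fun z => pob p (mxdiag B *m z)) = (fun z => pob p (scale_by t z)).
  by apply/funext => z; rewrite BE.
have -> : (fun z => T (pob p) (mxdiag B *m z)) = (fun z => T (pob p) (scale_by t z)).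
  by apply/funext => z; rewrite BE.
apply; exists D; split => // [l _|].
  by apply: unitary_diag => i; rewrite ComplexField.Normc.normcV t1 invr1.
exists t0^-1.
  (* Block [j] is nonempty, so [t0] is a value of [t] and hence unimodular. *)
  have i0 : 'I_(k j) := Ordinal (kpos j).
  by rewrite normfV -(tj i0) nc_def t1 invr1.
apply/matrixP => a b; by rewrite !mxE tj.
Qed.

Lemma T_dilation t p : admissible t -> T (pob (dilation t p)) = (fun z => T (pob p) (scale_by t z)).
Proof. by move=> ta; rewrite -T_torus// poly_on_ball_scale_by//; case: ta. Qed.

(** Unimodular scalar matrices belong to the group, so [T] keeps the circle homogeneity of degree
    [d] and [ball_homogeneous_polynomial] applies. *)
Lemma T_polynomial d p : (forall b, b \in msupp p -> mdeg b = d) ->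
  exists q, T (pob p) = pob q.
Proof.
move=> pd; have [Tb _ _] := hT.1.
have [Tdiff T0 _] := Tb _ (bergman_pob p).
have dil (c : C) : dilation (fun=> c) p = c ^+ d *: p.
  apply/mpolyP => b; rewrite mcoeff_dilation mcoeffZ mulrC.
  have [bp|bp] := boolP (b \in msupp p); last by rewrite (memN_msupp_eq0 bp) !mulr0.
  congr (_ * _); rewrite -(pd b bp) mdegE.
  by rewrite (big_morph (fun n => c ^+ n) (exprD c) (expr0 c)).
have [||q hq] := @ball_homogeneous_polynomial R N (T (pob p)) d.
- by move=> z zB; apply: differentiable_vdiff; exact: Tdiff.
- move=> c z c1 _; have ta : admissible (fun=> c) by split => //; exists c.
  have := T_dilation p ta; rewrite dil T_scale => /(congr1 (fun f => f z)) ->.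
  by congr (T _ _); apply/matrixP => a b; rewrite !mxE (ord1 b).
exists q; apply/funext => z; have [zB|zB] := pselect (cball z).
  by rewrite hq// poly_on_ballE.
by rewrite T0// poly_on_ball0.
Qed.

Lemma T_torus_coef t c p q : admissible t -> T (pob p) = pob q -> dilation t p = c *: p ->
  forall b, mcoeff b q * \prod_a t a ^+ b a = c * mcoeff b q.
Proof.
move=> ta Tp tp b; have := T_dilation p ta; rewrite tp T_scale Tp.
rewrite poly_on_ball_scale_by; last by case: ta.
have -> : (fun z => c * pob q z) = pob (c *: q).
  apply/funext => z; have [zB|zB] := pselect (cball z).
    by rewrite !poly_on_ballE// mevalZ.
  by rewrite !poly_on_ball0// mulr0.
by move/poly_on_ball_inj => /(congr1 (mcoeff b)); rewrite mcoeffZ mcoeff_dilation => ->.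
Qed.

Variable kappa : 'I_m -> nat.
Local Notation W := (mhomog_poly k kappa C).

Lemma prod_block_expr l (t : C) (b : multinom N) :
  \prod_a (if tag (tagnat.sig a) == l then t else 1) ^+ b a = t ^+ mdeg (mblock l b).
Proof.
rewrite mdegE (big_morph (fun n => t ^+ n) (exprD t) (expr0 t)).
rewrite (reindex _ tagnat.rank_bij_on) /=.
transitivity (\prod_l' \prod_(i < k l')
   ((if l' == l then t else 1) ^+ b (tagnat.Rank l' i))).
  rewrite sig_big_dep /=; apply: eq_bigr => -[l' i] _ /=.
  by rewrite tagnat.rankK.
rewrite [LHS](bigD1 l)//= [X in _ * X = _]big1 ?mulr1 => [|l' /negbTE l'l]; last first.
  by rewrite l'l big1// => i _; rewrite expr1n.
by rewrite eqxx; apply: eq_bigr => i _; rewrite mnmE.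
Qed.

Lemma T_mhomog (p : W) : exists q : W, T (pob (mspan_val p)) = pob (mspan_val q).
Proof.
have ph b : b \in msupp (mspan_val p) -> forall l, mdeg (mblock l b) = kappa l.
  case: p => p /= /allP ph /ph; rewrite /= mem_mhomog_exponents => /forallP h l.
  exact/eqP.
have [q Tq] : exists q, T (pob (mspan_val p)) = pob q.
  apply: (@T_polynomial (\sum_l kappa l)%N) => b /ph bh.
  by rewrite mdeg_mblock; apply: eq_bigr => l _.
suff qh : q \in mspan_pred (mhomog_exponents k kappa) by exists (MSpan qh).
apply/allP => b bq /=; rewrite mem_mhomog_exponents; apply/forallP => l.
have [//|/(@unit_expr_inj R)[t [t1 tb]]] := eqVneq (mdeg (mblock l b)) (kappa l).
(* The circle acting on block [l] alone; it is admissible for [l = j] too, being scalar there. *)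
pose tt (a : 'I_N) : C := if tag (tagnat.sig a) == l then t else 1.
have tta : admissible tt.
  split=> [a|]; first by rewrite /tt; case: ifP; rewrite ?ComplexField.Normc.normc1.
  exists (if j == l then t else 1) => i; rewrite /tt.
  by rewrite [tagnat.sig _](tagnat.rankK (Tagged _ i)).
have dil : dilation tt (mspan_val p) = t ^+ kappa l *: mspan_val p.
  apply/mpolyP => c; rewrite mcoeff_dilation mcoeffZ mulrC prod_block_expr.
  have [cp|cp] := boolP (c \in msupp (mspan_val p)).
    by rewrite (ph _ cp).
  by rewrite (memN_msupp_eq0 cp) !mulr0.
have := T_torus_coef tta Tq dil b; rewrite prod_block_expr mulrC => /eqP.
rewrite -subr_eq0 -mulrBl mulf_eq0 subr_eq0 (negbTE tb) /=.
by move: bq; rewrite mcoeff_msupp => /negbTE ->.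
Qed.

(** The chosen polynomial is unique because [poly_on_ball] is injective; linearity rests on this. *)
Definition T_fun (p : W) : W := sval (cid (T_mhomog p)).

Lemma T_funE (p : W) : T (pob (mspan_val p)) = pob (mspan_val (T_fun p)).
Proof. exact: svalP (cid (T_mhomog p)). Qed.

Lemma T_fun_eq (p q : W) : T (pob (mspan_val p)) = pob (mspan_val q) -> T_fun p = q.
Proof. by rewrite T_funE => /poly_on_ball_inj h; apply: val_inj. Qed.

Lemma T_fun_linear : linear T_fun.
Proof.
move=> c p q; apply: T_fun_eq.
rewrite -[mspan_val (c *: p + q)]/(c *: mspan_val p + mspan_val q) T_linear.
by rewrite !T_funE -poly_on_ball_linear.
Qed.

Definition T_lin : {linear W -> W} :=
  HB.pack T_fun (GRing.isLinear.Build C W W _ T_fun T_fun_linear).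

Local Notation V := (homog_factor k kappa C).

(** Since [l != j], the circle acting on a single variable of block [l] is in the group. The image
    of the monomial is an eigenvector for it, so it has only monomials with the same exponent in
    that variable. *)
Lemma T_lin_diag (a b : forall l, multinom (k l)) :
  homog_index kappa a -> homog_index kappa b -> (exists2 l, l != j & a l != b l) ->
  mcoeff (mjoin b) (mspan_val (T_lin (poly_prod (mon C kappa a)))) = 0.
Proof.
move=> ah bh [l lj]; have [//|ab _] := eqVneq (a l) (b l).
have [i /(@unit_expr_inj R)[t [t1 tab]]] : exists i, a l i != b l i.
  apply/existsP; apply: contraR ab; rewrite negb_exists => /forallP h.
  by apply/eqP/mnmP => i; apply/eqP; move: (h i); rewrite negbK.
pose x := tagnat.Rank l i.
pose tt (y : 'I_N) : C := if y == x then t else 1.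
have tta : admissible tt.
  split=> [y|]; first by rewrite /tt; case: ifP; rewrite ?ComplexField.Normc.normc1.
  exists 1 => i'; rewrite /tt; case: eqP => // /(congr1 tagnat.sig).
  rewrite /x [LHS](tagnat.rankK (Tagged _ i')) [RHS](tagnat.rankK (Tagged _ i)).
  by move=> /(congr1 tag) /= jl; rewrite jl eqxx in lj.
have ttE (c : forall l, multinom (k l)) : \prod_y tt y ^+ mjoin c y = t ^+ c l i.
  rewrite [LHS](bigD1 x)//= [X in _ * X = _]big1 ?mulr1 => [|y /negbTE yx]; last by rewrite /tt yx expr1n.
  rewrite /tt eqxx mnmE; congr (_ ^+ _).
  by rewrite /x /tagnat.Rank tagnat.rankK.
have pE : mspan_val (poly_prod (mon C kappa a)) = mpolyX C (mjoin a).
  rewrite /= -prod_block_polyX; apply: eq_bigr => l' _; congr block_poly.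
  by rewrite mspanXE//; exact: ah.
have := T_torus_coef tta (T_funE (poly_prod (mon C kappa a))).
rewrite pE => /(_ (t ^+ a l i)).
have dil : dilation tt (mpolyX C (mjoin a)) = t ^+ a l i *: mpolyX C (mjoin a).
  apply/mpolyP => c; rewrite mcoeff_dilation mcoeffZ mcoeffX mulrC.
  by case: eqP => [<-|_]; rewrite ?mulr0 ?mulr1// ttE.
move=> /(_ dil (mjoin b)); rewrite ttE mulrC => /eqP.
rewrite -subr_eq0 -mulrBl mulf_eq0 subr_eq0 eq_sym (negbTE tab) /= => /eqP.
by [].
Qed.

Lemma sqnorm_unitary n (A : 'M[C]_n) (y : 'cV[C]_n) : A \is unitarymx ->
  sqnorm (A *m y) = sqnorm y.
Proof.
move=> /unitarymxP/mulmx1C AA.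
have sqE (x : 'cV[C]_n) : (sqnorm x)%:C%C = ((x^t*)%sesqui *m x) 0 0.
  rewrite /sqnorm rmorph_sum mxE; apply: eq_bigr => i _.
  by rewrite !mxE rmorphXn /= -nc_def normCKC.
apply: complexI; rewrite /= !sqE; congr (fun_of_matrix _ 0 0).
by rewrite trmx_mul map_mxM -mulmxA [X in _ *m X]mulmxA AA mul1mx.
Qed.

Lemma sqnorm_blocks (z : 'cV[C]_N) : sqnorm z = \sum_l sqnorm (submxcol z l).
Proof.
rewrite /sqnorm (reindex _ tagnat.rank_bij_on) /=.
transitivity (\sum_l \sum_(i < k l) nc (z (tagnat.Rank l i) 0) ^+ 2).
  by rewrite sig_big_dep /=; apply: eq_bigr => -[l i].
by apply: eq_bigr => l _; apply: eq_bigr => i _; rewrite mxE.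
Qed.

Lemma T_lin_factor : exists M : 'End(homog_poly C (k j) (kappa j)), forall p : W,
  T_lin p = (poly_tensor k kappa C \o tmap_at (V := V) M \o (poly_tensor k kappa C)^-1)%VF p.
Proof.
pose o l : 'I_(k l) := Ordinal (kpos l).
pose A l := sval (cid (unitary_involution_pos_row (R := R) (o l))).
have hA l : [/\ A l *m A l = 1%:M, A l \is unitarymx & forall i, 0 < A l (o l) i].
  exact: svalP (cid (unitary_involution_pos_row (R := R) (o l))).
(* The reference monomial is the power [kappa l] of the first variable of each block; the reflection
   turns it into the power [w l] of a positive linear form. *)
pose e l : multinom (k l) := mnm_muln (mnm1 (o l)) (kappa l).
have eh : homog_index kappa e.
  by move=> l; rewrite mem_homog_exponents mdegMn mdeg1 mul1n.
have wh l : linform (A l (o l)) ^+ kappa l \in mspan_pred (homog_exponents (k l) (kappa l)).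
  by apply/allP => b /msupp_linformX bd; rewrite /= mem_homog_exponents bd.
pose w l : V l := MSpan (wh l).
have w_neq0 l (b : multinom (k l)) : l != j ->
    b \in homog_exponents (k l) (kappa l) -> hcoef b (w l) != 0.
  rewrite mem_homog_exponents => _ /eqP bd; rewrite gt_eqF//.
  by apply: mcoeff_linformX_gt0 => //; have [] := hA l.
(* The reflections off block [j] with the identity on block [j]: a group element with phase 1 that
   leaves the factor in block [j] untouched. *)
pose B : forall l, 'M[C]_(k l) := eqtype.dfwith A (1%:M : 'M[C]_(k j)).
have BB l : B l *m B l = 1%:M.
  by rewrite /B; case: eqtype.dfwithP => [|l' _]; [rewrite mulmx1|have [] := hA l'].
have Bu l : B l \is unitarymx.
  rewrite /B; case: eqtype.dfwithP => [|l' _]; last by have [] := hA l'.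
  by apply/unitarymxP; rewrite trmx1 map_mx1 mulmx1.
have gB : block_group k j (mxdiag B).
  exists B; split => //; exists 1; first by rewrite normr1.
  by rewrite /B eqtype.dfwith_in.
(* The substitution must preserve the ball to be compatible with extension by 0. *)
have Bball z : cball (mxdiag B *m z) <-> cball z.
  rewrite /cball /= (_ : sqnorm (mxdiag B *m z) = sqnorm z)//.
  rewrite !sqnorm_blocks; apply: eq_bigr => l _; rewrite -[RHS](sqnorm_unitary _ (Bu l)).
  by rewrite -[X in mxdiag B *m X]submxcolK mul_mxdiag_mxcol mxcolK.
have Be (r : V j) : (fun z => pob (mspan_val (poly_prod (eqtype.dfwith (mon C kappa e) r)))
    (mxdiag B *m z)) = pob (mspan_val (poly_prod (eqtype.dfwith w r))).
  apply/funext => z; have [zB|zB] := pselect (cball z); last first.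
    have zB' : ~ cball (mxdiag B *m z) by move/Bball.
    by rewrite [RHS](poly_on_ball0 _ zB) (poly_on_ball0 _ zB').
  have zB' : cball (mxdiag B *m z) by exact/Bball.
  rewrite [RHS](poly_on_ballE _ zB) (poly_on_ballE _ zB').
  rewrite !meval_poly_prod; apply: eq_bigr => l _.
  have [->|lj] := eqVneq l j.
    rewrite !eqtype.dfwith_in; apply: meval_eq => i; rewrite mxdiag_mulE /B eqtype.dfwith_in.
    rewrite [LHS](bigD1 i)//= [X in _ + X = _]big1 ?addr0 => [|i' i'i].
      by rewrite mxE eqxx mul1r.
    by rewrite mxE eq_sym (negbTE i'i) mul0r.
  rewrite !eqtype.dfwith_out 1?eq_sym// /mon mspanXE; last exact: eh.
  rewrite /= -mpolyXn !rmorphXn /= mevalXU meval_linform mxdiag_mulE; congr (_ ^+ _).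
  by rewrite /B eqtype.dfwith_out 1?eq_sym.
have S_w (q q' : V j) :
    T_lin (poly_prod (eqtype.dfwith (mon C kappa e) q)) = poly_prod (eqtype.dfwith (mon C kappa e) q') ->
    T_lin (poly_prod (eqtype.dfwith w q)) = poly_prod (eqtype.dfwith w q').
  move=> hq; apply: T_fun_eq.
  have h1 := congr1 T (Be q).
  have h2 := T_block (mspan_val (poly_prod (eqtype.dfwith (mon C kappa e) q))) BB gB.
  have h3 := etrans (T_funE (poly_prod (eqtype.dfwith (mon C kappa e) q)))
    (congr1 (fun x : W => pob (mspan_val x)) hq).
  have h4 := congr1 (fun f z => f (mxdiag B *m z)) h3.
  exact: etrans (esym h1) (etrans h2 (etrans h4 (Be q'))).
eexists => p; exact: (tensor_factor T_lin_diag eh w_neq0 S_w).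
Qed.

End Intertwining.

Theorem proposition6p4 (R : realType) (lambda : R) (m : nat)
    (k : 'I_m -> nat) (j : 'I_m)
    (T : ('cV[R[i]]_(\sum_l k l) -> R[i]) -> 'cV[R[i]]_(\sum_l k l) -> R[i]) :
  -1 < lambda -> (2 <= m)%N -> (forall l, (0 < k l)%N) ->
  intertwining lambda (block_group k j) T ->
  forall kappa : 'I_m -> nat,
    T @` mhomog_on_ball k kappa `<=` mhomog_on_ball k kappa /\
    exists M : 'End(homog_poly R[i] (k j) (kappa j)),
      forall p : mhomog_poly k kappa R[i],
        let U := poly_tensor k kappa R[i] in
        T (poly_on_ball p) =
          poly_on_ball
            ((U \o tmap_at (V := homog_factor k kappa R[i]) M \o U^-1)%VF p).
Proof.
move=> lambda1 _ kpos hT kappa; split.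
  move=> _ [_ [p _ <-] <-]; have [q ->] := T_mhomog lambda1 kpos hT p.
  by exists q.
have [M hM] := T_lin_factor lambda1 kpos hT kappa; exists M => p U.
by rewrite (T_funE lambda1 kpos hT) -[T_fun _ _ _ _]/(T_lin lambda1 kpos hT kappa p) hM.
Qed.
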